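(* Let $q,K$ be positive integers, $p=2q-1$, $\lambda\ge0$, $k_q=\lambda^{1/(2q)}\pi K$. Let $\mathcal{K}(x,t)=h(k_q)\,\mathcal{W}\{h(k_q)x,h(k_q)t\}$ be the scaled equivalent kernel for spline estimators on $\mathbb{R}$, with bandwidth $h(k_q)$ given by $h(k_q)^{-1}=\int_0^K\{1+\lambda(\pi x)^{2q}\}^{-1}dx$. Then for all $x,t\in\mathbb{R}$ $$\begin{cases}c_1\mathcal{K}(c_1x,c_1t)=\mathcal{K}_{rs}(x,t)-k_q^{2q}\,\mathcal{K}_1(x,t), & k_q<1,\\ c_2\mathcal{K}(c_2x,c_2t)=\mathcal{K}_{ss}(x,t)+k_q^{1-2q}\,\mathcal{K}_2(x,t), & k_q\ge1,\end{cases}$$ where $\mathcal{K}_1$ and $\mathcal{K}_2$ (explicit formulas in the context) are bounded functions; $\mathcal{K}_{rs}$ is the asymptotic regression spline equivalent kernel on $\mathbb{R}$, $$\mathcal{K}_{rs}(x,t)=\sum_{j=1}^p\sum_{l=0}^{2p}\frac{\alpha_l(\{x\},\{t\})}{P_{2p}'(r_j)}\,r_j^{\,|d_{x,t}+l-1|+(2p-2)\mathbb{I}(d_{x,t}+l\le0)},$$ with $P_{2p}(u)=\Pi_{2p+1}(u)/(2p+1)!$, $r_j$ ($j=1,\ldots,p$) the roots of $P_{2p}$ with $|r_j|<1$, $d_{x,t}=\lfloor x\rfloor-\lfloor t\rfloor$, and $\alpha_l$ defined by $z^{p-d_{x,t}}\Phi_p(x+(p+1)/2,z)\Phi_p(t+(p+1)/2,z^{-1})=\sum_{l=0}^{2p}\alpha_l(\{x\},\{t\})z^l$;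 and $\mathcal{K}_{ss}$ is the asymptotic smoothing spline equivalent kernel on $\mathbb{R}$, $$\mathcal{K}_{ss}(x,t)=\sum_{j=0}^{q-1}\frac{\mathrm{i}\exp\left[\mathrm{i}|x-t|\exp\{\pi\mathrm{i}(2j+1)/(2q)\}\right]}{2q\exp\{\mathrm{i}\pi(2q-1)(2j+1)/(2q)\}} .$$
   Context: $\mathrm{i}=(-1)^{1/2}$; $\mathrm{sinc}(x)=\sin(x)/x$, $\mathrm{sinc}(0)=1$; $\lfloor t\rfloor$, $\{t\}=t-\lfloor t\rfloor$ integer and fractional parts; $\mathbb{I}(A)$ is $1$ if $A$ holds and $0$ otherwise; $\Re$ denotes real part. Euler--Frobenius polynomials: $\Pi_0=1$ and $\Pi_j$ ($j\ge1$, degree $j-1$) are defined by $\frac{z-1}{z-e^{s}}=\sum_{j\ge0}\frac{\Pi_j(z)}{(z-1)^j}\frac{s^j}{j!}$. Exponential splines: for $t\in\mathbb{R}$, $z\ne0,1$, $\Phi_p(t,z)=z^{\lfloor t\rfloor}(1-z^{-1})^p\sum_{j=0}^p\binom pj\frac{\{t\}^{p-j}\Pi_j(z)}{p!(z-1)^j}$ (convention $0^0=1$), and $\Phi_p(t,1)=1$. For an integer $m\ge0$, $Q_m(z)=\sum_{l=-\infty}^\infty \mathrm{sinc}\{\pi(z+l)\}^{m+2}$. For real $u,x$, $$\phi(u,x)=\frac{\Phi_p\big(Kx+(p+1)/2,\exp(-2\pi\mathrm{i}u/K)\big)}{\{Q_{2p}(u/K)\}^{1/2}},\quad \mu(u)=(2\pi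 u)^{2q}\,\mathrm{sinc}(\pi u/K)^{2q}\,\frac{Q_{2p-2q}(u/K)}{Q_{2p}(u/K)},$$ $$\mathcal{W}(x,t)=\int_0^K\frac{\phi(u,x)\overline{\phi(u,t)}}{1+\lambda\mu(u)}\,du .$$ Constants: $c_1=c_1(k_q)=k_q^{-1}\int_0^{k_q}(1+x^{2q})^{-1}dx$ for $k_q<1$ (with $c_1(0)=1$), so that $h(k_q)^{-1}=Kc_1$; $c_2=c_2(k_q)=\pi^{-1}\int_0^{k_q}(1+x^{2q})^{-1}dx$ for $k_q\ge1$, so that $h(k_q)^{-1}=\lambda^{-1/(2q)}c_2$. Remainder functions: for $k_q<1$, $$\mathcal{K}_1(x,t)=\Re\int_0^{1/2}\frac{2\cdot 2^{2q}\sin(\pi u)^{2q}\,Q_{2q-2}(u)\,\phi(Ku,x/K)\overline{\phi(Ku,t/K)}}{\pi^{2q}\,Q_{4q-2}(u)\{1+\lambda\mu(Ku)\}}\,du .$$ For $k_q\ge1$ and $v\in[0,k_q/2]$ define $r_1(v)$, $r_2(x,t,v)$ by $1+\lambda\mu(Kv/k_q)=\{1+(2v)^{2q}\}\{1+r_1(v)\}$ and $\phi(Kv/k_q,\lambda^{1/(2q)}x)\overline{\phi(Kv/k_q,\lambda^{1/(2q)}t)}=e^{2\mathrm{i}v(t-x)}\{1+r_2(x,t,v)\}$, put $r_q=(r_2-r_1)/(1+r_1)$, and $$\mathcal{K}_2(x,t)=k_q^{2q-1}\,\Re\int_0^{k_q/2}\frac{2e^{2\mathrm{i}v(t-x)}}{\pi\{1+(2v)^{2q}\}}\,r_q(x,t,v)\,dv-\int_1^\infty\frac{\cos\{k_qu(t-x)\}}{\pi(k_q^{-2q}+u^{2q})}\,du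 .$$ *)

(* Defs.v *)
From HB Require Import structures.
From mathcomp Require Import all_boot all_order all_algebra.
From mathcomp Require Import all_classical all_reals all_analysis.
From mathcomp Require Import complex.

Set Implicit Arguments.
Unset Strict Implicit.
Unset Printing Implicit Defensive.

Import Order.TTheory GRing.Theory Num.Theory.
Import numFieldNormedType.Exports.

Local Open Scope classical_set_scope.
Local Open Scope ring_scope.
Local Open Scope complex_scope.

Section SplineKernels.
Context {R : realType}.

Local Notation C := (R[i]).
Local Notation Re := complex.Re.
Local Notation Im := complex.Im.
Local Notation mu := (@lebesgue_measure R).

Definition cexp (z : C) : C := (expR (Re z))%:C * (cos (Im z) +i* sin (Im z)).

Definition cintegral (D : set R) (f : R -> C) : C :=
  (\int[mu]_(x in D) Re (f x)) +i* (\int[mu]_(x in D) Im (f x)).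

Definition fract (t : R) : R := t - (Num.floor t)%:~R.

Definition sinc (x : R) : R := if x == 0 then 1 else sin x / x.

(* The generating function is an identity in C for each z <> 1 and each small
   real s; it characterizes the sequence of polynomials uniquely. *)
Definition euler_frobenius_spec (P : nat -> {poly C}) : Prop :=
  [/\ P 0%N = 1, (forall j, (0 < j)%N -> size (P j) = j) &
    forall z : C, z != 1 -> \forall s \near (0 : R),
      (fun n => \sum_(0 <= j < n)
         (P j).[z] / (z - 1) ^+ j * (s%:C ^+ j / j`!%:R) : C^o) @ \oo -->
      ((z - 1) / (z - (expR s)%:C) : C^o)].

Definition Pi_ : nat -> {poly C} := xget (fun=> 0) euler_frobenius_spec.

Definition Phi (p : nat) (t : R) (z : C) : C :=
  if z == 1 then 1 else
  z ^ Num.floor t * (1 - z^-1) ^+ p *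
  \sum_(j < p.+1) 'C(p, j)%:R *
    ((fract t)%:C ^+ (p - j) * (Pi_ j).[z] / (p`!%:R * (z - 1) ^+ j)).

(* The bilateral sum over l in Z, as the sum over l >= 0 plus that over l < 0. *)
Definition Qsum (m : nat) (z : R) : R :=
  limn (series (fun l => sinc (pi * (z + l%:R)) ^+ (m + 2))) +
  limn (series (fun l => sinc (pi * (z - l.+1%:R)) ^+ (m + 2))).

Section Kernels.
Variables (q K : nat) (lambda : R).

Definition deg : nat := 2 * q - 1.
Local Notation p := deg.

Definition phi (u x : R) : C :=
  Phi p (K%:R * x + p.+1%:R / 2) (cexp (- 2 * pi%:C * 'i%C * u%:C / K%:R)) /
  (Num.sqrt (Qsum (2 * p) (u / K%:R)))%:C.

Definition penal (u : R) : R :=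
  (2 * pi * u) ^+ (2 * q) * sinc (pi * u / K%:R) ^+ (2 * q) *
  (Qsum (2 * p - 2 * q) (u / K%:R) / Qsum (2 * p) (u / K%:R)).

Definition Wker (x t : R) : C :=
  cintegral `[0, K%:R]
    (fun u => phi u x * (phi u t)^* / (1 + lambda * penal u)%:C).

(* lambda^(1/(2q)) *)
Definition lroot : R := lambda `^ (2 * q)%:R^-1.

Definition kq : R := lroot * pi * K%:R.

Definition bandwidth : R :=
  (\int[mu]_(x in `[0, K%:R]) (1 + lambda * (pi * x) ^+ (2 * q))^-1)^-1.

Definition eqkernel (x t : R) : C :=
  bandwidth%:C * Wker (bandwidth * x) (bandwidth * t).

Definition cst1 : R :=
  if kq == 0 then 1 else
  kq^-1 * \int[mu]_(x in `[0, kq]) (1 + x ^+ (2 * q))^-1.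

Definition cst2 : R := pi^-1 * \int[mu]_(x in `[0, kq]) (1 + x ^+ (2 * q))^-1.

Definition K1 (x t : R) : R :=
  Re (cintegral `[0, 2^-1] (fun u =>
    (2 * 2 ^+ (2 * q) * sin (pi * u) ^+ (2 * q) * Qsum (2 * q - 2) u)%:C *
    phi (K%:R * u) (x / K%:R) * (phi (K%:R * u) (t / K%:R))^* /
    (pi ^+ (2 * q) * Qsum (4 * q - 2) u * (1 + lambda * penal (K%:R * u)))%:C)).

Definition osc (x t v : R) : C := cexp (2 * 'i%C * v%:C * (t - x)%:C).

Definition r1 (v : R) : R :=
  (1 + lambda * penal (K%:R * v / kq)) / (1 + (2 * v) ^+ (2 * q)) - 1.

Definition r2 (x t v : R) : C :=
  phi (K%:R * v / kq) (lroot * x) * (phi (K%:R * v / kq) (lroot * t))^* /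
  osc x t v - 1.

Definition rq (x t v : R) : C := (r2 x t v - (r1 v)%:C) / (1 + r1 v)%:C.

Definition K2 (x t : R) : R :=
  kq ^+ (2 * q - 1) *
  Re (cintegral `[0, kq / 2] (fun v =>
    2 * osc x t v / (pi * (1 + (2 * v) ^+ (2 * q)))%:C * rq x t v)) -
  \int[mu]_(u in `[1, +oo[)
    (cos (kq * u * (t - x)) / (pi * (kq ^- (2 * q) + u ^+ (2 * q)))).

Definition P2p : {poly C} := ((2 * p + 1)`!%:R)^-1 *: Pi_ (2 * p + 1).

(* An enumeration r_1, ..., r_p of the roots of P2p in the open unit disc;
   its order is immaterial. *)
Definition inner_roots : seq C :=
  xget [::] [set s : seq C | [/\ uniq s, size s = p &
    forall z : C, z \in s <-> root P2p z /\ `|z| < 1]].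

Definition dxt (x t : R) : int := Num.floor x - Num.floor t.

(* The polynomial in z whose coefficients are alpha_0(a, b), ...,
   alpha_2p(a, b), for fractional parts a = {x} and b = {t}. *)
Definition alpha_poly (a b : R) : {poly C} :=
  xget 0 [set f : {poly C} | (size f <= (2 * p).+1)%N /\
    forall (x t : R) (z : C), fract x = a -> fract t = b -> z != 0 ->
      z ^ (p%:Z - dxt x t) * Phi p (x + p.+1%:R / 2) z *
        Phi p (t + p.+1%:R / 2) z^-1 =
      \sum_(l < (2 * p).+1) f`_l * z ^+ l].

Definition alpha (l : nat) (a b : R) : C := (alpha_poly a b)`_l.

Definition Krs (x t : R) : C :=
  \sum_(j < p) \sum_(l < (2 * p).+1)
    alpha l (fract x) (fract t) / (P2p^`()).[inner_roots`_j] *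
    inner_roots`_j ^+ (absz (dxt x t + l%:Z - 1)%R +
                       (2 * p - 2) * (dxt x t + l%:Z <= 0)%R)%N.

Definition Kss (x t : R) : C :=
  \sum_(j < q)
    'i%C * cexp ('i%C * `|x - t|%:C *
               cexp (pi%:C * 'i%C * (2 * j + 1)%:R / (2 * q)%:R)) /
    ((2 * q)%:R *
     cexp ('i%C * pi%:C * (2 * q - 1)%:R * (2 * j + 1)%:R / (2 * q)%:R)).

End Kernels.
End SplineKernels.

(* Main.v *)
(* Write z = exp (- 2 pi i u).

   The Euler-Frobenius polynomials are the Eulerian polynomials. Poisson summation
   holds for the exponential splines: Phi_(2n-1)(x + n, z) is the sum over l of
   sinc (pi (u + l))^(2n) exp (- 2 pi i (u + l) x). It follows by repeated
   integration in x from the linear case, which is the limit of an identity for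
   sums over the b-th roots of z. Hence the functions Q are Laurent polynomials in
   z without zeros on the unit circle, and they differ from the l = 0 term
   by O(u^(2n)).

   For k_q < 1, the kernel is the integral over [0, 1] of
   phi phi^* / (1 + k_q^(2q) m(u)). The part with m = 0 is the integral over the
   circle of the rational function sum_l alpha_l z^(d + l) / P_2p(z), computed by
   partial fractions; the roots of P_2p are real, negative, simple and closed
   under inversion. The symmetry u -> 1 - u halves the interval in the remainder.

   For k_q >= 1, with u = v / k_q, the integrand is compared with
   exp (2 i v (t - x)) / (1 + (2v)^(2q)), up to an error O(k_q^(-2q)) on an interval
   of length k_q / 2. The main term is the cosine transform of 1 / (1 + y^(2q)),
   reduced by partial fractions in y^2 to that of 1 / (y^2 + a^2) with Re a > 0.
   This one is the limit, as n -> oo, of integrals of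
   cos (2 n atan (w y / (2n))) / (y^2 + a^2), which become circle integrals again
   under y = (2n / w) tan (pi u). *)

Require Import Defs.
From HB Require Import structures.
From mathcomp Require Import all_boot all_order all_algebra.
From mathcomp Require Import all_classical all_reals all_analysis.
From mathcomp Require Import measurable_realfun complex polyrcf.
From mathcomp Require Import ring lra zify.

Set Implicit Arguments.
Unset Strict Implicit.
Unset Printing Implicit Defensive.

Import Order.TTheory GRing.Theory Num.Theory.
Import numFieldNormedType.Exports ComplexField.Normc.

Local Open Scope ring_scope.
Local Open Scope complex_scope.

(** * Eulerian polynomials *)

Section Eulerian.
Variable A : comNzRingType.
Implicit Types (f : {poly A}).

(** [Pi_], [inner_roots] and [alpha_poly] are chosen from specifications. For the last two existence
    is enough, since only the defining property is used; [Pi_] also needs uniqueness, which follows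
    from power series in s at each fixed z <> 1.

    The linear case has terms of size 1 / (u + l)^2, already absolutely summable, and its error
    bound is uniform in x; this is what lets the identity survive repeated integration.

    Residues are avoided: z^(m+1) / (z - r) = z^m + r z^m / (z - r) gives a recurrence in m for the
    circle integrals, and their boundedness forces them to vanish on one side.

    The cosine is replaced by cos (2 n atan (w y / (2n))) because this becomes a trigonometric
    polynomial in u. Its integral is exact and contains the power ((1 - h) / (1 + h))^n, a discrete
    form of the exponential.

    For k_q >= 1, replacing splines by exponentials costs O(u^(2q)) = O(k_q^(-2q) v^(2q)), and the
    weight 1 / (1 + (2v)^(2q)) absorbs v^(2q). A lower bound of the penalty by a multiple of
    (2u)^(2q) on [0, 1/2] does the same for the denominators. *)

Definition euler_op (n : nat) f : {poly A} :=
  (1 + n%:R * 'X) * f + 'X * (1 - 'X) * f^`().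

(** With A_n / (1 - X)^(n+1) = sum_k (k+1)^n X^k, applying f -> (X f)' to the series gives the
    recurrence A_(n+1) = [euler_op n] A_n. *)
Fixpoint eulerian (n : nat) : {poly A} :=
  if n is m.+1 then euler_op m (eulerian m) else 1.

Arguments eulerian : simpl never.

Lemma eulerianS n : eulerian n.+1 = euler_op n (eulerian n).
Proof. by []. Qed.

Lemma eulerianE0 : eulerian 0 = 1.
Proof. by []. Qed.

Lemma eulerian1 : eulerian 1 = 1.
Proof. by rewrite eulerianS eulerianE0 /euler_op mul0r addr0 mul1r derivC mulr0 addr0. Qed.

Lemma coef_euler_op n f k :
  (euler_op n f)`_k = k.+1%:R * f`_k +
    (if k is k'.+1 then (n%:R - k'%:R) * f`_k' else 0).
Proof.
rewrite /euler_op.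
have -> : (1 + n%:R * 'X) * f + 'X * (1 - 'X) * f^`() =
  f + n%:R *: (f * 'X) + f^`() * 'X - f^`() * 'X * 'X.
  by rewrite scaler_nat -(mulr_natl _ n); ring.
rewrite !(coefD, coefN, coefZ, coefMX, coef_deriv).
case: k => [|k] /=; first by rewrite mulr0 !addr0 subr0 mul1r.
case: k => [|k] /=; first by rewrite !subr0; ring.
by rewrite -(mulr_natr _ k.+1) -(mulr_natr _ k.+2) -(addn1 k.+2) -(addn1 k.+1) !natrD; ring.
Qed.

Lemma coef_eulerian_big n k : (n < k.+1)%N -> (0 < n)%N -> (eulerian n)`_k = 0.
Proof.
elim: n k => // -[|n] IH k nk _.
  by rewrite eulerian1 coef1; case: k nk.
rewrite eulerianS coef_euler_op IH//; last exact: ltnW.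
case: k nk => // k nk; rewrite mulr0 add0r.
case: (ltnP n k) => h; last by rewrite (_ : k = n.+1) ?subrr ?mul0r//; lia.
by rewrite IH ?mulr0//; lia.
Qed.

Lemma coef_eulerian_lead n : (eulerian n.+1)`_n = 1.
Proof.
elim: n => [|n IH]; first by rewrite eulerian1 coef1.
rewrite eulerianS coef_euler_op coef_eulerian_big// mulr0 add0r IH mulr1.
by rewrite -natrB// subSnn.
Qed.

Lemma size_eulerian n : size (eulerian n.+1) = n.+1.
Proof.
apply/eqP; rewrite eqn_leq; apply/andP; split.
  by apply/leq_sizeP => j nj; rewrite coef_eulerian_big.
rewrite leqNgt; apply/negP => h; have := coef_eulerian_lead n.
by rewrite nth_default// => /esym /eqP; rewrite oner_eq0.
Qed.

Lemma eulerian_monic n : eulerian n \is monic.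
Proof.
case: n => [|n]; first by rewrite eulerianE0 monic1.
by rewrite monicE lead_coefE size_eulerian /= coef_eulerian_lead.
Qed.

Lemma eulerian0 n : (eulerian n).[0] = 1.
Proof.
rewrite horner_coef0; elim: n => [|n IH]; first by rewrite eulerianE0 coef1.
by rewrite eulerianS coef_euler_op IH addr0 mul1r.
Qed.

Lemma eulerian_at1 n : (eulerian n).[1] = n`!%:R.
Proof.
elim: n => [|n IH]; first by rewrite eulerianE0 hornerC.
rewrite eulerianS /euler_op -[n%:R in X in X + _](rmorph_nat (@polyC A)) !hornerE IH.
by rewrite subrr mul0r addr0 factS natrM -addn1 natrD; ring.
Qed.

(** Palindromy is what later pairs each root r with 1 / r. The ends k = 0 and k = n are separate
    because one of the two coefficients in the recurrence then falls outside the polynomial. *)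
Lemma eulerian_sym n k : (k <= n)%N ->
  (eulerian n.+1)`_k = (eulerian n.+1)`_(n - k).
Proof.
elim: n k => [|n IH] k kn; first by case: k kn.
rewrite [eulerian n.+2]eulerianS.
have big : (eulerian n.+1)`_n.+1 = 0 by exact: coef_eulerian_big.
move: IH big; move: (eulerian n.+1) => f IH big; rewrite !coef_euler_op.
case: k kn => [|k] kn.
  by rewrite !subn0 big mulr0 add0r addr0 (IH 0%N)// subn0 -natrB// subSnn.
have [->|kn'] : (k = n \/ k < n)%N by lia.
  by rewrite subnn big mulr0 add0r addr0 (IH 0%N)// subn0 -natrB// subSnn.
have -> : (n.+1 - k.+1 = (n - k.+1).+1)%N by lia.
rewrite (IH (n - k.+1)%N); last by lia.
rewrite (IH k); last by lia.
have -> : (n - (n - k.+1) = k.+1)%N by lia.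
have -> : ((n - k.+1).+1 = (n - k))%N by lia.
rewrite -!natrB; try lia.
have -> : (n.+1 - k = (n - k).+1)%N by lia.
have -> : (n.+1 - (n - k.+1) = k.+2)%N by lia.
by rewrite addrC.
Qed.

(** X (1 - X) times the derivative of (X - 1)^k is - k X (X - 1)^k, which lowers the coefficient n
    of [euler_op] to n - k. *)
Lemma euler_op_pow n k f : (k <= n)%N ->
  euler_op n (('X - 1) ^+ k * f) = ('X - 1) ^+ k * euler_op (n - k) f.
Proof.
move=> kn; rewrite /euler_op derivM deriv_exp derivB derivX derivC subr0 mul1r.
rewrite natrB//; case: k kn => [|k] kn; first by rewrite mulr0n; ring.
by rewrite exprS /= -(mulr_natl _ k.+1); ring.
Qed.

(** Coefficient form of (z - e^s) G(s) = z - 1 for the generating series G, with the powers of z - 1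
    cleared. In the induction, [euler_op] turns each A_j of the identity into A_(j+1); Pascal's rule
    then combines the result with (X - 1) times the identity itself. *)
Lemma eulerian_sum n : (0 < n)%N ->
  \sum_(j < n.+1) 'C(n, j)%:R * (('X - 1) ^+ (n - j) * eulerian j) =
  'X * eulerian n.
Proof.
elim: n => // -[_ _|n IH _].
  by rewrite big_ord_recr big_ord1 /= bin0 bin1 subn0 eulerian1 expr0 expr1; ring.
have {}IH := IH isT.
have opD : {morph euler_op n.+1 : f g / f + g >-> f + g}.
  by move=> f g; rewrite /euler_op derivD; ring.
have opN c : {morph euler_op n.+1 : f / c%:R * f >-> c%:R * f}.
  move=> f; rewrite /euler_op.
  have -> : (c%:R * f)^`() = c%:R * f^`() by rewrite !mulr_natl derivMn.
  ring.
have op0 : euler_op n.+1 0 = 0 by rewrite /euler_op deriv0; ring.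
have := congr1 (euler_op n.+1) IH.
rewrite (big_morph _ opD op0).
have -> : euler_op n.+1 ('X * eulerian n.+1) =
   'X * eulerian n.+2 + 'X * (1 - 'X) * eulerian n.+1.
  by rewrite [eulerian n.+2]eulerianS /euler_op derivM derivX; ring.
move=> E.
have {E} -> : 'X * eulerian n.+2 =
  \sum_(i < n.+2) 'C(n.+1, i)%:R * (('X - 1) ^+ (n.+1 - i) * eulerian i.+1)
  + ('X - 1) * ('X * eulerian n.+1).
  apply/eqP; rewrite -subr_eq; apply/eqP.
  transitivity ('X * eulerian n.+2 + 'X * (1 - 'X) * eulerian n.+1).
    ring.
  rewrite -E; apply: eq_bigr => i _.
  rewrite opN euler_op_pow; last by lia.
  by rewrite subKn ?leq_ord.
rewrite -IH mulr_sumr big_ord_recl.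
rewrite [X in _ + X = _](eq_bigr (fun i : 'I_n.+2 =>
   'C(n.+1, i)%:R * (('X - 1) ^+ (n.+1 - i) * eulerian i.+1)
   + 'C(n.+1, i.+1)%:R * (('X - 1) ^+ (n.+1 - i) * eulerian i.+1))); last first.
  by move=> i _; rewrite /= /bump /= !add1n binS natrD subSS; ring.
rewrite big_split /= addrCA; congr (_ + _).
rewrite [in RHS]big_ord_recl [in LHS]big_ord_recr /=.
rewrite (@bin_small n.+1 n.+2)// mul0r addr0 !bin0 !subn0 !mul1r [RHS]addrC.
rewrite [RHS]addrC; congr (_ + _); first by rewrite mulrA -exprS.
apply: eq_bigr => i _; rewrite /bump /= !add1n [RHS]mulrCA; congr (_ * _).
by rewrite mulrA -exprS; congr (_ ^+ _ * _); have := ltn_ord i; lia.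
Qed.

End Eulerian.

Lemma map_eulerian (A B : comNzRingType) (g : {rmorphism A -> B}) n :
  map_poly g (eulerian A n) = eulerian B n.
Proof.
elim: n => [|n IH]; first by rewrite !eulerianE0 rmorph1.
rewrite !eulerianS -IH /euler_op.
by rewrite deriv_map !(rmorphD, rmorphM, rmorphN, rmorph1, rmorph_nat) /= map_polyX.
Qed.

(** * Complex exponentials *)

Section ComplexBasics.
Variable R : realType.
Local Notation C := R[i].
Implicit Types (z w : C) (x y : R).

Lemma cReD z w : complex.Re (z + w) = complex.Re z + complex.Re w.
Proof. by case: z w => [a b] [c d]. Qed.
Lemma cImD z w : complex.Im (z + w) = complex.Im z + complex.Im w.
Proof. by case: z w => [a b] [c d]. Qed.
Lemma cReN z : complex.Re (- z) = - complex.Re z.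
Proof. by case: z. Qed.
Lemma cImN z : complex.Im (- z) = - complex.Im z.
Proof. by case: z. Qed.
Lemma cReM z w : complex.Re (z * w) =
  complex.Re z * complex.Re w - complex.Im z * complex.Im w.
Proof. by case: z w => [a b] [c d]. Qed.
Lemma cImM z w : complex.Im (z * w) =
  complex.Re z * complex.Im w + complex.Im z * complex.Re w.
Proof. by case: z w => [a b] [c d]. Qed.

Lemma complex_eqP z w : complex.Re z = complex.Re w ->
  complex.Im z = complex.Im w -> z = w.
Proof. by case: z w => [a b] [c d] /= -> ->. Qed.

Lemma normCE z : `|z| = (normc z)%:C.
Proof. by rewrite normc_def; case: z. Qed.

Lemma normc_ge0 z : 0 <= normc z.
Proof. by case: z => a b; rewrite /normc sqrtr_ge0. Qed.

Lemma normcX z n : normc (z ^+ n) = normc z ^+ n.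
Proof.
elim: n => [|n IH]; first by rewrite !expr0 normc1.
by rewrite !exprS normcM IH.
Qed.

Lemma normc_eq0 z : (normc z == 0) = (z == 0).
Proof.
by apply/eqP/eqP => [/eq0_normc//|->]; rewrite normc0.
Qed.

Lemma normc_gt0 z : (0 < normc z) = (z != 0).
Proof. by rewrite lt0r normc_ge0 andbT normc_eq0. Qed.

Lemma normc_real x : normc x%:C = `|x|.
Proof. by rewrite /normc /= expr0n addr0 sqrtr_sqr. Qed.

Lemma normc_nat n : normc (n%:R : C) = n%:R.
Proof. by rewrite -(rmorph_nat (real_complex R)) normc_real ger0_norm. Qed.

Lemma normcB z w : normc (z - w) = normc (w - z).
Proof. by rewrite -[RHS](@normcN R (w - z)); congr normc; ring. Qed.

Lemma ler_normcD z w : normc (z + w) <= normc z + normc w.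
Proof. exact: (@le_normcD R z w). Qed.

Lemma normc_opp z : normc (- z) = normc z.
Proof. exact: (@normcN R z). Qed.

Lemma ler_normc_sum (I : Type) (r : seq I) (P : pred I) (F : I -> C) :
  normc (\sum_(i <- r | P i) F i) <= \sum_(i <- r | P i) normc (F i).
Proof.
elim/big_ind2 : _ => //; first by rewrite normc0.
by move=> a x b y ax bY; rewrite (le_trans (ler_normcD _ _))// lerD.
Qed.

Lemma Re_le_normc z : `|complex.Re z| <= normc z.
Proof. by have := normc_ge_Re z; rewrite normCE lecR. Qed.

Lemma normcMi z : normc ('i%C * z) = normc z.
Proof. by case: z => a b; simpc => /=; rewrite sqrrN addrC. Qed.

Lemma Im_le_normc z : `|complex.Im z| <= normc z.
Proof.
by rewrite -normcMi -(normrN (complex.Im z)) -ReiNIm mulrC Re_le_normc.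
Qed.

Lemma normc_le_ReIm z : normc z <= `|complex.Re z| + `|complex.Im z|.
Proof.
rewrite [in leLHS](complexE z) (le_trans (ler_normcD _ _))//.
by rewrite normcMi !normc_real.
Qed.

Lemma normcJ z : normc z^* = normc z.
Proof. by case: z => a b /=; rewrite sqrrN. Qed.


Lemma cReMl x z : complex.Re (x%:C * z) = x * complex.Re z.
Proof. by rewrite cReM /= mul0r subr0. Qed.

Lemma cImMl x z : complex.Im (x%:C * z) = x * complex.Im z.
Proof. by rewrite cImM /= mul0r addr0. Qed.

(** Transfers convergence in [C^o] to the real-valued modulus, the form in which the later limits of
    complex sequences are stated. *)
Lemma ccvgP (f : nat -> C) (l : C) :
  ((f : nat -> C^o) @ \oo --> (l : C^o))%classic <->
  ((fun n => normc (f n - l)) @ \oo --> (0 : R))%classic.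
Proof.
split.
  move/cvgrPdist_lt => H; apply/cvgrPdist_lt => e e0.
  have /H : 0 < e%:C by rewrite ltcR.
  apply: filterS => n; rewrite normCE ltcR normcB.
  by rewrite sub0r normrN ger0_norm// normc_ge0.
move/cvgrPdist_lt => H; apply/cvgrPdist_lt => e e0.
have e1 : e = (complex.Re e)%:C by rewrite RRe_real// realE (ltW e0).
rewrite e1 ltcR in e0; have := H _ e0.
apply: filterS => n; rewrite e1 normCE ltcR normcB.
by rewrite sub0r normrN ger0_norm// normc_ge0.
Qed.

Definition cis x : C := cos x +i* sin x.

Lemma cisD x y : cis (x + y) = cis x * cis y.
Proof. by apply: complex_eqP; rewrite ?cReM ?cImM /= ?cosD ?sinD; ring. Qed.

Lemma cis0 : cis 0 = 1.
Proof. by rewrite /cis cos0 sin0. Qed.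

Lemma cisN x : cis (- x) = (cis x)^*.
Proof. by rewrite /cis cosN sinN. Qed.

Lemma normc_cis x : normc (cis x) = 1.
Proof. by rewrite /= cos2Dsin2 sqrtr1. Qed.

Lemma cis_neq0 x : cis x != 0.
Proof. by rewrite -normc_gt0 normc_cis. Qed.

Lemma cisV x : (cis x)^-1 = cis (- x).
Proof.
apply: (mulfI (cis_neq0 x)); rewrite mulfV ?cis_neq0//.
by rewrite -cisD subrr cis0.
Qed.

Lemma cisMn x n : cis (n%:R * x) = cis x ^+ n.
Proof.
elim: n => [|n IH]; first by rewrite mul0r cis0.
by rewrite exprS -IH -cisD -natr1 mulrDl mul1r addrC.
Qed.

Lemma cisMz x (m : int) : cis (m%:~R * x) = cis x ^ m.
Proof.
case: m => n; first by rewrite cisMn.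
by rewrite NegzE mulrNz mulNr -cisV -exprnN cisMn.
Qed.

Lemma cexpE z : cexp z = (expR (complex.Re z))%:C * cis (complex.Im z).
Proof. by []. Qed.

Lemma cexpD z w : cexp (z + w) = cexp z * cexp w.
Proof. by rewrite !cexpE cReD cImD expRD cisD rmorphM /=; ring. Qed.

Lemma cexp0 : cexp 0 = 1 :> C.
Proof. by rewrite cexpE /= expR0 cis0 mulr1. Qed.

Lemma cexp_i x : cexp ('i%C * x%:C) = cis x.
Proof.
have -> : 'i%C * x%:C = 0 +i* x by apply: complex_eqP; rewrite ?cReM ?cImM /=; ring.
by rewrite cexpE /= expR0 mul1r.
Qed.

Lemma normc_cexp z : normc (cexp z) = expR (complex.Re z).
Proof.
by rewrite cexpE normcM normc_cis mulr1 normc_real ger0_norm// expR_ge0.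
Qed.

Lemma cexpMn z n : cexp (n%:R * z) = cexp z ^+ n.
Proof.
elim: n => [|n IH]; first by rewrite mul0r cexp0.
by rewrite exprS -IH -cexpD -natr1 mulrDl mul1r addrC.
Qed.

End ComplexBasics.

#[global] Arguments normc : simpl never.
#[global] Arguments cis : simpl never.
#[global] Arguments cexp : simpl never.

(** * The generating function of the Eulerian polynomials *)

Section EulerGeneratingFunction.
Variable R : realType.
Local Notation C := R[i].
Variables (z : C) (z1 : z != 1).

Definition gcoef (j : nat) : C :=
  (eulerian C j).[z] / (z - 1) ^+ j / j`!%:R.

Let zB1 : z - 1 != 0. Proof. by rewrite subr_eq0. Qed.

Let factC (n : nat) : (n`!%:R : C) != 0.
Proof. by rewrite pnatr_eq0 -lt0n fact_gt0. Qed.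

Lemma gcoef0 : gcoef 0 = 1.
Proof. by rewrite /gcoef eulerianE0 hornerC expr0 fact0 !divr1. Qed.

(** Comparison of the coefficients of s^n in e^s G(s) = z G(s) - (z - 1). *)
Lemma gcoef_rec n : \sum_(j < n.+1) gcoef j / (n - j)`!%:R =
  z * gcoef n - (n == 0)%N%:R * (z - 1).
Proof.
case: n => [|n].
  by rewrite big_ord1 gcoef0 /= subnn fact0 divr1 mulr1 mul1r subKr.
rewrite /= mul0r subr0.
have := congr1 (fun f : {poly C} => f.[z] / (z - 1) ^+ n.+1 / n.+1`!%:R)
  (eulerian_sum C (ltn0Sn n)).
move=> H; transitivity (('X * eulerian C n.+1).[z] / (z - 1) ^+ n.+1 / n.+1`!%:R);
  last by rewrite hornerM hornerX /gcoef !mulrA.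
rewrite -{}H.
rewrite horner_sum !mulr_suml; apply: eq_bigr => j _.
have jn : (j <= n.+1)%N by rewrite leq_ord.
rewrite -[X in (X * _).[z]](rmorph_nat (@polyC C)) !(hornerM, hornerC, horner_exp).
rewrite hornerD hornerX hornerN hornerC /gcoef.
rewrite -(bin_fact jn) !natrM -[in (z - 1) ^+ n.+1](subnK jn) exprD.
have := bin_gt0 n.+1 j; rewrite jn => b0.
have b1 : ('C(n.+1, j)%:R : C) != 0 by rewrite pnatr_eq0 -lt0n b0.
have e1 := expf_neq0 j zB1; have e2 := expf_neq0 (n.+1 - j) zB1.
by field; rewrite e1 e2 b1 !factC.
Qed.

(** Chosen with D - 1 = 1 / |z - 1|, so that sum_(j < n) D^j = |z - 1| (D^n - 1) and the recurrence
    propagates the bound D^n. *)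
Let D : R := 1 + (normc (z - 1))^-1.

Let nz0 : 0 < normc (z - 1). Proof. by rewrite normc_gt0. Qed.

Let D1 : 1 <= D.
Proof. by rewrite /D lerDl invr_ge0 ltW. Qed.

Let D0 : 0 <= D. Proof. exact: le_trans D1. Qed.

Lemma normc_gcoef n : normc (gcoef n) <= D ^+ n.
Proof.
have [m] := ubnP n; elim: m n => // m IH n nm.
have [->|n0] := posnP n; first by rewrite gcoef0 normc1 expr0.
have : (z - 1) * gcoef n = \sum_(j < n) gcoef j / (n - j)`!%:R.
  have := gcoef_rec n; rewrite big_ord_recr /= subnn fact0 divr1.
  rewrite (negbTE (lt0n_neq0 n0)) mul0r subr0 => H.
  by rewrite mulrBl mul1r -H addrK.
move/(congr1 (@normc R)); rewrite normcM => E.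
have : normc (z - 1) * normc (gcoef n) <= \sum_(j < n) D ^+ j.
  rewrite E (le_trans (ler_normc_sum _ _ _))//; apply: ler_sum => j _.
  rewrite normcM normcV normc_nat (le_trans _ (IH j _)) //; last first.
    by rewrite (leq_trans (ltn_ord j)).
  rewrite ler_piMr ?normc_ge0// invf_le1 ?ltr0n ?fact_gt0//.
  by rewrite ler1n fact_gt0.
rewrite -(ler_pM2l nz0 (normc (gcoef n))) => /le_trans; apply.
have : normc (z - 1) * (D ^+ n - 1) = \sum_(j < n) D ^+ j.
  have DE : D - 1 = (normc (z - 1))^-1 by rewrite /D addrC addKr.
  by rewrite subrX1 DE mulVKf ?gt_eqF.
move=> <-.
by rewrite (ler_wpM2l (ltW nz0))// gerBl.
Qed.

Let gp n : {poly C} := \poly_(j < n) gcoef j.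
Let ep n : {poly C} := \poly_(j < n) (j`!%:R)^-1.
(* The truncated form of (z - e^s) * sum_j gcoef j s^j = z - 1: [rp n] is its
   error, with no terms of degree < n and geometrically bounded coefficients. *)
Let rp n : {poly C} := z%:P * gp n - gp n * ep n - (z - 1)%:P.

Let rp_low n m : (m < n)%N -> (rp n)`_m = 0.
Proof.
move=> mn; rewrite !(coefD, coefN, coefCM, coefM, coefC, coef_poly) mn.
have -> : \sum_(j < m.+1) (gp n)`_j * (ep n)`_(m - j) =
   \sum_(j < m.+1) gcoef j / (m - j)`!%:R.
  apply: eq_bigr => j _; rewrite !coef_poly.
  have := ltn_ord j; rewrite ltnS => jm.
  by rewrite (leq_ltn_trans jm mn) (leq_ltn_trans (leq_subr _ _) mn).
by rewrite gcoef_rec; case: eqP => _ /=; ring.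
Qed.

Let rp_high n m : (0 < n <= m)%N -> normc (rp n)`_m <= m.+1%:R * D ^+ m.
Proof.
move=> /andP[n0 nm]; rewrite !(coefD, coefN, coefCM, coefM, coefC, coef_poly).
rewrite ltnNge nm /= mulr0 add0r (_ : (m == 0)%N = false); last first.
  by rewrite gtn_eqF// (leq_trans n0).
rewrite subr0 normc_opp (le_trans (ler_normc_sum _ _ _))//.
have -> : m.+1%:R * D ^+ m = \sum_(j < m.+1) D ^+ m.
  by rewrite sumr_const card_ord mulr_natl.
apply: ler_sum => j _; rewrite normcM !coef_poly.
have jm : (j <= m)%N by rewrite leq_ord.
have H1 : normc (if (j < n)%N then gcoef j else 0) <= D ^+ m.
  case: ifP => _; last by rewrite normc0 exprn_ge0.
  by rewrite (le_trans (normc_gcoef j))// ler_weXn2l.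
rewrite -[leRHS]mulr1 ler_pM ?normc_ge0//.
case: ifP => _; last by rewrite normc0.
rewrite normcV normc_nat invf_le1 ?ltr0n ?fact_gt0//.
by rewrite ler1n fact_gt0.
Qed.

Section Point.
(** With D |s| <= 1/8 and m + 1 <= 2^m, the term of degree m of [rp] is at most 4^-m. Its at most 2n
    terms, all of degree >= n, then add up to 2 n 4^-n <= 2 * 2^-n. *)
Variables (s : R) (Ds : D * `|s| <= 8^-1).

Let Ds0 : 0 <= D * `|s|. Proof. by rewrite mulr_ge0. Qed.

Let rp_bound n : (0 < n)%N -> normc (rp n).[s%:C] <= 2 * 2^-1 ^+ n.
Proof.
move=> n0.
have sz : (size (rp n) <= n + n)%N.
  rewrite /rp (leq_trans (size_polyD _ _))// geq_max size_polyN.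
  rewrite (leq_trans (size_polyC_leq1 _)) ?andbT; last by lia.
  rewrite (leq_trans (size_polyD _ _))// geq_max size_polyN.
  apply/andP; split.
    rewrite (leq_trans (size_polyMleq _ _))//.
    rewrite (leq_trans (leq_pred _))//.
    by rewrite (leq_trans (leq_add (size_polyC_leq1 _) (size_poly _ _)))//; lia.
  rewrite (leq_trans (size_polyMleq _ _))//.
  by rewrite (leq_trans (leq_pred _))// (leq_trans (leq_add (size_poly _ _) (size_poly _ _))).
rewrite (horner_coef_wide _ sz) (le_trans (ler_normc_sum _ _ _))//.
have h m : (m < n + n)%N ->
   normc ((rp n)`_m * s%:C ^+ m) <= 4^-1 ^+ n.
  move=> _; case: (ltnP m n) => mn.
    by rewrite rp_low// mul0r normc0 exprn_ge0// invr_ge0.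
  rewrite normcM normcX normc_real.
  apply: (@le_trans _ _ (m.+1%:R * D ^+ m * `|s| ^+ m)).
    by rewrite ler_wpM2r ?exprn_ge0// rp_high// n0.
  rewrite -mulrA -exprMn.
  apply: (@le_trans _ _ (2 ^+ m * 8^-1 ^+ m)).
    rewrite ler_pM ?exprn_ge0//; last by rewrite lerXn2r// ?nnegrE.
    by rewrite -natrX ler_nat ltn_expl.
  rewrite -exprMn (_ : 2 * 8^-1 = 4^-1 :> R); last by field.
  by rewrite ler_wiXn2l ?invr_ge0// invf_le1// ler1n.
apply: (@le_trans _ _ (\sum_(m < n + n) 4^-1 ^+ n)).
  by apply: ler_sum => m _; apply: h.
rewrite sumr_const card_ord mulrnDr.
suff : 4^-1 ^+ n *+ n <= 2^-1 ^+ n :> R by lra.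
have -> : 4^-1 ^+ n = 2^-1 ^+ n * 2^-1 ^+ n :> R.
  by rewrite -exprMn; congr (_ ^+ _); field.
rewrite -mulrnAr ler_piMr ?exprn_ge0 ?invr_ge0// -mulr_natr.
by rewrite exprVn ler_pdivrMl ?exprn_gt0// mulr1 -natrX ler_nat ltnW// ltn_expl.
Qed.

Let gp_bound n : normc (gp n).[s%:C] <= 2.
Proof.
rewrite (horner_coef_wide _ (size_poly _ _)) (le_trans (ler_normc_sum _ _ _))//.
apply: (@le_trans _ _ (\sum_(m < n) 2^-1 ^+ m)).
  apply: ler_sum => m _; rewrite coef_poly ltn_ord normcM normcX normc_real.
  apply: (@le_trans _ _ (D ^+ m * `|s| ^+ m)).
    by rewrite ler_wpM2r ?exprn_ge0// normc_gcoef.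
  by rewrite -exprMn lerXn2r ?nnegrE// (le_trans Ds)//; lra.
have := subrX1 (2^-1 : R) n => E.
have -> : \sum_(m < n) 2^-1 ^+ m = 2 * (1 - 2^-1 ^+ n) :> R by lra.
have : 0 <= 2^-1 ^+ n :> R by rewrite exprn_ge0// invr_ge0.
lra.
Qed.

Let ep_exp n : (ep n).[s%:C] = (series (exp_coeff s) n)%:C.
Proof.
rewrite (horner_coef_wide _ (size_poly _ _)) /series /= big_mkord rmorph_sum.
apply: eq_bigr => m _; rewrite coef_poly ltn_ord /exp_coeff /=.
by rewrite rmorphM fmorphV /= rmorph_nat rmorphXn mulrC.
Qed.

Let gp_err n : (0 < n)%N ->
  normc ((z - (expR s)%:C) * (gp n).[s%:C] - (z - 1)) <=
   2 * 2^-1 ^+ n + 2 * `|series (exp_coeff s) n - expR s|.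
Proof.
move=> n0.
have -> : (z - (expR s)%:C) * (gp n).[s%:C] - (z - 1) =
  (rp n).[s%:C] + (series (exp_coeff s) n - expR s)%:C * (gp n).[s%:C].
  rewrite /rp !(hornerD, hornerN, hornerM, hornerC) ep_exp rmorphB /=; ring.
rewrite (le_trans (ler_normcD _ _))// lerD ?rp_bound//.
by rewrite normcM normc_real mulrC ler_wpM2r.
Qed.

Let err_cvg : ((fun n => 2 * 2^-1 ^+ n + 2 * `|series (exp_coeff s) n - expR s|)
  @ \oo --> (0 : R))%classic.
Proof.
rewrite -[0 : R](addr0 (0 : R)).
apply: cvgD.
  have := @cvg_geometric R 2 2^-1; rewrite /geometric /=; apply.
  by rewrite ger0_norm ?invr_ge0// invf_lt1// ltr1n.
rewrite -(mulr0 (2 : R)); apply: cvgMr.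
apply/norm_cvg0P; rewrite -(subrr (expR s)).
apply: cvgB; last exact: cvg_cst.
exact: is_cvg_series_exp_coeff.
Qed.

Lemma eulerian_series : ((fun n => (\sum_(0 <= j < n)
    (eulerian C j).[z] / (z - 1) ^+ j * (s%:C ^+ j / j`!%:R)) : C^o)
  @ \oo --> ((z - 1) / (z - (expR s)%:C) : C^o))%classic.
Proof.
have gE n : \sum_(0 <= j < n)
    (eulerian C j).[z] / (z - 1) ^+ j * (s%:C ^+ j / j`!%:R) = (gp n).[s%:C].
  rewrite (horner_coef_wide _ (size_poly _ _)) big_mkord.
  by apply: eq_bigr => j _; rewrite coef_poly ltn_ord /gcoef -!mulrA;
    congr (_ * (_ * _)); rewrite mulrC.
under eq_fun do rewrite gE.
set w := z - (expR s)%:C.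
have w0 : w != 0.
  (* If z were equal to e^s, the error bound would dominate |z - 1|, although it tends to 0. *)
  apply/eqP => w0.
  have /cvgrPdist_lt /(_ _ nz0) [N _ HN] := err_cvg.
  have := HN N.+1 (leqnSn N); rewrite sub0r normrN ger0_norm; last first.
    by rewrite addr_ge0// mulr_ge0// exprn_ge0// invr_ge0.
  rewrite ltNge => /negP; apply.
  rewrite -normc_opp (le_trans _ (gp_err (ltn0Sn N)))//.
  by rewrite -/w w0 mul0r sub0r.
apply/ccvgP.
apply: (@squeeze_cvgr _ _ _ _ (cst 0) (fun n => (normc w)^-1 *
  (2 * 2^-1 ^+ n + 2 * `|series (exp_coeff s) n - expR s|))).
- exists 1%N => //= n n0; rewrite normc_ge0 /=.
  have -> : (gp n).[s%:C] - (z - 1) / w =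
    w^-1 * (w * (gp n).[s%:C] - (z - 1)) by field.
  by rewrite normcM normcV ler_wpM2l ?invr_ge0 ?normc_ge0// gp_err.
- exact: cvg_cst.
- by rewrite -(mulr0 (normc w)^-1); apply: cvgMr; exact: err_cvg.
Qed.

End Point.

Lemma eulerian_series_near : (\forall s \near (0 : R),
  (fun n => (\sum_(0 <= j < n)
    (eulerian C j).[z] / (z - 1) ^+ j * (s%:C ^+ j / j`!%:R)) : C^o)
  @ \oo --> ((z - 1) / (z - (expR s)%:C) : C^o))%classic.
Proof.
have D80 : 0 < (8 * D)^-1 by rewrite invr_gt0 mulr_gt0// (lt_le_trans _ D1).
apply/nbhs_ballP; exists (8 * D)^-1 => //= s.
rewrite /ball /= sub0r normrN => sD; apply: eulerian_series; move: sD.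
by rewrite invfM ltr_pdivlMr ?(lt_le_trans _ D1)// mulrC => /ltW.
Qed.

End EulerGeneratingFunction.

(** * Uniqueness of the Euler-Frobenius polynomials *)

Section EulerFrobenius.
Variable R : realType.
Local Notation C := R[i].

Lemma sum_geometric_le (t : R) (a n : nat) : 0 <= t <= 2^-1 ->
  \sum_(a <= j < n) t ^+ j <= 2 * t ^+ a.
Proof.
move=> /andP[t0 t2]; have [an|na] := leqP a n; last first.
  by rewrite big_geq ?(ltnW na)// mulr_ge0// exprn_ge0.
have E : (1 - t) * \sum_(a <= j < n) t ^+ j = t ^+ a - t ^+ n.
  rewrite mulr_sumr -[RHS]opprB -(telescope_sumr (fun j => t ^+ j) an) -sumrN.
  by apply: eq_bigr => j _; rewrite exprS; ring.
have S0 : 0 <= \sum_(a <= j < n) t ^+ j.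
  by rewrite sumr_ge0// => j _; rewrite exprn_ge0.
have tn : 0 <= t ^+ n by rewrite exprn_ge0.
nra.
Qed.

(** Convergence at one point s0 bounds the coefficients, |d_j| s0^j <= B. If those below m vanish,
    evaluation at t s0 gives |d_m| s0^m <= 2 B t for all small t, whence d_m = 0. *)
Lemma power_series_eq0 (d : nat -> C) :
  (\forall s \near (0 : R), (fun n => (\sum_(0 <= j < n) d j * s%:C ^+ j) : C^o)
     @ \oo --> (0 : C^o))%classic -> forall j, d j = 0.
Proof.
move=> /nbhs_ballP[e /= e0 He].
have {}He s : `|s| < e ->
    ((fun n => normc (\sum_(0 <= j < n) d j * s%:C ^+ j)) @ \oo --> (0 : R))%classic.
  move=> se; have /He : ball (0 : R) e s by rewrite /ball /= sub0r normrN.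
  by move/ccvgP; under eq_fun do rewrite subr0.
pose s0 := e / 2; have s00 : 0 < s0 by rewrite divr_gt0.
have s0e : s0 < e by rewrite /s0; lra.
have [B B0 HB] : exists2 B : R, 0 < B & forall j, normc (d j) * s0 ^+ j <= B.
  have := He s0; rewrite (gtr0_norm s00) => /(_ s0e) cv.
  have /cvg_seq_bounded/pinfty_ex_gt0[B B0 /= HB] :
    cvgn (fun n => normc (\sum_(0 <= j < n) d j * s0%:C ^+ j)).
    by apply/cvg_ex; exists 0.
  exists (B + B); first by rewrite addr_gt0.
  move=> j.
  have -> : normc (d j) * s0 ^+ j = normc (d j * s0%:C ^+ j).
    by rewrite normcM normcX normc_real (gtr0_norm s00).
  have -> : d j * s0%:C ^+ j =
     (\sum_(0 <= i < j.+1) d i * s0%:C ^+ i) - \sum_(0 <= i < j) d i * s0%:C ^+ i.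
    by rewrite big_nat_recr//= addrAC subrr add0r.
  rewrite (le_trans (ler_normcD _ _))// normc_opp lerD//.
    by have := HB j.+1 I; rewrite ger0_norm// normc_ge0.
  by have := HB j I; rewrite ger0_norm// normc_ge0.
elim/ltn_ind => m IH.
have key t : 0 < t <= 2^-1 -> normc (d m) * s0 ^+ m <= 2 * B * t.
  move=> /andP[t0 t2].
  rewrite -(ler_pM2r (exprn_gt0 m t0)) -!mulrA -exprMn -exprS [s0 * t]mulrC.
  have ts : `|t * s0| < e.
    by rewrite gtr0_norm ?mulr_gt0//; nra.
  rewrite -[leRHS]addr0.
  have cv : ((fun n => 2 * (B * t ^+ m.+1) +
      normc (\sum_(0 <= j < n) d j * (t * s0)%:C ^+ j)) @ \oo -->
      2 * (B * t ^+ m.+1) + 0)%classic.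
    by apply: cvgD; [exact: cvg_cst|exact: He].
  apply: (ler_cvg_to (cvg_cst _) cv); exists m.+1 => //= n mn.
  have -> : normc (d m) * (t * s0) ^+ m = normc (d m * (t * s0)%:C ^+ m).
    by rewrite normcM normcX normc_real ger0_norm// mulr_ge0// ltW.
  have -> : d m * (t * s0)%:C ^+ m = \sum_(0 <= j < n) d j * (t * s0)%:C ^+ j
     - \sum_(m.+1 <= j < n) d j * (t * s0)%:C ^+ j.
    rewrite (big_cat_nat (n := m.+1))//= big_nat_recr//= big_nat big1 => [|j /andP[_ jm]].
      by rewrite add0r addrK.
    by rewrite IH// mul0r.
  rewrite (le_trans (ler_normcD _ _))// addrC normc_opp lerD2r.
  rewrite (le_trans (ler_normc_sum _ _ _))//.
  apply: (@le_trans _ _ (\sum_(m.+1 <= j < n) B * t ^+ j)).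
    apply: ler_sum => j _.
    rewrite normcM normcX normc_real gtr0_norm ?mulr_gt0// exprMn mulrCA mulrC.
    by rewrite (ler_wpM2r (exprn_ge0 _ (ltW t0))).
  rewrite -mulr_sumr mulrCA ler_wpM2l ?(ltW B0)//.
  by rewrite sum_geometric_le// (ltW t0).
have k0 : normc (d m) * s0 ^+ m <= 0.
  rewrite leNgt; apply/negP => p0.
  set x := normc (d m) * s0 ^+ m in p0 key.
  pose t := Num.min 2^-1 (x / (4 * B)).
  have t0 : 0 < t by rewrite lt_min invr_gt0 ltr0n divr_gt0// mulr_gt0.
  have := key t; rewrite t0 ge_min lexx /= => /(_ isT).
  have : t <= x / (4 * B) by rewrite ge_min lexx orbT.
  rewrite ler_pdivlMr ?mulr_gt0//; lra.
apply/eqP; rewrite -normc_eq0 eq_le normc_ge0 andbT.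
by move: k0; rewrite pmulr_lle0// exprn_gt0.
Qed.

Lemma poly_eq_almost (f g : {poly C}) (s : seq C) :
  (forall z, z \notin s -> f.[z] = g.[z]) -> f = g.
Proof.
move=> H; apply/eqP; rewrite -subr_eq0; apply/negPn/negP => fg0.
pose t := [seq i%:R : C | i <- iota 0 (size s + size (f - g))].
have tu : uniq t.
  rewrite map_inj_uniq ?iota_uniq// => i j /eqP.
  by rewrite eqr_nat => /eqP.
pose t' := [seq x <- t | x \notin s].
have t'u : uniq t' by rewrite filter_uniq.
have t'r : all (root (f - g)) t'.
  apply/allP => x; rewrite mem_filter => /andP[xs _].
  by rewrite rootE hornerD hornerN H// subrr.
have h1 := max_poly_roots fg0 t'r t'u.
have h2 : (count [pred x | x \in s] t <= size s)%N.
  rewrite -size_filter; apply: uniq_leq_size; first by rewrite filter_uniq.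
  by move=> x; rewrite mem_filter => /andP[].
have h3 := count_predC [pred x | x \in s] t.
rewrite size_map size_iota in h3.
have h4 : size t' = count (predC [pred x | x \in s]) t by rewrite size_filter.
by move: h1; rewrite h4 -(ltn_add2l (size s)) -h3 ltn_add2r ltnNge h2.
Qed.

Lemma euler_frobenius_eulerian : euler_frobenius_spec (eulerian C).
Proof.
split; [exact: eulerianE0| by case=> // j _; exact: size_eulerian|].
by move=> z z1; exact: eulerian_series_near.
Qed.

(** At a fixed z <> 1 the two generating series have the same limit near s = 0, so
    [power_series_eq0] identifies the values at z; polynomials that agree away from 1 are equal. *)
Lemma Pi_E : Pi_ = eulerian C.
Proof.
have [H0 _ H2] : euler_frobenius_spec (@Pi_ R).
  rewrite /Pi_; apply: xgetPex; exists (eulerian C).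
  exact: euler_frobenius_eulerian.
apply/funext => j; apply: (@poly_eq_almost _ _ [:: 1]) => z; rewrite inE => z1.
have := @power_series_eq0
  (fun j => ((Pi_ j).[z] - (eulerian C j).[z]) / (z - 1) ^+ j / j`!%:R).
have zB1 : z - 1 != 0 by rewrite subr_eq0.
move=> /(_ _ j) H; apply/eqP; rewrite -subr_eq0; apply/eqP.
have {}H : ((Pi_ j).[z] - (eulerian C j).[z]) / (z - 1) ^+ j / j`!%:R = 0.
  apply: H; move: (H2 z z1) (eulerian_series_near z1); apply: filterS2 => s c1 c2.
  have cB := cvgB c1 c2; rewrite subrr in cB.
  apply: (cvg_trans _ (cB _)); apply: near_eq_cvg; exists 0%N => //= n _.
  by rewrite fctE -[LHS]sumrB; apply: eq_bigr => i _; ring.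
move/eqP: H; rewrite !mulf_eq0 !invr_eq0 expf_eq0 (negbTE zB1) andbF orbF.
by rewrite pnatr_eq0 -(negbK (_`! == 0)%N) -lt0n fact_gt0 orbF => /eqP.
Qed.

End EulerFrobenius.

(** * Exponential splines *)

Section ExponentialSpline.
Variable R : realType.
Local Notation C := R[i].

Lemma floorDn (t : R) n : Num.floor (t + n%:R) = Num.floor t + n%:Z.
Proof.
have [h1 h2] := (floor_le t, floorD1_gt t).
by apply: floor_def; move: h1 h2; rewrite !intrD /=; lra.
Qed.

Lemma fractDn (t : R) n : fract (t + n%:R) = fract t.
Proof. by rewrite /fract floorDn intrD; ring. Qed.

Lemma fract_ge0 (t : R) : 0 <= fract t.
Proof. by rewrite subr_ge0 floor_le. Qed.

Lemma fract_lt1 (t : R) : fract t < 1.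
Proof. by have := floorD1_gt t; rewrite /fract intrD; lra. Qed.

(** The factor (1 - 1/z)^p = z^-p (z - 1)^p clears the denominators (z - 1)^j of [Phi]; what remains
    is a polynomial in z depending only on the fractional part. *)
Definition spline_poly (p : nat) (a : R) : {poly C} :=
  \sum_(j < p.+1) ('C(p, j)%:R * a%:C ^+ (p - j) / p`!%:R) *:
    (('X - 1) ^+ (p - j) * eulerian C j).

Lemma size_spline_poly p a : (size (spline_poly p a) <= p.+1)%N.
Proof.
apply: (leq_trans (size_sum _ _ _)); apply/bigmax_leqP => j _.
apply: (leq_trans (size_scale_leq _ _)); apply: (leq_trans (size_polyMleq _ _)).
rewrite -[1 : {poly C}]/(1%:P) size_exp_XsubC.
have := leq_ord j; case: (val j) => [|k] kp; last by rewrite size_eulerian; lia.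
by rewrite eulerianE0 size_polyC oner_neq0; lia.
Qed.

(** This form also covers z = 1: there only j = p survives, and A_p(1) = p! gives the conventional
    value 1. Continuity of [Phi] in z on the whole circle rests on it. *)
Lemma PhiE p (t : R) (z : C) : z != 0 ->
  Phi p t z = z ^ (Num.floor t - p%:Z) * (spline_poly p (fract t)).[z].
Proof.
move=> z0; rewrite /Phi Pi_E /spline_poly; case: eqVneq => [->|z1].
  rewrite exp1rz mul1r horner_sum big_ord_recr /= big1 => [|j _].
    rewrite subnn binn !expr0 !mul1r hornerZ eulerian_at1 add0r mulVf//.
  rewrite hornerZ hornerM horner_exp !hornerE subrr expr0n.
  by rewrite subn_eq0 leqNgt ltn_ord /= mulr0 mul0r.
have zB1 : z - 1 != 0 by rewrite subr_eq0.
have pf : (p`!%:R : C) != 0 by rewrite pnatr_eq0 -lt0n fact_gt0.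
have -> : (1 - z^-1) ^+ p = z ^- p * (z - 1) ^+ p.
  by rewrite -exprVn -exprMn; congr (_ ^+ _); field.
rewrite expfzDr// -[z ^ (- p%:Z)]exprnN -!mulrA; congr (_ * (_ * _)).
rewrite horner_sum mulr_sumr; apply: eq_bigr => j _.
have jp : (j <= p)%N by rewrite leq_ord.
rewrite hornerZ hornerM horner_exp hornerD hornerN hornerX hornerC.
have -> : (z - 1) ^+ p = (z - 1) ^+ (p - j) * (z - 1) ^+ j by rewrite -exprD subnK.
have ej := expf_neq0 j zB1.
by field; rewrite ej pf.
Qed.

Lemma Phi_shiftE p (t : R) (z : C) n : z != 0 ->
  Phi p (t + n%:R) z =
  z ^ (Num.floor t + n%:Z - p%:Z) * (spline_poly p (fract t)).[z].
Proof.
by move=> z0; rewrite (PhiE _ _ z0) (fractDn t n) (floorDn t n).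
Qed.

Definition rev_poly (p : nat) (f : {poly C}) : {poly C} := \poly_(i < p.+1) f`_(p - i).

Lemma rev_polyE p (f : {poly C}) z : (size f <= p.+1)%N -> z != 0 ->
  (rev_poly p f).[z] = z ^+ p * f.[z^-1].
Proof.
move=> sf z0; rewrite (horner_coef_wide _ sf) (horner_coef_wide _ (size_poly _ _)).
rewrite mulr_sumr [RHS](reindex_inj rev_ord_inj) /=; apply: eq_bigr => i _.
have ip : (i <= p)%N by rewrite leq_ord.
rewrite coef_poly ltn_ord subSS mulrCA; congr (_ * _).
rewrite exprVn -[in z ^+ p](subnK ip) exprD mulrAC mulfV ?mul1r//.
exact: expf_neq0.
Qed.

Lemma deg_half q : (0 < q)%N -> (deg q).+1%:R / 2 = q%:R :> R.
Proof.
move=> q0; rewrite (_ : (deg q).+1 = q * 2)%N; last by rewrite /deg; lia.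
by rewrite natrM mulfK.
Qed.

(** The spline at 1/z contributes a reversed polynomial and a factor z^-p. The prefactor z^(p - d)
    cancels both integer parts, so one polynomial, depending on the fractional parts alone, serves
    all x and t. *)
Lemma alpha_poly_exists q (q0 : (0 < q)%N) (a b : R) :
  exists f : {poly C}, (size f <= (2 * deg q).+1)%N /\
    forall (x t : R) (z : C), fract x = a -> fract t = b -> z != 0 ->
      z ^ ((deg q)%:Z - dxt x t) * Phi (deg q) (x + (deg q).+1%:R / 2) z *
        Phi (deg q) (t + (deg q).+1%:R / 2) z^-1 =
      \sum_(l < (2 * deg q).+1) f`_l * z ^+ l.
Proof.
set p := deg q.
pose f := spline_poly p a * rev_poly p (spline_poly p b).
have sf : (size f <= (2 * p).+1)%N.
  rewrite (leq_trans (size_polyMleq _ _))//.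
  have h1 := size_spline_poly p a; have h2 : (size (rev_poly p (spline_poly p b)) <= p.+1)%N.
    exact: size_poly.
  lia.
exists f; split => // x t z xa tb z0.
rewrite -(horner_coef_wide _ sf) deg_half// !Phi_shiftE ?invr_eq0// xa tb.
rewrite hornerM rev_polyE ?size_spline_poly// exprz_inv.
have E : z ^+ p = z ^ (p%:Z - dxt x t) * z ^ (Num.floor x + q%:Z - p%:Z)
     * z ^ (- (Num.floor t + q%:Z - p%:Z)).
  rewrite -!expfzDr// /dxt [z ^+ p](_ : _ = z ^ p%:Z)//.
  by congr (_ ^ _); lia.
by rewrite E; ring.
Qed.

Lemma alphaP q (q0 : (0 < q)%N) (x t : R) (z : C) : z != 0 ->
  z ^ ((deg q)%:Z - dxt x t) * Phi (deg q) (x + (deg q).+1%:R / 2) z *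
    Phi (deg q) (t + (deg q).+1%:R / 2) z^-1 =
  \sum_(l < (2 * deg q).+1) alpha q l (fract x) (fract t) * z ^+ l.
Proof.
move=> z0; have [_] := xgetPex 0 (alpha_poly_exists q0 (fract x) (fract t)).
exact.
Qed.

Lemma P2pE q : P2p q = ((2 * deg q + 1)`!%:R)^-1 *: eulerian C (2 * deg q + 1).
Proof. by rewrite /P2p Pi_E. Qed.

End ExponentialSpline.

(** * Poisson summation for exponential splines *)

Section RealBounds.
Variable R : realType.
Implicit Types (x y : R).

Lemma cvgD0 (f g : nat -> R) : (f @ \oo --> (0 : R))%classic ->
  (g @ \oo --> (0 : R))%classic -> ((fun n => f n + g n) @ \oo --> (0 : R))%classic.
Proof. by move=> hf hg; have := cvgD hf hg; rewrite addr0; apply. Qed.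

Lemma is_derive_continuous (f : R -> R) (df : R -> R) :
  (forall x, is_derive x 1 f (df x)) -> continuous f.
Proof.
by move=> H x; apply/differentiable_continuous/derivable1_diffP; case: (H x).
Qed.

Lemma mean_value (f df : R -> R) (a b : R) : a <= b ->
  (forall x, is_derive x 1 f (df x)) ->
  exists2 c, a <= c <= b & f b - f a = df c * (b - a).
Proof.
move=> ab H; have [|c] := MVT_segment ab (fun x _ => H x).
  by apply: continuous_subspaceT; exact: is_derive_continuous H.
by rewrite in_itv /= => cab E; exists c.
Qed.

Lemma sin_le_id x : 0 <= x -> sin x <= x.
Proof.
move=> x0; have [c _] := mean_value x0 (fun y => is_derive_sin y).
by rewrite sin0 !subr0 => ->; rewrite ler_piMl// cos_le1.
Qed.

Lemma norm_sin_le x : `|sin x| <= `|x|.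
Proof.
wlog x0 : x / 0 <= x => [H|].
  have [/H//|/ltW x0] := leP 0 x.
  by rewrite -normrN -sinN -(normrN x) H// oppr_ge0.
rewrite ler_norml (ger0_norm x0) sin_le_id// andbT.
have [c _] := mean_value x0 (fun y => is_derive_sin y).
by rewrite sin0 !subr0 => ->; rewrite -mulN1r ler_wpM2r// cos_geN1.
Qed.

Lemma cos_ge_quadratic x : 1 - x ^+ 2 / 2 <= cos x.
Proof.
have -> : x = (x / 2) *+ 2 by rewrite -mulr_natr divfK.
rewrite cos_mulr2n cos2sin2 -[(x / 2) *+ 2]mulr_natr divfK//.
have := norm_sin_le (x / 2); rewrite -(@ler_pXn2r _ 2) ?nnegrE//.
rewrite !real_normK ?num_real// expr_div_n -[(1 - _) *+ 2]mulr_natr; lra.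
Qed.

Lemma sin_ge_cubic x : 0 <= x -> x - x ^+ 3 / 6 <= sin x.
Proof.
move=> x0; pose f y : R := sin y - y + y ^+ 3 / 6.
have df y : is_derive y 1 f (cos y - 1 + y ^+ 2 / 2).
  rewrite /f; apply: is_derive_eq.
  by rewrite /GRing.scale /= expr2; lra.
have [c _ E] := mean_value x0 df.
have : 0 <= f x - f 0.
  by rewrite E subr0 mulr_ge0//; have := cos_ge_quadratic c; lra.
rewrite /f sin0 expr0n /=; lra.
Qed.

(** A weak form of Jordan's inequality: on this range x^2 <= 4, so x - x^3 / 6 >= x / 3. *)
Lemma sin_ge_third x : 0 <= x <= pi / 2 -> x / 3 <= sin x.
Proof.
move=> /andP[x0 xpi].
have x2 : x < 2 by rewrite (le_lt_trans xpi)// pihalf_lt2.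
have := sin_ge_cubic x0; have : x ^+ 3 <= 4 * x; last lra.
by rewrite exprS mulrC ler_wpM2r// expr2; nra.
Qed.

Lemma norm_sin_ge_third x : `|x| <= pi / 2 -> `|x| / 3 <= `|sin x|.
Proof.
move=> xpi; have := @sin_ge_third `|x|; rewrite normr_ge0 xpi => /(_ isT).
by move/le_trans; apply; case: (ger0P x) => _; rewrite ?ler_norm// sinN -normrN ler_norm.
Qed.

(** Tannery's theorem with a summation range growing with N: finitely many terms tend to 0, and the
    others lie below a tail of the series of M. *)
Lemma tannery (d : nat -> nat -> R) (M : nat -> R) :
  (forall l, 0 <= M l) -> cvgn (series M) ->
  (forall N l, 0 <= d N l) -> (forall N l, (l < N)%N -> d N l <= M l) ->
  (forall l, (d ^~ l @ \oo --> (0 : R))%classic) ->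
  ((fun N => \sum_(0 <= l < N) d N l) @ \oo --> (0 : R))%classic.
Proof.
move=> M0 cM d0 dM dl; apply/cvgrPdist_lt => e e0.
have e2 : 0 < e / 2 by rewrite divr_gt0.
have [m Hm] : exists m, limn (series M) - series M m < e / 2.
  have /cvgrPdist_lt /(_ _ e2) [m _ Hm] := cM.
  exists m; have := Hm m (leqnn m); apply: le_lt_trans; exact: ler_norm.
have nd : nondecreasing_seq (series M).
  by apply/nondecreasing_seqP => n; rewrite /series /= big_nat_recr//= lerDl.
have : ((fun N => \sum_(0 <= l < m) d N l) @ \oo --> (0 : R))%classic.
  elim: (index_iota 0 m) => [|i s IH].
    by under eq_fun do rewrite big_nil; exact: cvg_cst.
  under eq_fun do rewrite big_cons.
  exact: cvgD0.
move=> /cvgrPdist_lt /(_ _ e2) [N0 _ HN].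
exists (N0 + m)%N => // N /= N0mN.
have N0N : (N0 <= N)%N := leq_trans (leq_addr _ _) N0mN.
have mN : (m <= N)%N := leq_trans (leq_addl _ _) N0mN.
have := HN N N0N; rewrite !sub0r !normrN !ger0_norm; last 2 first.
  by rewrite sumr_ge0.
  by rewrite sumr_ge0.
have cat (f : nat -> R) : \sum_(0 <= l < N) f l =
    \sum_(0 <= l < m) f l + \sum_(m <= l < N) f l.
  by rewrite (@big_cat_nat _ _ _ m 0 N).
rewrite cat => H1.
have : \sum_(m <= l < N) d N l <= \sum_(m <= l < N) M l.
  by rewrite big_nat [leRHS]big_nat ler_sum// => l /andP[_ /dM].
have : \sum_(m <= l < N) M l = series M N - series M m.
  by rewrite /series /= cat [_ + \sum_(m <= l < N) _]addrC addrK.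
have := nondecreasing_cvgn_le nd cM N; lra.
Qed.

(** 1 / k^2 <= 2 (1/k - 1/(k+1)) telescopes to the bound 2. *)
Lemma inv_sqr_series_cvg : cvgn (series (fun l => (l.+1%:R ^+ 2)^-1 : R)).
Proof.
apply: nondecreasing_is_cvgn.
  apply/nondecreasing_seqP => n; rewrite /series /= big_nat_recr//= lerDl.
  by rewrite invr_ge0 exprn_ge0.
exists 2 => _ [n _ <-]; rewrite /series /=.
suff : \sum_(0 <= k < n) (k.+1%:R ^+ 2)^-1 <= 2 - 2 * n.+1%:R^-1 :> R.
  by move=> H; rewrite (le_trans H)// gerBl mulr_ge0// invr_ge0.
elim: n => [|n IH]; first by rewrite big_geq// invr1; lra.
rewrite big_nat_recr//= (le_trans (lerD IH (lexx _)))//.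
have -> : n.+2%:R = n.+1%:R + 1 :> R by rewrite natr1.
have : 1 <= n.+1%:R :> R by rewrite ler1n.
set y := n.+1%:R : R => y1.
rewrite -subr_ge0.
have -> : 2 - 2 * (y + 1)^-1 - (2 - 2 * y^-1 + (y ^+ 2)^-1) =
  (y - 1) * ((y ^+ 2)^-1 * (y + 1)^-1).
  by field; apply/andP; split; lra.
by rewrite mulr_ge0 ?subr_ge0// mulr_ge0 ?invr_ge0 ?sqr_ge0//; lra.
Qed.

End RealBounds.

(** * Sums over the b-th roots of a point of the unit circle *)

Section Fejer.
Variable R : realType.
Local Notation C := R[i].

Lemma cis_pi2 (m : int) : cis (2 * pi * m%:~R) = 1 :> C.
Proof.
rewrite mulrC cisMz; have -> : cis (2 * pi) = 1 :> C.
  by rewrite mulr_natl /cis cos2pi sin2pi.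
by rewrite exp1rz.
Qed.

Lemma cis2B1 (y : R) : cis (2 * y) - 1 = 'i%C * (2 * sin y)%:C * cis y.
Proof.
apply: complex_eqP; rewrite ?(cReM, cImM, cReD, cImD) /=
  [2 * y]mulr_natl ?cos_mulr2n ?sin_mulr2n ?cos2sin2; ring.
Qed.

Lemma cis2B1_sqr (y : R) : (cis (2 * y) - 1) ^+ 2 = - (4 * sin y ^+ 2)%:C * cis (2 * y).
Proof.
rewrite cis2B1 [in RHS]cisMn !exprMn sqr_i -rmorphXn /=.
have -> : 4 * sin y ^+ 2 = (2 * sin y) ^+ 2 by ring.
by ring.
Qed.

Lemma normc_cisB (x y : R) : normc (cis x - cis y) <= `|x - y|.
Proof.
have -> : cis x - cis y = cis y * (cis (2 * ((x - y) / 2)) - 1) :> C.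
  by rewrite mulrBr mulr1 -cisD; congr (cis _ - _); lra.
rewrite cis2B1 !normcM !normc_cis mul1r mulr1 normc_real.
have -> : normc 'i%C = 1 :> R by rewrite /normc expr0n expr1n add0r sqrtr1.
rewrite mul1r normrM ger0_norm//.
have := norm_sin_le ((x - y) / 2); rewrite normrM [`|2^-1|]ger0_norm; lra.
Qed.

Section Finite.
Variables (b : nat) (w : nat -> C) (z : C).
Hypotheses (z1 : z != 1) (wb : forall k, (k < b)%N -> w k ^+ b = z)
  (w_orth : forall i, (0 < i < b)%N -> \sum_(k < b) w k ^+ i = 0).

Let w1 k : (k < b)%N -> w k - 1 != 0.
Proof.
move=> kb; rewrite subr_eq0; apply/eqP => wk.
by move: z1; rewrite -(wb kb) wk expr1n eqxx.
Qed.

Let zB1 : z - 1 != 0. Proof. by rewrite subr_eq0. Qed.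

Let F a : C := \sum_(k < b) w k ^+ a.+1 / (w k - 1) ^+ 2.
Let G a : C := \sum_(k < b) w k ^+ a.+1 / (w k - 1).

Let FS a : F a.+1 = F a + G a.
Proof.
rewrite /F /G -big_split /=; apply: eq_bigr => k _.
by rewrite [w k ^+ a.+2]exprS; field; exact: w1.
Qed.

Let GS a : G a.+1 = G a + \sum_(k < b) w k ^+ a.+1.
Proof.
rewrite /G -big_split /=; apply: eq_bigr => k _.
by rewrite [w k ^+ a.+2]exprS; field; exact: w1.
Qed.

(** Since w_k^b = z, w_k / (w_k - 1) is the sum of w_k^(i+1) / (z - 1) over i < b; orthogonality
    leaves only the exponent b. *)
Let G0 : G 0 = b%:R * z / (z - 1).
Proof.
rewrite /G; move: wb w_orth w1 zB1; clear.
case: b => [|b'] wb' wo w1' zB1; first by rewrite big_ord0 !mul0r.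
transitivity (\sum_(k < b'.+1) \sum_(i < b'.+1) w k ^+ i.+1 / (z - 1)).
  apply: eq_bigr => k _; rewrite -mulr_suml.
  have := subrX1 (w k) b'.+1; rewrite wb'// => E.
  rewrite E; set s := \sum_(i < _) _ in E *.
  have -> : \sum_(i < b'.+1) w k ^+ i.+1 = w k * s.
    by rewrite mulr_sumr; apply: eq_bigr => i _; rewrite exprS.
  have s0 : s != 0 by apply: contraNneq zB1 => s0; rewrite E s0 mulr0.
  by rewrite expr1; field; rewrite s0 w1'.
rewrite exchange_big big_ord_recr /= big1 => [|i _].
  rewrite add0r -mulr_suml; congr (_ / _).
  rewrite (eq_bigr (fun=> z)); first by rewrite sumr_const card_ord mulr_natl.
  by move=> k _; rewrite wb'.
by rewrite -mulr_suml wo ?mul0r//= ltnS ltn_ord.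
Qed.

(* The second difference in [a] of the left-hand side is a power sum of the b-th
   roots [w k] of [z], hence zero, so that side is affine in [a]. *)
Lemma finite_fejer a : (0 < b)%N -> (a <= b)%N ->
  \sum_(k < b) w k ^+ a.+1 / (w k - 1) ^+ 2 =
  b%:R ^+ 2 * z / (z - 1) ^+ 2 * (1 + a%:R / b%:R * (z - 1)).
Proof.
move=> b0 ab; rewrite -/(F a).
have GE c : (c < b)%N -> G c = G 0.
  elim: c => // c IH cb; rewrite GS IH ?(ltnW cb)// w_orth ?addr0//.
have FE c : (c <= b)%N -> F c = F 0 + c%:R * G 0.
  elim: c => [|c IH] cb; first by rewrite mul0r addr0.
  by rewrite FS IH ?(ltnW cb)// GE// -natr1; ring.
have Fb : F b = z * F 0.
  rewrite /F mulr_sumr; apply: eq_bigr => k _.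
  by rewrite exprSr wb// expr1 mulrA.
have b1 : (b%:R : C) != 0 by rewrite pnatr_eq0 -lt0n.
have F0 : F 0 = b%:R ^+ 2 * z / (z - 1) ^+ 2.
  apply: (mulfI zB1); have := FE b (leqnn b); rewrite Fb G0 => E.
  have -> : (z - 1) * F 0 = z * F 0 - F 0 by ring.
  by rewrite E; field.
by rewrite FE// F0 G0; field; rewrite b1 zB1.
Qed.

End Finite.

Section Limit.
Variables (u : R) (u01 : 0 < u < 1).
Let z : C := cis (- (2 * pi * u)).

Lemma cis_neq1 : z != 1.
Proof.
rewrite -subr_eq0 -normc_gt0 /z -mulrA -mulrN cis2B1 !normcM normc_cis mulr1.
have -> : normc 'i%C = 1 :> R by rewrite /normc expr0n expr1n add0r sqrtr1.
rewrite mul1r normc_real normr_gt0 mulf_neq0// sinN oppr_eq0 gt_eqF//.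
by apply: sin_gt0_pi; have := pi_gt0 R; case/andP: u01 => ? ? ?; nra.
Qed.

Lemma cis_shift (x : R) (m : int) : cis (- (2 * pi * (x + m%:~R))) = cis (- (2 * pi * x)) :> C.
Proof.
rewrite mulrDr opprD cisD -[X in _ * X]cisV cis_pi2 invr1 mulr1//.
Qed.

(** Term of the finite identity for b = 2N, indexed by a point x of u + Z; it tends to e^(-2 pi i x
    t) / (2 pi x)^2 when a / b tends to t. With b = 2N the indices can be centred so that |x| <= N,
    which keeps pi x / b in [-pi/2, pi/2], where |sin y| >= |y| / 3 yields a summable majorant. *)
Definition fejer_term (N a : nat) (x : R) : C :=
  ((4 * (N + N)%:R ^+ 2 * sin (pi * x / (N + N)%:R) ^+ 2)^-1)%:C *
  cis (- (2 * pi * x * a%:R / (N + N)%:R)).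

Lemma sum_two_sided (f : R -> C) N :
  \sum_(k < N + N) f (u - N%:R + k%:R) =
  \sum_(0 <= l < N) (f (u + l%:R) + f (u - l.+1%:R)).
Proof.
rewrite -(big_mkord xpredT (fun k => f (u - N%:R + k%:R))).
rewrite (@big_cat_nat _ _ _ N 0%N (N + N))//= ?leq_addr// addrC big_split /=.
congr (_ + _).
  rewrite -{1}[N]add0n big_addn addnK; apply: eq_bigr => l _.
  by congr f; rewrite natrD; ring.
rewrite big_nat_rev /= add0n; apply: eq_big_nat => l /andP[_ lN].
by congr f; rewrite natrB//; ring.
Qed.

(** With w_k = e^(2 i y_k), (w_k - 1)^2 = - 4 sin(y_k)^2 w_k turns [finite_fejer], divided by - b^2,
    into this sum. *)
Lemma fejer_term_sum N a : (0 < N)%N -> (a <= N + N)%N ->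
  \sum_(0 <= l < N) (fejer_term N a (u + l%:R) + fejer_term N a (u - l.+1%:R)) =
  - (z / (z - 1) ^+ 2) * (1 + a%:R / (N + N)%:R * (z - 1)).
Proof.
move=> N0 ab; rewrite -(sum_two_sided (fejer_term N a)).
set b := (N + N)%N in ab *; have b0 : (0 < b)%N by rewrite addn_gt0 N0.
have b1 : (b%:R : R) != 0 by rewrite pnatr_eq0 -lt0n.
have b1' : (b%:R : C) != 0 by rewrite pnatr_eq0 -lt0n.
pose y k : R := - (pi * (u - N%:R + k%:R) / b%:R).
pose w k : C := cis (2 * y k).
have z1 := cis_neq1.
have zB1 : z - 1 != 0 by rewrite subr_eq0.
have wb k : (k < b)%N -> w k ^+ b = z.
  move=> _; rewrite /w -cisMn /y.
  have -> : b%:R * (2 * - (pi * (u - N%:R + k%:R) / b%:R)) =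
     - (2 * pi * (u + (k%:Z - N%:Z)%:~R)).
    by rewrite intrD rmorphN /=; field.
  exact: cis_shift.
have wo i : (0 < i < b)%N -> \sum_(k < b) w k ^+ i = 0.
  move=> /andP[i0 ib].
  (* In k, the powers w_k^i form a geometric progression of ratio o <> 1, and o^b = 1 makes its sum
     vanish. *)
  pose o : C := cis (2 * - (pi * i%:R / b%:R)).
  have o1 : o - 1 != 0.
    rewrite -normc_gt0 cis2B1 !normcM normc_cis mulr1.
    have -> : normc 'i%C = 1 :> R by rewrite /normc expr0n expr1n add0r sqrtr1.
    rewrite mul1r normc_real normr_gt0 mulf_neq0// sinN oppr_eq0 gt_eqF//.
    apply: sin_gt0_pi; rewrite divr_gt0 ?mulr_gt0 ?pi_gt0 ?ltr0n//=.
    by rewrite ltr_pdivrMr ?ltr0n// ltr_pM2l ?pi_gt0// ltr_nat.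
  have -> : \sum_(k < b) w k ^+ i =
     cis (2 * - (pi * (u - N%:R) * i%:R / b%:R)) * \sum_(k < b) o ^+ k.
    rewrite mulr_sumr; apply: eq_bigr => k _.
    rewrite /w /o -!cisMn -cisD /y; congr cis; field; exact: b1.
  have := subrX1 o b.
  have -> : o ^+ b = 1.
    rewrite /o -cisMn.
    have -> : b%:R * (2 * - (pi * i%:R / b%:R)) = 2 * pi * (- i%:Z)%:~R :> R.
      by rewrite mulrNz; field.
    exact: cis_pi2.
  rewrite subrr => /esym /eqP; rewrite mulf_eq0 (negbTE o1) /= => /eqP ->.
  by rewrite mulr0.
have := finite_fejer z1 wb wo b0 ab.
move=> E; have {}E : - (b%:R ^+ 2)^-1 * \sum_(k < b) w k ^+ a.+1 / (w k - 1) ^+ 2 =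
   - (z / (z - 1) ^+ 2) * (1 + a%:R / b%:R * (z - 1)).
  by rewrite E; field; rewrite b1' zB1.
rewrite -E mulr_sumr; apply: eq_bigr => k _.
rewrite /fejer_term /w cis2B1_sqr exprSr.
have sk0 : sin (y k) != 0.
  apply/eqP => s0; have := wb k (ltn_ord k) => E2.
  have : w k - 1 = 0 by rewrite /w cis2B1 s0 mulr0 mulr0 mul0r.
  move/subr0_eq => wk; move: z1; rewrite -E2 wk expr1n eqxx//.
rewrite -/b.
have -> : sin (pi * (u - N%:R + k%:R) / b%:R) ^+ 2 = sin (y k) ^+ 2.
  by rewrite /y sinN sqrrN.
have -> : cis (- (2 * pi * (u - N%:R + k%:R) * a%:R / b%:R)) = cis (2 * y k) ^+ a :> C.
  by rewrite -cisMn /y; congr cis; field; exact: b1.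
rewrite fmorphV !(rmorphXn, rmorphM, rmorph_nat) /= [cis _ ^+ a.+1]exprS.
have sk1 : (sin (y k))%:C != 0 by rewrite fmorph_eq0.
have cn := cis_neq0 (2 * y k).
by field; rewrite b1' sk1 cn.
Qed.

End Limit.
End Fejer.

(** * Limit of the finite identity: Poisson summation in the linear case *)

Section FejerLimit.
Variable R : realType.
Local Notation C := R[i].

Lemma norm_sinB_le (y : R) : `|sin y - y| <= `|y| ^+ 3.
Proof.
wlog y0 : y / 0 <= y => [H|].
  have [/H//|/ltW y0] := leP 0 y.
  have := H (- y); rewrite oppr_ge0 => /(_ y0).
  by rewrite sinN -opprD !normrN.
have := sin_ge_cubic y0; have := sin_le_id y0.
have : 0 <= y ^+ 3 by rewrite exprn_ge0.
by rewrite (ger0_norm y0) ler_norml => h1 h2 h3; apply/andP; split; lra.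
Qed.

Lemma cvg_dominated0 (f g : nat -> R) : (forall n, (0 < n)%N -> 0 <= f n <= g n) ->
  (g @ \oo --> (0 : R))%classic -> (f @ \oo --> (0 : R))%classic.
Proof.
move=> fg cg; apply: (@squeeze_cvgr _ _ _ _ (cst 0) g) => //; last exact: cvg_cst.
by exists 1%N => //= n /fg.
Qed.

Lemma cvg_harmonicZ (k : R) : ((fun n => k * n.+1%:R^-1) @ \oo --> (0 : R))%classic.
Proof. by rewrite -(mulr0 k); apply: cvgMr; exact: cvg_harmonic. Qed.

(** A Fourier mode divided by a power of its frequency, normalised so that differentiation in t
    lowers m by one. *)
Definition lerch_term m (x t : R) : C :=
  cis (- (2 * pi * x * t)) / ('i%C * (- (2 * pi * x))%:C) ^+ m.+1.

Arguments lerch_term : simpl never.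

Lemma lerch_term1E x t : lerch_term 1 x t =
  - (((2 * pi * x) ^+ 2)^-1)%:C * cis (- (2 * pi * x * t)).
Proof.
rewrite /lerch_term exprMn sqr_i rmorphN sqrrN fmorphV rmorphXn /=.
by rewrite mulN1r invrN mulrC.
Qed.

Lemma normc_lerch_term1 x t : normc (lerch_term 1 x t) = ((2 * pi * x) ^+ 2)^-1.
Proof.
rewrite lerch_term1E normcM normc_cis mulr1 normc_opp normc_real ger0_norm//.
by rewrite invr_ge0 sqr_ge0.
Qed.

Let cvg_bsin (x : R) : ((fun N => (N + N)%:R * sin (pi * x / (N + N)%:R)) @ \oo -->
   pi * x)%classic.
Proof.
apply/subr_cvg0; apply/norm_cvg0P => /=.
apply: (@cvg_dominated0 _ (fun n => `|pi * x| ^+ 3 * n.+1%:R^-1)); last exact: cvg_harmonicZ.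
move=> N N0; rewrite normr_ge0 /=.
have b0 : 0 < (N + N)%:R :> R by rewrite ltr0n addn_gt0 N0.
have bN : (N.+1 <= (N + N) ^ 2)%N by nia.
move: b0 bN; move: (N + N)%N => b b0 bN.
have -> : b%:R * sin (pi * x / b%:R) - pi * x =
  b%:R * (sin (pi * x / b%:R) - pi * x / b%:R).
  by field; rewrite gt_eqF.
rewrite normrM gtr0_norm// (le_trans (ler_wpM2l (ltW b0) (norm_sinB_le _)))//.
rewrite normrM normfV (gtr0_norm b0) exprMn mulrCA ler_wpM2l ?exprn_ge0//.
have -> : b%:R * b%:R^-1 ^+ 3 = (b%:R ^+ 2)^-1 :> R.
  by field; rewrite gt_eqF.
have bN' : N.+1%:R <= b%:R ^+ 2 :> R by rewrite -natrX ler_nat.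
by rewrite lef_pV2// posrE ?exprn_gt0// ltr0n.
Qed.

Section Fixed.
Variables (u : R) (u01 : 0 < u < 1).
Let z : C := cis (- (2 * pi * u)).
(** The distance from u to the integers; the l-th point on either side has modulus at least cu (l +
    1). *)
Let cu := Num.min u (1 - u).

Let cu0 : 0 < cu. Proof. by rewrite lt_min subr_gt0. Qed.

Definition lerch_bound (l : nat) : R := 2 * (cu ^+ 2)^-1 * (l.+1%:R ^+ 2)^-1.

Lemma lerch_bound_ge0 l : 0 <= lerch_bound l.
Proof. by rewrite /lerch_bound !mulr_ge0// invr_ge0 sqr_ge0. Qed.

Lemma lerch_bound_cvg : cvgn (series lerch_bound).
Proof.
have -> : series lerch_bound = (fun n => 2 * (cu ^+ 2)^-1 *
    series (fun l => (l.+1%:R ^+ 2)^-1) n).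
  by apply/funext => n; rewrite /series /= mulr_sumr.
by apply: is_cvgMr; exact: inv_sqr_series_cvg.
Qed.

Let far_p (l : nat) : cu * l.+1%:R <= `|u + l%:R|.
Proof.
case/andP: u01 => u0 u1; rewrite ger0_norm ?addr_ge0 ?(ltW u0)//.
have : cu <= u by rewrite ge_min lexx.
have : 0 <= l%:R :> R by []. rewrite -natr1; nra.
Qed.

Let far_n l : cu * l.+1%:R <= `|u - l.+1%:R|.
Proof.
case/andP: u01 => u0 u1; rewrite -normrN opprB.
have : cu <= 1 - u by rewrite ge_min lexx orbT.
have : 0 <= l%:R :> R by []; rewrite -natr1 => l0 h.
by rewrite ger0_norm; nra.
Qed.

Let near_p N l : (l < N)%N -> `|u + l%:R| <= N%:R.
Proof.
case/andP: u01 => u0 u1; rewrite -(ler_nat R) -natr1 => lN.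
by rewrite ger0_norm ?addr_ge0 ?(ltW u0)//; lra.
Qed.

Let near_n N l : (l < N)%N -> `|u - l.+1%:R| <= N%:R.
Proof.
case/andP: u01 => u0 u1; rewrite -(ler_nat R) -natr1 => lN.
have : 0 <= l%:R :> R by [] => l0.
by rewrite -normrN opprB ger0_norm; lra.
Qed.

Let inv_far (x : R) (l : nat) : cu * l.+1%:R <= `|x| ->
  (x ^+ 2)^-1 <= (cu ^+ 2)^-1 * (l.+1%:R ^+ 2)^-1.
Proof.
have p0 : 0 < cu * l.+1%:R by rewrite mulr_gt0// ltr0n.
move=> h; rewrite -invfM -exprMn lef_pV2 ?posrE ?(exprn_gt0 _ p0)//; last first.
  by rewrite -real_normK ?num_real// exprn_gt0// (lt_le_trans p0).
by rewrite -[leRHS]real_normK ?num_real// lerXn2r ?nnegrE// ltW.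
Qed.

Let lerch1_le x t : normc (lerch_term 1 x t) <= 16^-1 * (x ^+ 2)^-1.
Proof.
rewrite normc_lerch_term1 exprMn invfM ler_wpM2r ?invr_ge0 ?sqr_ge0//.
have := pi_ge2 R => p2.
by rewrite lef_pV2 ?posrE ?exprn_gt0//; nra.
Qed.

(** The constant comes from pi >= 2 and |sin y| >= |y| / 3. Added to the 1/16 of [lerch1_le] it
    stays below 1, so [lerch_bound], with its factor 2 for the two sides, dominates the
    differences. *)
Let fterm_le (N a : nat) (x : R) : (0 < N)%N -> x != 0 -> `|x| <= N%:R ->
  normc (fejer_term N a x) <= 9 / 16 * (x ^+ 2)^-1.
Proof.
move=> N0 x0 xN; rewrite /fejer_term normcM normc_cis mulr1 normc_real.
have bE : (N + N)%:R = 2 * N%:R :> R by rewrite natrD; ring.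
have b0 : 0 < (N + N)%:R :> R by rewrite ltr0n addn_gt0 N0.
move: b0 bE; move: (N + N)%:R => b b0 bE.
have xp : 0 < `|x| by rewrite normr_gt0.
have p2 := pi_ge2 R.
have h : `|pi * x / b| / 3 <= `|sin (pi * x / b)|.
  apply: norm_sin_ge_third; rewrite !normrM normfV (gtr0_norm b0).
  rewrite ger0_norm ?pi_ge0// -mulrA ler_wpM2l ?pi_ge0//.
  by rewrite ler_pdivrMr// bE; lra.
have h2 : (2 * `|x| / b / 3) ^+ 2 <= sin (pi * x / b) ^+ 2.
  rewrite -[leRHS]real_normK ?num_real// lerXn2r ?nnegrE//.
    by rewrite !mulr_ge0// ?invr_ge0 ltW.
  apply: le_trans h; rewrite ler_wpM2r ?invr_ge0// !normrM normfV (gtr0_norm b0).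
  rewrite ler_wpM2r ?invr_ge0 ?(ltW b0)// ler_wpM2r//.
  by rewrite ger0_norm ?pi_ge0.
have -> : 9 / 16 * (x ^+ 2)^-1 = (4 * b ^+ 2 * (2 * `|x| / b / 3) ^+ 2)^-1.
  rewrite -[x ^+ 2]real_normK ?num_real//; field.
  by rewrite (gt_eqF b0) (gt_eqF xp).
have p : 0 < 4 * b ^+ 2 * (2 * `|x| / b / 3) ^+ 2.
  by rewrite !mulr_gt0 ?exprn_gt0// ?mulr_gt0 ?invr_gt0.
have p' : 4 * b ^+ 2 * (2 * `|x| / b / 3) ^+ 2 <= 4 * b ^+ 2 * sin (pi * x / b) ^+ 2.
  by apply: ler_wpM2l => //; apply: mulr_ge0 => //; exact: sqr_ge0.
rewrite ger0_norm ?invr_ge0 ?(le_trans _ p') ?(ltW p)//.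
by rewrite lef_pV2 ?posrE// (lt_le_trans p).
Qed.

Section FixedT.
Variables (t : R) (t01 : 0 <= t <= 1).

Let aN N := Num.truncn ((N + N)%:R * t).

Let aN_le N : (aN N <= N + N)%N.
Proof.
case/andP: t01 => t0 t1; rewrite -(ler_nat R).
have h0 : 0 <= (N + N)%:R * t by rewrite mulr_ge0.
have /andP[h _] := truncn_itv h0.
by rewrite (le_trans h)// ler_piMr.
Qed.

Let aN_close N : (0 < N)%N -> `|(aN N)%:R / (N + N)%:R - t| <= N.+1%:R^-1.
Proof.
case/andP: t01 => t0 t1 N0.
have h0 : 0 <= (N + N)%:R * t by rewrite mulr_ge0.
have /andP[h1 h2] := truncn_itv h0.
have b0 : 0 < (N + N)%:R :> R by rewrite ltr0n addn_gt0 N0.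
have -> : (aN N)%:R / (N + N)%:R - t = - (((N + N)%:R * t - (aN N)%:R) / (N + N)%:R).
  by move: b0; move: (N + N)%:R => b b0; field; rewrite gt_eqF.
rewrite normrN ger0_norm; last by rewrite divr_ge0 ?subr_ge0.
apply: (@le_trans _ _ ((N + N)%:R^-1)).
  rewrite -[leRHS]mul1r ler_wpM2r ?invr_ge0 ?(ltW b0)//.
  by move: h2; rewrite -natr1; rewrite -/(aN N); lra.
have hh : N.+1%:R <= (N + N)%:R :> R by rewrite ler_nat -addn1 leq_add2l.
by rewrite lef_pV2// posrE ltr0n.
Qed.

Let fterm_cvg (x : R) : x != 0 ->
  ((fun N => normc (fejer_term N (aN N) x + lerch_term 1 x t)) @ \oo --> (0 : R))%classic.
Proof.
move=> x0.
pose r N := (4 * (N + N)%:R ^+ 2 * sin (pi * x / (N + N)%:R) ^+ 2)^-1 : R.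
pose r0 := ((2 * pi * x) ^+ 2)^-1 : R.
have r00 : 0 <= r0 by rewrite invr_ge0 sqr_ge0.
have cr : ((fun N => `|r N - r0|) @ \oo --> (0 : R))%classic.
  apply/norm_cvg0P; apply/subr_cvg0.
  have -> : r = (fun N => (4 * ((N + N)%:R * sin (pi * x / (N + N)%:R)) ^+ 2)^-1).
    by apply/funext => N; rewrite /r; congr (_^-1); ring.
  have -> : r0 = (4 * (pi * x) ^+ 2)^-1 by rewrite /r0; congr (_^-1); ring.
  apply: cvgV; first by rewrite mulf_neq0// expf_neq0// mulf_neq0// gt_eqF// pi_gt0.
  apply: cvgMr; have c := @cvg_bsin x; rewrite expr2; under eq_fun do rewrite expr2.
  exact: cvgM.
apply: (@cvg_dominated0 _ (fun N => `|r N - r0| + r0 * `|2 * pi * x| * N.+1%:R^-1)).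
  move=> N N0; rewrite normc_ge0 andTb lerch_term1E.
  set al := - (2 * pi * x * t).
  set be := - (2 * pi * x * (aN N)%:R / (N + N)%:R).
  have -> : fejer_term N (aN N) x + - r0%:C * cis al =
     (r N - r0)%:C * cis be + r0%:C * (cis be - cis al).
    by rewrite /fejer_term -/(r N) -/be rmorphB /=; ring.
  rewrite (le_trans (ler_normcD _ _))// !normcM normc_cis mulr1 !normc_real.
  rewrite lerD2l (ger0_norm r00) -mulrA ler_wpM2l//.
  rewrite (le_trans (normc_cisB _ _))//.
  have -> : be - al = - (2 * pi * x) * ((aN N)%:R / (N + N)%:R - t).
    by rewrite /be /al; ring.
  by rewrite normrM normrN ler_wpM2l// aN_close.
by apply: cvgD0 => //; exact: cvg_harmonicZ.
Qed.

(* The finite identity at a = floor(2Nt), with N -> oo by dominated convergence. *)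
Lemma fejer_limit :
  ((fun N => normc (\sum_(0 <= l < N) (lerch_term 1 (u + l%:R) t +
      lerch_term 1 (u - l.+1%:R) t) - z / (z - 1) ^+ 2 * (1 + t%:C * (z - 1))))
   @ \oo --> (0 : R))%classic.
Proof.
have nz (x : R) l : cu * l.+1%:R <= `|x| -> x != 0.
  by move=> h; rewrite -normr_gt0 (lt_le_trans _ h)// mulr_gt0// ltr0n.
pose d N l := normc (fejer_term N (aN N) (u + l%:R) + lerch_term 1 (u + l%:R) t) +
  normc (fejer_term N (aN N) (u - l.+1%:R) + lerch_term 1 (u - l.+1%:R) t).
have cd : ((fun N => \sum_(0 <= l < N) d N l) @ \oo --> (0 : R))%classic.
  apply: (@tannery _ _ lerch_bound).
  - exact: lerch_bound_ge0.
  - exact: lerch_bound_cvg.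
  - by move=> N l; rewrite addr_ge0// normc_ge0.
  - move=> N l lN; have N0 : (0 < N)%N by exact: leq_ltn_trans lN.
    have H (x : R) : cu * l.+1%:R <= `|x| -> `|x| <= N%:R ->
      normc (fejer_term N (aN N) x + lerch_term 1 x t) <=
      (cu ^+ 2)^-1 * (l.+1%:R ^+ 2)^-1.
      move=> h1 h2; rewrite (le_trans (ler_normcD _ _))//.
      have := fterm_le (aN N) N0 (nz _ _ h1) h2; have := lerch1_le x t.
      have := inv_far h1; have : 0 <= (x ^+ 2)^-1 by rewrite invr_ge0 sqr_ge0.
      have G (A B c e : R) : 0 <= A -> A <= B -> c <= 16^-1 * A -> e <= 9 / 16 * A ->
        e + c <= B by lra.
      exact: G.
    have := H _ (far_p l) (near_p lN); have := H _ (far_n l) (near_n lN).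
    rewrite /d /lerch_bound -mulrA [2 * _]mulr_natl mulr2n => h1 h2.
    exact: lerD.
  - by move=> l; apply: cvgD0; apply: fterm_cvg; [exact: (nz _ l)|exact: (nz _ l)].
pose k := normc (z / (z - 1) ^+ 2 * (z - 1)).
apply: (@cvg_dominated0 _ (fun N => (\sum_(0 <= l < N) d N l) + k * N.+1%:R^-1)); last first.
  by apply: cvgD0 => //; exact: cvg_harmonicZ.
move=> N N0; rewrite normc_ge0 andTb.
pose S : C := \sum_(0 <= l < N) (lerch_term 1 (u + l%:R) t + lerch_term 1 (u - l.+1%:R) t).
rewrite -/S; have E := fejer_term_sum u01 N0 (aN_le N); rewrite -/z in E.
have -> : S - z / (z - 1) ^+ 2 * (1 + t%:C * (z - 1)) =
  \sum_(0 <= l < N) ((fejer_term N (aN N) (u + l%:R) + lerch_term 1 (u + l%:R) t) +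
  (fejer_term N (aN N) (u - l.+1%:R) + lerch_term 1 (u - l.+1%:R) t)) +
  z / (z - 1) ^+ 2 * (z - 1) * ((aN N)%:R / (N + N)%:R - t)%:C.
  have -> : \sum_(0 <= l < N) ((fejer_term N (aN N) (u + l%:R) + lerch_term 1 (u + l%:R) t) +
  (fejer_term N (aN N) (u - l.+1%:R) + lerch_term 1 (u - l.+1%:R) t)) =
     S + - (z / (z - 1) ^+ 2) * (1 + (aN N)%:R / (N + N)%:R * (z - 1)).
    by rewrite -E -big_split /=; apply: eq_bigr => l _; ring.
  by rewrite rmorphB rmorphM fmorphV !rmorph_nat /=; ring.
rewrite (le_trans (ler_normcD _ _))// lerD//.
  rewrite (le_trans (ler_normc_sum _ _ _))// ler_sum// => l _.
  exact: ler_normcD.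
by rewrite normcM normc_real ler_wpM2l ?normc_ge0// aN_close.
Qed.

(** The same majorant bounds the remainder at every stage N, independently of t; this uniformity is
    what integration in t uses. *)
Lemma fejer_tail N :
  normc (\sum_(0 <= l < N) (lerch_term 1 (u + l%:R) t +
      lerch_term 1 (u - l.+1%:R) t) - z / (z - 1) ^+ 2 * (1 + t%:C * (z - 1))) <=
  limn (series lerch_bound) - series lerch_bound N.
Proof.
pose S n : C := \sum_(0 <= l < n) (lerch_term 1 (u + l%:R) t + lerch_term 1 (u - l.+1%:R) t).
rewrite -/(S N).
set L := z / _ * _.
have H N' : (N <= N')%N -> normc (S N - L) <=
    normc (S N' - L) + (limn (series lerch_bound) - series lerch_bound N).
  move=> NN'; have -> : S N - L = (S N' - L) + (S N - S N') by ring.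
  rewrite (le_trans (ler_normcD _ _))// lerD2l.
  have -> : S N - S N' = - (\sum_(N <= l < N') (lerch_term 1 (u + l%:R) t +
      lerch_term 1 (u - l.+1%:R) t)).
    by rewrite /S [X in _ - X](@big_cat_nat _ _ _ N 0%N N')//= opprD addrA subrr add0r.
  rewrite normc_opp (le_trans (ler_normc_sum _ _ _))//.
  apply: (@le_trans _ _ (series lerch_bound N' - series lerch_bound N)).
    rewrite /series /= [X in _ <= X - _](@big_cat_nat _ _ _ N 0%N N')//=.
    rewrite addrAC subrr add0r ler_sum// => l _.
    rewrite (le_trans (ler_normcD _ _))//.
    have := lerch1_le (u + l%:R) t; have := lerch1_le (u - l.+1%:R) t.
    have := inv_far (far_p l); have := inv_far (far_n l).
    have h1 : 0 <= ((u + l%:R) ^+ 2)^-1 by rewrite invr_ge0 sqr_ge0.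
    have h2 : 0 <= ((u - l.+1%:R) ^+ 2)^-1 by rewrite invr_ge0 sqr_ge0.
    have G (A B D c e : R) : 0 <= A -> 0 <= B -> A <= D -> B <= D -> c <= 16^-1 * A ->
      e <= 16^-1 * B -> e + c <= 2 * D by lra.
    by rewrite /lerch_bound -mulrA => ? ? ? ?; apply: G h2 h1 _ _ _ _.
  rewrite lerD2r; apply: nondecreasing_cvgn_le; last exact: lerch_bound_cvg.
  apply/nondecreasing_seqP => n; rewrite /series /= big_nat_recr//= lerDl.
  exact: lerch_bound_ge0.
have cv : ((fun N' => normc (S N' - L) +
   (limn (series lerch_bound) - series lerch_bound N)) @ \oo -->
   0 + (limn (series lerch_bound) - series lerch_bound N))%classic.
  by apply: cvgD; [exact: fejer_limit|exact: cvg_cst].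
rewrite -[leRHS]add0r; apply: (ler_cvg_to (cvg_cst _) cv).
by exists N => // N' /= /H.
Qed.

End FixedT.
End Fixed.
End FejerLimit.

(** * Derivatives of complex functions of a real variable *)

Section ComplexDerivative.
Variable R : realType.
Local Notation C := R[i].
Implicit Types f g : R -> C.

Definition cderiv f g := forall t : R,
  is_derive t (1 : R) (fun s : R => complex.Re (f s)) (complex.Re (g t)) /\
  is_derive t (1 : R) (fun s : R => complex.Im (f s)) (complex.Im (g t)).

Lemma cderiv_eq f g f' g' : f =1 f' -> g =1 g' -> cderiv f g -> cderiv f' g'.
Proof. by move=> /funext <- /funext <-. Qed.

Lemma cderivD f g f' g' : cderiv f f' -> cderiv g g' ->
  cderiv (fun t => f t + g t) (fun t => f' t + g' t).
Proof.
move=> Hf Hg t; have [f1 f2] := Hf t; have [g1 g2] := Hg t.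
rewrite cReD cImD; split.
  by under eq_fun do rewrite cReD; exact: is_deriveD.
by under eq_fun do rewrite cImD; exact: is_deriveD.
Qed.

Lemma cderiv_cst (k : C) : cderiv (fun=> k) (fun=> 0).
Proof. by move=> t; split; exact: is_derive_cst. Qed.

Lemma cderivZ f g k : cderiv f g -> cderiv (fun t => f t * k) (fun t => g t * k).
Proof.
move=> H t; have [f1 f2] := H t; rewrite cReM cImM; split.
  under eq_fun do rewrite cReM.
  apply: is_derive_eq; rewrite /GRing.scale /= ?mulr0 ?addr0; ring.
under eq_fun do rewrite cImM.
apply: is_derive_eq; rewrite /GRing.scale /= ?mulr0 ?addr0; ring.
Qed.

Lemma cderiv_sum (I : Type) (r : seq I) (F G : I -> R -> C) :
  (forall i, cderiv (F i) (G i)) ->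
  cderiv (fun t => \sum_(i <- r) F i t) (fun t => \sum_(i <- r) G i t).
Proof.
move=> H; elim: r => [|i r IH].
  by apply: (cderiv_eq _ _ (cderiv_cst 0)) => t; rewrite big_nil.
by apply: (cderiv_eq _ _ (cderivD (H i) IH)) => t; rewrite big_cons.
Qed.

Lemma cderiv_real (f g : R -> R) : (forall t : R, is_derive t (1 : R) f (g t)) ->
  cderiv (fun t => (f t)%:C) (fun t => (g t)%:C).
Proof. by move=> H t; split => //=; exact: is_derive_cst. Qed.

Lemma cderiv_cis (c : R) : cderiv (fun t => cis (c * t)) (fun t => cis (c * t) * ('i%C * c%:C)).
Proof.
have dc (t : R) : is_derive t (1 : R) (fun s : R => c * s) c.
  have := is_deriveZ c (is_derive_id t (1 : R)).
  by rewrite /GRing.scale /= mulr1.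
move=> t; rewrite cReM cImM cReM cImM /=; split.
  have := is_derive1_comp (is_derive_cos (c * t)) (dc t).
  by move/is_derive_eq; apply; rewrite /cis /=; ring.
have := is_derive1_comp (is_derive_sin (c * t)) (dc t).
by move/is_derive_eq; apply; rewrite /cis /=; ring.
Qed.

(** The mean value theorem applies to each component separately, hence the factor 2. *)
Lemma cderiv_mean_value f g (a b B : R) : cderiv f g -> a <= b ->
  (forall t, a <= t <= b -> normc (g t) <= B) ->
  normc (f b - f a) <= 2 * (B * (b - a)).
Proof.
move=> H ab gB.
rewrite (le_trans (normc_le_ReIm _))// [2 * _]mulr_natl mulr2n.
rewrite cReD cReN cImD cImN lerD//.
  have [c cab ->] := mean_value ab (fun t => proj1 (H t)).
  rewrite normrM [`|b - a|]ger0_norm ?subr_ge0// ler_wpM2r ?subr_ge0//.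
  by rewrite (le_trans (Re_le_normc _))// gB.
have [c cab ->] := mean_value ab (fun t => proj2 (H t)).
rewrite normrM [`|b - a|]ger0_norm ?subr_ge0// ler_wpM2r ?subr_ge0//.
by rewrite (le_trans (Im_le_normc _))// gB.
Qed.

End ComplexDerivative.

(** * Repeated integration of the linear case *)

Section Lerch.
Variable R : realType.
Local Notation C := R[i].

(** [Phi] on a unit cell without its prefactor, written as an Appell sequence in t: differentiation
    lowers m, exactly as for [lerch_term]. *)
Definition euler_spline (z : C) (m : nat) (t : R) : C :=
  \sum_(j < m.+1) (t ^+ (m - j) / (m - j)`!%:R)%:C * gcoef z j.

Lemma Phi_euler_spline p (t : R) (z : C) : z != 1 -> z != 0 ->
  Phi p t z = z ^ Num.floor t * (1 - z^-1) ^+ p * euler_spline z p (fract t).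
Proof.
move=> z1 z0; rewrite /Phi Pi_E (negbTE z1); congr (_ * _).
apply: eq_bigr => j _; rewrite /gcoef.
have jp : (j <= p)%N by rewrite leq_ord.
have f0 n : (n`!%:R : C) != 0 by rewrite pnatr_eq0 -lt0n fact_gt0.
have zB1 : z - 1 != 0 by rewrite subr_eq0.
have e := expf_neq0 j zB1.
have c0 : ('C(p, j)%:R : C) != 0 by rewrite pnatr_eq0 -lt0n bin_gt0.
rewrite -(bin_fact jp) !natrM rmorphM fmorphV rmorphXn rmorph_nat.
by field; rewrite e c0 !f0.
Qed.

Lemma cderiv_euler_spline z m : cderiv (euler_spline z m.+1) (euler_spline z m).
Proof.
have dX n : cderiv (fun t : R => (t ^+ n.+1 / n.+1`!%:R)%:C) (fun t => (t ^+ n / n`!%:R)%:C).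
  apply: cderiv_real => t.
  have f0 : (n`!%:R : R) != 0 by rewrite pnatr_eq0 -lt0n fact_gt0.
  have n0 : (n.+1%:R : R) != 0 by rewrite pnatr_eq0.
  have := is_deriveZ (n.+1`!%:R^-1) (is_deriveX n.+1 (is_derive_id t (1 : R))).
  have -> : n.+1`!%:R^-1 \*: (id : R -> R) ^+ n.+1 = (fun t => t ^+ n.+1 / n.+1`!%:R).
    by apply/funext => s; rewrite exprfctE /GRing.scale /= mulrC.
  move/is_derive_eq; apply; rewrite /GRing.scale /= mulr1 factS natrM.
  by rewrite invfM mulrACA mulVf// mul1r mulrC.
have H1 : cderiv (fun t => \sum_(j < m.+1) (t ^+ (m.+1 - j) / (m.+1 - j)`!%:R)%:C * gcoef z j)
   (euler_spline z m).
  apply: cderiv_sum => j; apply: cderivZ.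
  by rewrite subSn ?leq_ord//; exact: dX.
apply: (cderiv_eq _ _ (cderivD H1 (cderiv_cst (gcoef z m.+1)))) => t.
  by rewrite /euler_spline [RHS]big_ord_recr /= subnn expr0 fact0 divr1 mul1r.
by rewrite addr0.
Qed.

Lemma cderiv_lerch m x : x != 0 -> cderiv (@lerch_term R m.+1 x) (lerch_term m x).
Proof.
move=> x0; set k := (('i%C * (- (2 * pi * x))%:C) ^+ m.+2 : C)^-1.
have w0 : 'i%C * (- (2 * pi * x))%:C != 0 :> C.
  rewrite mulf_neq0//; first by rewrite eq_complex /= oner_eq0 andbF.
  by rewrite fmorph_eq0 oppr_eq0 !mulf_neq0// gt_eqF// pi_gt0.
apply: (cderiv_eq _ _ (cderivZ k (cderiv_cis (- (2 * pi * x))))) => t.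
  by rewrite /lerch_term mulNr.
rewrite /lerch_term mulNr /k exprS; move: w0; set w := 'i%C * _ => w0.
by have w1 := expf_neq0 m.+1 w0; field; rewrite w1 w0.
Qed.

(** The boundary condition f(1) = z f(0) is [gcoef_rec] in order m + 1. *)
Lemma euler_spline_shift z m : z != 1 ->
  euler_spline z m.+1 1 = z * euler_spline z m.+1 0.
Proof.
move=> z1; have := gcoef_rec z1 m.+1; rewrite mul0r subr0 => E.
rewrite /euler_spline; transitivity (\sum_(j < m.+2) gcoef z j / (m.+1 - j)`!%:R).
  apply: eq_bigr => j _.
  by rewrite expr1n mul1r fmorphV rmorph_nat mulrC.
rewrite E; congr (_ * _).
rewrite big_ord_recr /= big1 => [|j _].
  by rewrite subnn expr0 fact0 divr1 mul1r add0r.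
by rewrite expr0n subn_eq0 leqNgt ltn_ord mul0r mul0r.
Qed.

Section Fixed.
Variables (u : R) (u01 : 0 < u < 1).
Let z : C := cis (- (2 * pi * u)).
Let z1 : z != 1. Proof. exact: cis_neq1. Qed.

Let lsum m N t : C := \sum_(0 <= l < N) (lerch_term m (u + l%:R) t + lerch_term m (u - l.+1%:R) t).
Let D m N t : C := lsum m N t - z / (z - 1) * euler_spline z m t.

Let tau N := limn (series (lerch_bound u)) - series (lerch_bound u) N.

Let tau_cvg : (tau @ \oo --> (0 : R))%classic.
Proof.
rewrite -(subrr (limn (series (lerch_bound u)))); apply: cvgB; first exact: cvg_cst.
exact: lerch_bound_cvg.
Qed.

Let pt_neq0 l : (u + l%:R != 0) /\ (u - l.+1%:R != 0).
Proof.
case/andP: u01 => u0 u1; have l0 : 0 <= l%:R :> R by [].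
by split; [rewrite gt_eqF//; lra|rewrite lt_eqF// -natr1; lra].
Qed.

Let cderivD m N : cderiv (D m.+1 N) (D m N).
Proof.
have d1 : cderiv (lsum m.+1 N) (lsum m N).
  apply: cderiv_sum => l; have [h1 h2] := pt_neq0 l.
  by apply: cderivD; apply: cderiv_lerch.
apply: (cderiv_eq _ _ (cderivD d1 (cderivZ (- (z / (z - 1))) (@cderiv_euler_spline z m)))) => t;
  rewrite /D; ring.
Qed.

(* As z <> 1, this quasi-periodicity fixes the constant of integration when
   [D m] is integrated to [D m.+1]. *)
Let D_shift m N : D m.+1 N 1 = z * D m.+1 N 0.
Proof.
rewrite /D mulrBr euler_spline_shift//; congr (_ - _); last by ring.
rewrite /lsum mulr_sumr; apply: eq_bigr => l _; rewrite mulrDr /lerch_term.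
rewrite !mulr0 oppr0 cis0 !mulr1 !mul1r.
have -> : - (2 * pi * (u - l.+1%:R)) = - (2 * pi * (u + (- l.+1%:Z)%:~R)) :> R.
  by rewrite mulrNz.
by rewrite (cis_shift _ l) cis_shift.
Qed.

(** Induction on m: the mean value theorem bounds the variation of the new difference on [0, 1], and
    (z - 1) D(0) = D(1) - D(0) bounds its value at 0. Each integration multiplies the constant by 2
    + 2 / |z - 1|. *)
Lemma lerch_uniform m : exists2 k, 0 <= k & forall N t, 0 <= t <= 1 ->
  normc (D m.+1 N t) <= k * tau N.
Proof.
have zB1 : z - 1 != 0 by rewrite subr_eq0.
elim: m => [|m [k k0 IH]].
  exists 1 => // N t t01; rewrite mul1r (le_trans _ (fejer_tail u01 t01 N))//.
  rewrite le_eqVlt; apply/orP; left; apply/eqP; congr normc; rewrite /D -/z.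
  congr (_ - _); rewrite /euler_spline big_ord_recr big_ord1 /= /gcoef.
  rewrite eulerianE0 eulerian1 !hornerC subn0 subnn expr0 expr1 !fact0 !divr1.
  by rewrite !expr0 expr1 rmorph1; field.
exists ((2 + 2 / normc (z - 1)) * k).
  by rewrite mulr_ge0// addr_ge0// divr_ge0// normc_ge0.
move=> N t /andP[t0 t1].
have mv (a b : R) : 0 <= a -> a <= b -> b <= 1 ->
    normc (D m.+2 N b - D m.+2 N a) <= 2 * (k * tau N).
  move=> a0 ab b1; rewrite (le_trans (cderiv_mean_value (cderivD m.+1 N) ab (B := k * tau N) _))//.
    by move=> s /andP[sa sb]; rewrite IH// (le_trans a0 sa) (le_trans sb b1).
  have kt : 0 <= k * tau N by rewrite (le_trans (normc_ge0 _) (IH N 0 _))// lexx ler01.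
  by rewrite ler_wpM2l// ler_piMr// lerBlDr; lra.
have h0 : normc (D m.+2 N 0) <= 2 / normc (z - 1) * (k * tau N).
  have nz : 0 < normc (z - 1) by rewrite normc_gt0.
  rewrite mulrAC ler_pdivlMr// mulrC -normcM.
  have -> : (z - 1) * D m.+2 N 0 = D m.+2 N 1 - D m.+2 N 0 by rewrite D_shift; ring.
  exact: mv.
have -> : D m.+2 N t = D m.+2 N 0 + (D m.+2 N t - D m.+2 N 0) by ring.
rewrite (le_trans (ler_normcD _ _))// -mulrA mulrDl addrC lerD//.
exact: mv.
Qed.

Lemma lerch_cvg m (t : R) : 0 <= t <= 1 ->
  ((fun N => normc (\sum_(0 <= l < N) (lerch_term m.+1 (u + l%:R) t +
     lerch_term m.+1 (u - l.+1%:R) t) - z / (z - 1) * euler_spline z m.+1 t))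
  @ \oo --> (0 : R))%classic.
Proof.
move=> t01; have [k k0 H] := lerch_uniform m.
apply: (@cvg_dominated0 _ _ (fun N => k * tau N)).
  by move=> N _; rewrite normc_ge0 andTb H.
by rewrite -(mulr0 k); apply: cvgMr; exact: tau_cvg.
Qed.

End Fixed.
End Lerch.

(** * Poisson summation for odd-degree splines *)

Section Poisson.
Variable R : realType.
Local Notation C := R[i].

Definition zu (u : R) : C := cis (- (2 * pi * u)).

Lemma zu_neq0 u : zu u != 0. Proof. exact: cis_neq0. Qed.

Lemma normc_zu u : normc (zu u) = 1. Proof. exact: normc_cis. Qed.

Lemma zu0 : zu 0 = 1.
Proof. by rewrite /zu mulr0 oppr0 cis0. Qed.

Lemma zu1 : zu 1 = 1.
Proof. by have := cis_shift (0 : R) 1; rewrite add0r => H; rewrite /zu H mulr0 oppr0 cis0. Qed.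

Lemma sin2_shift (u : R) (m : int) : sin (pi * (u + m%:~R)) ^+ 2 = sin (pi * u) ^+ 2.
Proof.
have E (y : R) : sin (pi * y) ^+ 2 = (1 - complex.Re (cis (- (2 * pi * y)) : C)) / 2.
  by rewrite /= cosN -mulrA [2 * _]mulr_natl cos_mulr2n cos2sin2 -mulr_natr; field.
by rewrite !E cis_shift.
Qed.

Lemma sin_pi_int (m : int) : sin (pi * m%:~R) = 0 :> R.
Proof.
apply/eqP; rewrite -sqrf_eq0; have := sin2_shift 0 m.
by rewrite add0r mulr0 sin0 expr0n => ->.
Qed.

Lemma sinc_pi_int (m : int) : m != 0 -> sinc (pi * m%:~R) = 0 :> R.
Proof.
move=> m0; rewrite /sinc sin_pi_int mul0r; case: eqP => // /eqP.
by rewrite mulf_eq0 intr_eq0 (negbTE m0) orbF gt_eqF// pi_gt0.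
Qed.

Lemma sinc0 : sinc 0 = 1 :> R. Proof. by rewrite /sinc eqxx. Qed.

Lemma sincN x : sinc (- x) = sinc x :> R.
Proof. by rewrite /sinc oppr_eq0 sinN invrN mulrNN. Qed.

Lemma sinc_pi_sqr (u : R) (m : int) : u + m%:~R != 0 ->
  sinc (pi * (u + m%:~R)) ^+ 2 = sin (pi * u) ^+ 2 / (pi * (u + m%:~R)) ^+ 2.
Proof.
move=> x0; rewrite /sinc mulf_eq0 (negbTE x0) orbF gt_eqF ?pi_gt0//.
by rewrite expr_div_n sin2_shift.
Qed.

Lemma sinc_sqr_le1 x : sinc x ^+ 2 <= 1 :> R.
Proof.
rewrite /sinc; case: eqP => [_|/eqP x0]; first by rewrite expr1n.
rewrite expr_div_n ler_pdivrMr ?mul1r; last by rewrite exprn_even_gt0.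
have := norm_sin_le x; rewrite -(@ler_pXn2r _ 2) ?nnegrE//.
by rewrite !real_normK ?num_real.
Qed.

Lemma sinc_even_ge0 x n : 0 <= sinc x ^+ (2 * n) :> R.
Proof. by rewrite exprM exprn_ge0// sqr_ge0. Qed.

Definition pterm n X x : C := (sinc (pi * x) ^+ (2 * n))%:C * cis (- (2 * pi * x * X)).

Lemma pterm_int n X (m : int) : (0 < n)%N -> pterm n X m%:~R = (m == 0)%:R.
Proof.
move=> n0; rewrite /pterm; have [->|m0] := eqVneq m 0.
  by rewrite mulr0 sinc0 expr1n mulr0 mul0r oppr0 cis0 mulr1.
by rewrite sinc_pi_int// expr0n muln_eq0 /= (gtn_eqF n0) mul0r.
Qed.

Let posD1 (u : R) l : u + l%:R = u + (l%:Z)%:~R. Proof. by []. Qed.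
Let negD1 (u : R) l : u - l.+1%:R = u + (- l.+1%:Z)%:~R.
Proof. by rewrite mulrNz. Qed.

(** At the ends z = 1 and the integration argument breaks down. There sinc vanishes at every nonzero
    integer, so only the term at the point 0 survives, which matches the convention [Phi] = 1. *)
Lemma poisson_end n X u : (0 < n)%N -> u \in [:: 0; 1] ->
  forall N, (0 < N)%N ->
  \sum_(0 <= l < N) (pterm n X (u + l%:R) + pterm n X (u - l.+1%:R)) = 1.
Proof.
move=> n0 u01 [//|N] _; rewrite big_nat_recl//= big1 => [|l _].
  move: u01; rewrite !inE => /orP[] /eqP ->; rewrite posD1 negD1.
    by rewrite !add0r !pterm_int// addr0 addr0.
  rewrite -[1 : R]/(1%:~R) -!intrD !pterm_int//= add0r addr0//.
move: u01; rewrite !inE => /orP[] /eqP ->; rewrite posD1 negD1.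
  by rewrite !add0r !pterm_int// addr0.
rewrite -[1 : R]/(1%:~R) -!intrD !pterm_int//.
have -> : (1%:Z + l.+1%:Z == 0) = false by apply/negP => /eqP; lia.
have -> : (1%:Z - l.+2%:Z == 0) = false by apply/negP => /eqP; lia.
by rewrite addr0.
Qed.

(** sin (pi x)^2 is the same at all points x of u + Z, so the powers of sinc share a factor,
    expressed through (z - 1)^2 / z = - 4 sin (pi u)^2. The integer part of X contributes a power of
    z. *)
Lemma pterm_lerch n X (u : R) (m : int) : 0 < u < 1 -> u + m%:~R != 0 ->
  pterm n.+1 X (u + m%:~R) =
  ((zu u - 1) ^+ 2 / zu u) ^+ n.+1 * zu u ^ Num.floor X *
  lerch_term (2 * n).+1 (u + m%:~R) (fract X).
Proof.
move=> u01 x0; set x := u + m%:~R in x0 *.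
have z0 := zu_neq0 u.
have -> : (zu u - 1) ^+ 2 / zu u = - (4 * sin (pi * u) ^+ 2)%:C.
  rewrite /zu -mulrA -mulrN cis2B1_sqr sinN sqrrN mulfK//.
  exact: cis_neq0.
have -> : zu u ^ Num.floor X = cis (- (2 * pi * x * (Num.floor X)%:~R)).
  rewrite /zu -cisMz.
  have -> : - (2 * pi * x * (Num.floor X)%:~R) =
    (Num.floor X)%:~R * - (2 * pi * u) + - (2 * pi * (0 + (m * Num.floor X)%:~R)).
    by rewrite /x intrM; ring.
  by rewrite [in RHS]cisD cis_shift mulr0 oppr0 cis0 mulr1.
rewrite /pterm /lerch_term.
have -> : (2 * n).+2 = (2 * n.+1)%N by lia.
rewrite exprM sinc_pi_sqr// -/x [('i%C * _) ^+ _]exprM.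
have -> : ('i%C * (- (2 * pi * x))%:C) ^+ 2 = - ((2 * pi * x)%:C ^+ 2) :> C.
  by rewrite exprMn sqr_i rmorphN sqrrN mulN1r.
have -> : cis (- (2 * pi * x * X)) = cis (- (2 * pi * x * (Num.floor X)%:~R)) *
   cis (- (2 * pi * x * fract X)) :> C.
  by rewrite -cisD /fract; congr cis; ring.
have -> : (sin (pi * u) ^+ 2 / (pi * x) ^+ 2) ^+ n.+1 =
   (4 * sin (pi * u) ^+ 2) ^+ n.+1 / ((2 * pi * x) ^+ 2) ^+ n.+1.
  rewrite -[RHS]expr_div_n; congr (_ ^+ _); move: (pi_gt0 R); move: (@pi R) => P P0.
  by field; rewrite x0 gt_eqF.
rewrite rmorphM fmorphV !rmorphXn /= [(- (4 * _)%:C) ^+ _]exprNn [(- (_ ^+ 2)) ^+ _]exprNn.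
have s0 : ((-1) ^+ n.+1 : C) != 0 by rewrite expf_neq0// oppr_eq0 oner_neq0.
have p0 : (2 * pi * x)%:C != 0 :> C.
  by rewrite fmorph_eq0 !mulf_neq0// gt_eqF// pi_gt0.
have p1 : ((2 * pi * x)%:C ^+ 2) ^+ n.+1 != 0 by rewrite !expf_neq0.
move: s0 p1; move: ((-1) ^+ n.+1 : C) (_ ^+ n.+1 : C) => a b a0 b0.
by field; rewrite a0 b0.
Qed.

Lemma poisson n X u : (0 < n)%N -> 0 <= u <= 1 ->
  ((fun N => normc (\sum_(0 <= l < N) (pterm n X (u + l%:R) + pterm n X (u - l.+1%:R))
     - Phi (2 * n - 1) (X + n%:R) (zu u))) @ \oo --> (0 : R))%classic.
Proof.
move=> n0 /andP[u0 u1].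
have endc : u \in [:: 0; 1] -> zu u = 1.
  by rewrite !inE => /orP[] /eqP ->; rewrite ?zu0 ?zu1.
have [/[dup] ue /endc ze|ue] := boolP (u \in [:: 0; 1]).
  apply: (@cvg_dominated0 _ _ (fun=> 0)); last exact: cvg_cst.
  move=> N N0; rewrite poisson_end// ze /Phi eqxx subrr normc0 lexx//.
have u01 : 0 < u < 1.
  by move: ue; rewrite !inE negb_or => /andP[a b]; rewrite !lt_neqAle u0 u1 b eq_sym a.
case: n n0 => // n _.
have z1 : zu u != 1 by exact: cis_neq1.
have z0 := zu_neq0 u.
set A := ((zu u - 1) ^+ 2 / zu u) ^+ n.+1 * zu u ^ Num.floor X.
have fX : 0 <= fract X <= 1 by rewrite fract_ge0 ltW// fract_lt1.
have := lerch_cvg u01 (2 * n) fX; rewrite -/(zu u) => H.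
apply: (@cvg_dominated0 _ _ (fun N => normc A * normc
  (\sum_(0 <= l < N)
     (lerch_term (2 * n).+1 (u + l%:R) (fract X) +
      lerch_term (2 * n).+1 (u - l.+1%:R) (fract X)) -
   zu u / (zu u - 1) * euler_spline (zu u) (2 * n).+1 (fract X)))); last first.
  by rewrite -(mulr0 (normc A)); apply: cvgMr; exact: H.
move=> N N0; rewrite normc_ge0 andTb -normcM mulrBr mulr_sumr.
rewrite le_eqVlt; apply/orP; left; apply/eqP; congr normc; congr (_ - _).
  apply: eq_bigr => l _.
  case/andP: u01 => u0' u1'; have l0 : 0 <= l%:R :> R by [].
  have lS : l.+1%:R = l%:R + 1 :> R by rewrite natr1.
  rewrite mulrDr; congr (_ + _).
    by rewrite posD1 (@pterm_lerch n X u l)// ?u0'// -posD1 gt_eqF//; lra.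
  by rewrite negD1 (@pterm_lerch n X u (- l.+1%:Z))// ?u0'// -negD1 lt_eqF//; lra.
have -> : (2 * n.+1 - 1 = (2 * n).+1)%N by rewrite mulnS add2n subSS subn0.
rewrite Phi_euler_spline// fractDn floorDn /A expfzDr// mulrA; congr (_ * _).
have zB1 : zu u - 1 != 0 by rewrite subr_eq0.
rewrite -[zu u ^ n.+1]/(zu u ^+ n.+1) [(1 - _) ^+ _]exprS exprM.
have -> : (1 - (zu u)^-1) ^+ 2 = ((zu u - 1) ^+ 2 / zu u) / zu u by field.
rewrite expr_div_n [((zu u - 1) ^+ 2 / zu u) ^+ n.+1]exprS.
have zn := expf_neq0 n z0.
by rewrite [zu u ^+ n.+1]exprS; field; rewrite zn zB1 z0.
Qed.

End Poisson.

(** * Sums of even powers of sinc *)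

Section SincSums.
Variable R : realType.
Local Notation C := R[i].

Let sp n (u : R) l : R := sinc (pi * (u + l%:R)) ^+ (2 * n).
Let sn n (u : R) l : R := sinc (pi * (u - l.+1%:R)) ^+ (2 * n).
Let T n u N : R := \sum_(0 <= l < N) (sp n u l + sn n u l).

Let add3rK (V : zmodType) (a b c : V) : a + b + c - a = b + c.
Proof. by rewrite addrAC [a + b]addrC addrK. Qed.

Lemma ler_cvg0D (f : nat -> R) (a b : R) : (f @ \oo --> (0 : R))%classic ->
  (forall N, (0 < N)%N -> a <= f N + b) -> a <= b.
Proof.
move=> f0 fab; have cv : ((fun N => f N + b) @ \oo --> 0 + b)%classic.
  by apply: cvgD => //; exact: cvg_cst.
rewrite -[leRHS]add0r; apply: (ler_cvg_to (cvg_cst _) cv).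
by exists 1%N => // N N0; exact: fab.
Qed.

Lemma cvg_eq0_normc (f : nat -> R) (p : C) :
  ((fun N => normc ((f N)%:C - p)) @ \oo --> (0 : R))%classic ->
  (f @ \oo --> complex.Re p)%classic /\ complex.Im p = 0.
Proof.
move=> H; split.
  apply/subr_cvg0/norm_cvg0P; apply: (@cvg_dominated0 _ _ _ _ H) => N _.
  rewrite normr_ge0 /= (le_trans _ (Re_le_normc _))//.
  by rewrite cReD cReN.
apply/eqP; rewrite -normr_eq0 eq_le normr_ge0 andbT.
apply: (ler_cvg_to (cvg_cst _) H); exists 0%N => // N _.
by rewrite (le_trans _ (Im_le_normc _))// cImD cImN /= sub0r normrN.
Qed.

Section Fixed.
Variables (n : nat) (n0 : (0 < n)%N) (u : R) (u01 : 0 <= u <= 1).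

Let P : C := Phi (2 * n - 1) n%:R (zu u).

Let T_Phi : (T n u @ \oo --> complex.Re P)%classic /\ complex.Im P = 0.
Proof.
apply: cvg_eq0_normc; have := poisson 0 n0 u01; rewrite add0r -/P.
apply: cvg_trans; apply: near_eq_cvg; exists 0%N => // N _ /=.
congr (normc (_ - _)); rewrite rmorph_sum /=; apply: eq_bigr => l _.
by rewrite /pterm !mulr0 oppr0 cis0 !mulr1 rmorphD.
Qed.

Let TE N : T n u N = series (sp n u) N + series (sn n u) N.
Proof. by rewrite /T /series /= big_split. Qed.

Let series_nd (f : nat -> R) : (forall l, 0 <= f l) -> nondecreasing_seq (series f).
Proof.
move=> f0; apply/nondecreasing_seqP => N; rewrite /series /= big_nat_recr//=.
by rewrite lerDl f0.
Qed.

Let sp0 l : 0 <= sp n u l. Proof. exact: sinc_even_ge0. Qed.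
Let sn0 l : 0 <= sn n u l. Proof. exact: sinc_even_ge0. Qed.

Let T_nd : nondecreasing_seq (T n u).
Proof.
by move=> N N' NN'; rewrite !TE lerD// series_nd.
Qed.

Let T_le N : T n u N <= complex.Re P.
Proof.
have [c _] := T_Phi; rewrite -(cvg_lim (@Rhausdorff R) c).
by apply: nondecreasing_cvgn_le => //; apply/cvg_ex; exists (complex.Re P).
Qed.

Let series_ge0 (f : nat -> R) N : (forall l, 0 <= f l) -> 0 <= series f N.
Proof. by move=> f0; rewrite /series /= sumr_ge0. Qed.

(** [poisson] controls only the symmetric partial sums; as the terms are nonnegative, each half
    series converges too, so the two limits in [Qsum] are genuine. *)
Let sp_cvg : cvgn (series (sp n u)).
Proof.
apply: nondecreasing_is_cvgn; first exact: series_nd.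
exists (complex.Re P) => _ [N _ <-]; rewrite (le_trans _ (T_le N))// TE lerDl.
exact: series_ge0.
Qed.

Let sn_cvg : cvgn (series (sn n u)).
Proof.
apply: nondecreasing_is_cvgn; first exact: series_nd.
exists (complex.Re P) => _ [N _ <-]; rewrite (le_trans _ (T_le N))// TE lerDr.
exact: series_ge0.
Qed.

Let deg2 : (2 * n - 2 + 2 = 2 * n)%N.
Proof. by rewrite subnK// leq_pmulr. Qed.

Let T_Qsum : (T n u @ \oo --> Qsum (2 * n - 2) u)%classic.
Proof.
rewrite /Qsum deg2 -/(sp n u) -/(sn n u).
have -> : T n u = (fun N => series (sp n u) N + series (sn n u) N).
  by apply/funext => N; rewrite TE.
by apply: cvgD; [exact: sp_cvg|exact: sn_cvg].
Qed.

Lemma Qsum_Phi : (Qsum (2 * n - 2) u)%:C = P.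
Proof.
have [c i0] := T_Phi; apply: complex_eqP => //=.
by rewrite -(cvg_lim (@Rhausdorff R) c) (cvg_lim (@Rhausdorff R) T_Qsum).
Qed.

Lemma Qsum_partial_le N : T n u N <= Qsum (2 * n - 2) u.
Proof. by rewrite (le_trans (T_le N))// -[leRHS]/(complex.Re (_%:C)) Qsum_Phi. Qed.

Lemma Qsum_partial_cvg : (T n u @ \oo --> Qsum (2 * n - 2) u)%classic.
Proof. exact: T_Qsum. Qed.

Lemma Qsum_ge_term : sinc (pi * u) ^+ (2 * n) <= Qsum (2 * n - 2) u.
Proof.
rewrite (le_trans _ (Qsum_partial_le 1))// /T big_nat1 /sp addr0 lerDl; exact: sn0.
Qed.

(** Each mode has modulus sinc^(2n) whatever X is, so those other than l = 0 contribute at most what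
    they contribute to [Qsum]. *)
Lemma Phi_near_term X :
  normc (Phi (2 * n - 1) (X + n%:R) (zu u) - pterm n X u) <=
  Qsum (2 * n - 2) u - sinc (pi * u) ^+ (2 * n).
Proof.
have npt x : normc (pterm n X x) = sinc (pi * x) ^+ (2 * n).
  by rewrite /pterm normcM normc_cis mulr1 normc_real ger0_norm// sinc_even_ge0.
set p := Phi _ _ _.
pose S N : C := \sum_(0 <= l < N) (pterm n X (u + l%:R) + pterm n X (u - l.+1%:R)).
have H N : (0 < N)%N -> normc (p - pterm n X u) <=
    normc (S N - p) + (Qsum (2 * n - 2) u - sinc (pi * u) ^+ (2 * n)).
  move=> N0; have -> : p - pterm n X u = - (S N - p) + (S N - pterm n X u) by ring.
  rewrite (le_trans (ler_normcD _ _))// normc_opp lerD2l.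
  rewrite (le_trans _ (lerB (Qsum_partial_le N) (lexx _)))//.
  case: N N0 => // N _; rewrite /S /T !big_nat_recl//= /sp /sn addr0.
  rewrite !add3rK (le_trans (ler_normcD _ _))// lerD//.
    by rewrite npt.
  rewrite (le_trans (ler_normc_sum _ _ _))// ler_sum// => l _.
  by rewrite (le_trans (ler_normcD _ _))// !npt.
exact: (ler_cvg0D (poisson X n0 u01) H).
Qed.

Lemma Phi_le_Qsum X : normc (Phi (2 * n - 1) (X + n%:R) (zu u)) <= Qsum (2 * n - 2) u.
Proof.
have -> : Phi (2 * n - 1) (X + n%:R) (zu u) =
  (Phi (2 * n - 1) (X + n%:R) (zu u) - pterm n X u) + pterm n X u by ring.
rewrite (le_trans (ler_normcD _ _))//.
have -> : normc (pterm n X u) = sinc (pi * u) ^+ (2 * n).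
  by rewrite /pterm normcM normc_cis mulr1 normc_real ger0_norm// sinc_even_ge0.
by rewrite -lerBrDr Phi_near_term.
Qed.

(** At the integer argument n the fractional part is 0, and 0^(p - j) keeps only j = p = 2n - 1. *)
Lemma Qsum_eulerian : (Qsum (2 * n - 2) u)%:C =
  zu u ^ (1 - n%:Z) * (eulerian C (2 * n - 1)).[zu u] / (2 * n - 1)`!%:R.
Proof.
rewrite Qsum_Phi /P -[n%:R]add0r Phi_shiftE ?zu_neq0// floor0 /fract floor0 subr0.
rewrite -mulrA; congr (_ ^ _ * _); first by rewrite add0r; lia.
rewrite /spline_poly horner_sum big_ord_recr /= big1 => [|j _].
  rewrite subnn binn !expr0 !mul1r hornerZ add0r mulrC; congr (_ * _).
by rewrite hornerZ expr0n subn_eq0 leqNgt ltn_ord mulr0 !mul0r.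
Qed.

End Fixed.

Lemma Qsum_sym m (u : R) : Qsum m (1 - u) = Qsum m u.
Proof.
rewrite /Qsum addrC.
have E (x y : R) : x = - y -> sinc (pi * x) ^+ (m + 2) = sinc (pi * y) ^+ (m + 2).
  by move=> ->; rewrite mulrN sincN.
congr (limn (series _) + limn (series _)); apply/funext => l; apply: E.
  by rewrite -natr1; ring.
by rewrite -natr1; ring.
Qed.

Lemma Qsum0E (u : R) : 0 <= u <= 1 -> Qsum 0 u = 1.
Proof.
move=> u01; have := Qsum_eulerian (ltn0Sn 0) u01.
rewrite muln1 subnn -[(2 - 1)%N]/1%N eulerian1 hornerC subrr expr0z.
by rewrite !mul1r factS fact0 muln1 invr1 => /complexI.
Qed.

Lemma Qsum_le1 n (u : R) : (0 < n)%N -> 0 <= u <= 1 -> Qsum (2 * n - 2) u <= 1.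
Proof.
move=> n0 u01; rewrite -(Qsum0E u01).
have c1 := Qsum_partial_cvg n0 u01; have := Qsum_partial_cvg (ltn0Sn 0) u01.
rewrite muln1 subnn => c2; apply: (ler_cvg_to c1 c2); exists 0%N => // N _ /=.
have h (x : R) : sinc x ^+ (2 * n) <= sinc x ^+ (2 * 1).
  case: n n0 {c1} => // n _; rewrite !exprM expr1 exprS ler_piMr ?sqr_ge0//.
  by rewrite exprn_ile1 ?sqr_ge0// sinc_sqr_le1.
by rewrite ler_sum// => l _; rewrite lerD ?h.
Qed.

Lemma sinc_ge_third (u : R) : 0 <= u <= 2^-1 -> 3^-1 <= sinc (pi * u).
Proof.
move=> /andP[u0 u2]; rewrite /sinc; case: eqP => [_|/eqP x0]; first by lra.
have p0 := pi_gt0 R.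
have x1 : 0 < pi * u by rewrite lt0r x0 mulr_ge0// ltW.
rewrite ler_pdivlMr// mulrC; apply: sin_ge_third; rewrite ltW//=.
by rewrite ler_wpM2l// ltW.
Qed.

(** By the symmetry u -> 1 - u it is enough to take u <= 1/2, where the l = 0 term alone suffices
    because sinc (pi u) >= 1/3. *)
Lemma Qsum_lower n (u : R) : (0 < n)%N -> 0 <= u <= 1 ->
  (3 ^+ (2 * n))^-1 <= Qsum (2 * n - 2) u.
Proof.
move=> n0; wlog u2 : u / u <= 2^-1 => [H|] /andP[u0 u1].
  have [h|h] := leP u 2^-1; first by rewrite H// u0.
  by rewrite -Qsum_sym H//; [lra|apply/andP; split; lra].
rewrite (le_trans _ (Qsum_ge_term n0 _)) ?u0//.
by rewrite -exprVn lerXn2r ?nnegrE ?invr_ge0 ?sinc_ge_third ?u0// (le_trans _ (sinc_ge_third _)) ?u0 ?invr_ge0.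
Qed.

Lemma Qsum_gt0 n (u : R) : (0 < n)%N -> 0 <= u <= 1 -> 0 < Qsum (2 * n - 2) u.
Proof.
by move=> n0 u01; rewrite (lt_le_trans _ (Qsum_lower n0 u01))// invr_gt0 exprn_gt0.
Qed.

Lemma sinc_ge_quadratic (u : R) : 0 <= u <= 2^-1 -> 1 - sinc (pi * u) ^+ 2 <= 8 * u ^+ 2.
Proof.
move=> /andP[u0 u2]; rewrite /sinc; case: eqP => [_|/eqP x0].
  by rewrite expr1n subrr mulr_ge0// sqr_ge0.
have p0 := pi_gt0 R.
have x1 : 0 < pi * u by rewrite lt0r x0 mulr_ge0// ltW.
have p4 : pi < 4 :> R by have := pihalf_lt2 R; lra.
have x2 : pi * u <= 2 by nra.
set y := pi * u in x0 x1 x2 *.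
have h : 1 - y ^+ 2 / 6 <= sin y / y.
  rewrite ler_pdivlMr//; have := sin_ge_cubic (ltW x1).
  by have -> : (1 - y ^+ 2 / 6) * y = y - y ^+ 3 / 6 by ring.
have y2 : y ^+ 2 <= 16 * u ^+ 2.
  have -> : y ^+ 2 = pi ^+ 2 * u ^+ 2 by rewrite /y exprMn.
  rewrite ler_wpM2r ?sqr_ge0//; nra.
have y4 : y ^+ 2 <= 4 by nra.
nra.
Qed.

(** Away from l = 0, |u + m| >= 1/2 gives sinc^2 <= 4 u^2. Extracting n - 1 such factors leaves the
    sum of sinc^2 over m <> 0, which equals 1 - sinc (pi u)^2 <= 8 u^2 because the full sum is 1. *)
Lemma Qsum_tail n (u : R) : (0 < n)%N -> 0 <= u <= 2^-1 ->
  Qsum (2 * n - 2) u - sinc (pi * u) ^+ (2 * n) <= 8 ^+ n * u ^+ (2 * n).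
Proof.
move=> n0 u02; have /andP[u0 u2] := u02.
have u01 : 0 <= u <= 1 by rewrite u0; lra.
pose c : R := (4 * u ^+ 2) ^+ n.-1.
have c0 : 0 <= c by rewrite exprn_ge0// mulr_ge0// sqr_ge0.
have small (m : int) : 2^-1 <= `|u + m%:~R| ->
  sinc (pi * (u + m%:~R)) ^+ (2 * n) <= c * sinc (pi * (u + m%:~R)) ^+ 2.
  move=> h; have x0 : u + m%:~R != 0 by rewrite -normr_gt0 (lt_le_trans _ h)// invr_gt0.
  rewrite exprM -(prednK n0) exprSr ler_wpM2r ?sqr_ge0//= /c lerXn2r ?nnegrE ?sqr_ge0//.
    by rewrite mulr_ge0// sqr_ge0.
  rewrite sinc_pi_sqr// exprMn ler_pdivrMr; last first.
    by apply: mulr_gt0; rewrite exprn_even_gt0// ?gt_eqF// ?pi_gt0.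
  have h1 : sin (pi * u) ^+ 2 <= (pi * u) ^+ 2.
    by rewrite -[leLHS]real_normK ?num_real// -[leRHS]real_normK ?num_real// lerXn2r ?nnegrE// norm_sin_le.
  have h2 : 1 <= 4 * (u + m%:~R) ^+ 2.
    rewrite -[(u + _) ^+ 2]real_normK ?num_real//; move: h; move: `|u + _| => w h; nra.
  rewrite (le_trans h1)// exprMn.
  have -> : 4 * u ^+ 2 * (pi ^+ 2 * (u + m%:~R) ^+ 2) =
     pi ^+ 2 * u ^+ 2 * (4 * (u + m%:~R) ^+ 2) by ring.
  by rewrite ler_peMr// mulr_ge0// sqr_ge0.
have c1 := Qsum_partial_cvg n0 u01; have := Qsum_partial_cvg (ltn0Sn 0) u01.
rewrite muln1 subnn => c2.
have key : Qsum (2 * n - 2) u - sinc (pi * u) ^+ (2 * n) <=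
   c * (Qsum 0 u - sinc (pi * u) ^+ 2).
  have c1' : ((fun N => T n u N - sinc (pi * u) ^+ (2 * n)) @ \oo -->
      Qsum (2 * n - 2) u - sinc (pi * u) ^+ (2 * n))%classic.
    by apply: cvgB => //; exact: cvg_cst.
  have c2' : ((fun N => c * (T 1 u N - sinc (pi * u) ^+ 2)) @ \oo -->
      c * (Qsum 0 u - sinc (pi * u) ^+ 2))%classic.
    by apply: cvgMr; apply: cvgB => //; exact: cvg_cst.
  apply: (ler_cvg_to c1' c2'); exists 1%N => // N /=.
  case: N => // N _; rewrite /T !big_nat_recl//= /sp /sn addr0.
  rewrite !add3rK.
  have lS l : (l.+1%:Z)%:~R = l%:R + 1 :> R by rewrite natr1.
  have smp l : sinc (pi * (u + l.+1%:R)) ^+ (2 * n) <= c * sinc (pi * (u + l.+1%:R)) ^+ 2.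
    apply: (small l.+1%:Z); have : 0 <= l%:R :> R by [].
    by rewrite lS => ?; rewrite ger0_norm; lra.
  have smn l : sinc (pi * (u - l.+1%:R)) ^+ (2 * n) <= c * sinc (pi * (u - l.+1%:R)) ^+ 2.
    have := small (- l.+1%:Z); rewrite mulrNz; apply.
    have : 0 <= l%:R :> R by [].
    by rewrite lS => ?; rewrite -normrN opprB ger0_norm; lra.
  rewrite [leRHS]mulrDr lerD ?(smn 0%N)// mulr_sumr ler_sum// => l _.
  by rewrite [leRHS]mulrDr lerD ?smn ?smp.
rewrite (le_trans key)// Qsum0E//.
have -> : 8 ^+ n * u ^+ (2 * n) = (8 * u ^+ 2) ^+ n.-1 * (8 * u ^+ 2).
  by rewrite -exprSr prednK// exprMn exprM.
rewrite ler_pM// ?sinc_ge_quadratic//.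
  by rewrite subr_ge0 sinc_sqr_le1.
rewrite lerXn2r ?nnegrE ?mulr_ge0 ?sqr_ge0// ler_wpM2r ?sqr_ge0//; lra.
Qed.

End SincSums.

(** * Roots of Eulerian polynomials *)

Section EulerianRoots.
Variable R : realType.
Local Notation C := R[i].

Lemma sgn_prod_split (x : nat -> R) (n i : nat) :
  (forall j k, (j < k < n)%N -> x j < x k) -> (i < n)%N ->
  0 < (-1) ^+ (n - i).-1 *
      ((\prod_(0 <= j < i) (x i - x j)) * \prod_(i.+1 <= j < n) (x i - x j)).
Proof.
move=> xm ilt; rewrite mulrCA mulr_gt0//.
  rewrite big_nat; elim/big_ind: _ => //; first exact: mulr_gt0.
  by move=> j /andP[_ ji]; rewrite subr_gt0 xm// ji.
have -> : (-1) ^+ (n - i).-1 = \prod_(i.+1 <= j < n) (-1) :> R.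
  by rewrite big_const_nat iter_mulr_1 subnS.
rewrite -big_split /= big_nat; elim/big_ind: _ => //; first exact: mulr_gt0.
by move=> j /andP[ij jn]; rewrite mulN1r opprB subr_gt0 xm// ij.
Qed.

Lemma deriv_prod_at (x : nat -> R) n i : (i < n)%N ->
  (\prod_(0 <= j < n) ('X - (x j)%:P))^`().[x i] =
  (\prod_(0 <= j < i) (x i - x j)) * \prod_(i.+1 <= j < n) (x i - x j).
Proof.
move=> ilt; rewrite (@big_cat_nat _ _ _ i 0%N n)//=; last exact: ltnW.
rewrite (big_ltn ilt).
set p := \prod_(0 <= j < i) _; set r := \prod_(i.+1 <= j < n) _.
rewrite mulrCA derivM derivB derivX derivC subr0 mul1r !hornerE subrr mul0r addr0.
by rewrite /p /r !horner_prod; congr (_ * _); apply: eq_bigr => j _; rewrite !hornerE.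
Qed.

Lemma euler_op_root n (f : {poly R}) a : root f a ->
  (euler_op n f).[a] = a * (1 - a) * f^`().[a].
Proof. by move=> /rootP fa; rewrite /euler_op !hornerE fa mulr0 add0r. Qed.

(* At a root a < 0 of A_n, A_(n+1) equals a (1 - a) A_n'(a), hence alternates in
   sign from one root to the next; the two extra sign changes are at 0 and -oo. *)
Lemma eulerian_real_roots n : exists x : nat -> R,
  [/\ forall i j, (i < j < n)%N -> x i < x j,
      forall i, (i < n)%N -> x i < 0 &
      eulerian R n.+1 = \prod_(0 <= j < n) ('X - (x j)%:P)].
Proof.
elim: n => [|n [x [xm x0 E]]].
  by exists (fun=> 0); split; rewrite ?big_geq ?eulerian1// => i j; rewrite ltn0 andbF.
set B := eulerian R n.+2.
have BS : size B = n.+2 by rewrite size_eulerian.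
have Bm : B \is monic by exact: eulerian_monic.
have B0 : B != 0 by rewrite -size_poly_eq0 BS.
(* Beyond the Cauchy bound the sign is that at -oo; the second entry keeps -M to the left of x_0. *)
pose M := Num.max (cauchy_bound B) (- x 0 + 1).
have BM : 0 < (-1) ^+ n.+1 * B.[- M].
  have nr : {in `]-oo, (- M)], forall y, ~~ root B y}.
    move=> y; rewrite in_itv /= => yM; apply: (le_cauchy_bound B0).
    by rewrite in_itv /= (le_trans yM)// lerN2 le_max lexx.
  have := @sgp_minftyP _ (- M) B nr (- M); rewrite in_itv /= lexx => /(_ isT).
  rewrite /sgp_minfty BS /= (monicP Bm) mulr1 => sB.
  rewrite -sgr_gt0 sgrM sB -sgrM -expr2 sqrr_sign sgr1 ltr01//.
(* The separating points -M < x_0 < ... < x_(n-1) < 0; each of the n + 1 gaps receives one root. *)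
pose y i := if i is i'.+1 then (if (i' < n)%N then x i' else 0) else - M.
have yS i : (i < n)%N -> y i.+1 = x i by rewrite /y => ->.
have yn : y n.+1 = 0 by rewrite /y ltnn.
have ylt i : (i <= n)%N -> y i < y i.+1.
  case: i => [_|i ilt].
    have h : - M < x 0.
      by rewrite ltrNl; apply: (@lt_le_trans _ _ (- x 0 + 1)); [lra|rewrite le_max lexx orbT].
    case: (posnP n) => n0.
      by rewrite /y n0 /= oppr_lt0 lt_max cauchy_bound_gt0.
    by rewrite yS.
  rewrite yS//; have [iSn|] := ltnP i.+1 n; first by rewrite yS// xm// leqnn.
  by move=> h; rewrite /y ltnNge h /= x0.
have sg i : (i <= n.+1)%N -> 0 < (-1) ^+ (n.+1 - i) * B.[y i].
  case: i => [_|i]; first by rewrite subn0.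
  rewrite ltnS leq_eqVlt => /orP[/eqP ->|ilt].
    by rewrite subnn expr0 mul1r yn eulerian0.
  rewrite yS// /B [eulerian R n.+2]eulerianS euler_op_root; last first.
    rewrite rootE E horner_prod (@big_cat_nat _ _ _ i 0%N n)//=; last exact: ltnW.
    by rewrite (big_ltn ilt) hornerXsubC subrr mul0r mulr0.
  rewrite E deriv_prod_at//.
  have := sgn_prod_split xm ilt; set s := _ * (_ * _ : R) => s0.
  have -> : (-1) ^+ (n.+1 - i.+1) * (x i * (1 - x i) *
    ((\prod_(0 <= j < i) (x i - x j)) * \prod_(i.+1 <= j < n) (x i - x j))) =
    - (x i) * (1 - x i) * s.
    have -> : (n.+1 - i.+1 = (n - i).-1.+1)%N by lia.
    by rewrite exprS /s; ring.
  have xi := x0 _ ilt; apply: mulr_gt0 s0; apply: mulr_gt0; lra.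
have ex i : exists w : R, (i <= n)%N -> [/\ y i < w, w < y i.+1 & root B w].
  have [ilt|] := leqP i n; last by exists 0.
  have s1 := sg i (leqW ilt); have s2 := sg i.+1 ilt.
  have [|w] := @poly_ivtoo _ B (y i) (y i.+1) (ltW (ylt i ilt)).
    have := mulr_gt0 s1 s2; have -> : (n.+1 - i = (n.+1 - i.+1).+1)%N by lia.
    rewrite exprS mulN1r mulNr mulNr oppr_gt0.
    rewrite mulrACA -expr2 sqrr_sign mul1r//.
  by rewrite in_itv /= => /andP[w1 w2] rw; exists w.
have [w Hw] := choice ex.
have ymono i j : (i <= j <= n.+1)%N -> y i <= y j.
  move=> /andP[ij jn]; elim: j ij jn => [|j IH]; first by rewrite leqn0 => /eqP ->.
  rewrite leq_eqVlt => /orP[/eqP ->//|ij] jn.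
  by rewrite (le_trans (IH ij (ltnW jn)))// ltW// ylt.
have wm i j : (i < j < n.+1)%N -> w i < w j.
  move=> /andP[ij jn]; have [_ w1 _] := Hw i (leq_trans (ltnW ij) jn).
  have [w2 _ _] := Hw j jn.
  by rewrite (lt_trans w1)// (le_lt_trans _ w2)// ymono// ij ltnW.
exists w; split => // [i ilt|].
  have [_ w1 _] := Hw i ilt; rewrite (lt_le_trans w1)// -yn ymono// leqnn andbT//.
rewrite -[LHS]/B (@all_roots_prod_XsubC _ B [seq w i | i <- index_iota 0 n.+1]).
- by rewrite (monicP Bm) scale1r big_map.
- by rewrite BS size_map size_iota subn0.
- apply/allP => z /mapP[k]; rewrite mem_index_iota => /andP[_ ilt] ->.
  by have [] := Hw k ilt.
- rewrite uniq_rootsE map_inj_in_uniq ?iota_uniq// => i j.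
  rewrite !mem_index_iota /= => ilt jlt wij.
  case: (ltngtP i j) => // ij.
    by have := wm i j; rewrite ij jlt wij ltxx => /(_ isT).
  by have := wm j i; rewrite ij ilt wij ltxx => /(_ isT).
Qed.

Lemma eulerian_inv n (z : C) : z != 0 ->
  (eulerian C n.+1).[z^-1] = z ^- n * (eulerian C n.+1).[z].
Proof.
move=> z0; have sz : (size (eulerian C n.+1) <= n.+1)%N by rewrite size_eulerian.
rewrite !(horner_coef_wide _ sz) mulr_sumr (reindex_inj rev_ord_inj) /=.
apply: eq_bigr => i _; rewrite subSS eulerian_sym ?leq_subr// subKn ?leq_ord//.
rewrite mulrCA; congr (_ * _); rewrite exprVn.
have -> : z ^+ n = z ^+ (n - i) * z ^+ i by rewrite -exprD subnK ?leq_ord.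
have e1 := expf_neq0 (n - i) z0; have e2 := expf_neq0 i z0.
by field; rewrite e1 e2.
Qed.

Lemma eulerian_complex_roots n : exists rs : seq C, [/\ uniq rs, size rs = n,
  (forall z, z \in rs -> exists2 x : R, x < 0 & z = x%:C) &
  eulerian C n.+1 = \prod_(r <- rs) ('X - r%:P)].
Proof.
have [x [xm x0 E]] := eulerian_real_roots n.
exists [seq (x i)%:C | i <- index_iota 0 n]; split.
- rewrite map_inj_in_uniq ?iota_uniq// => i j.
  rewrite !mem_index_iota /= => ilt jlt /complexI xij.
  case: (ltngtP i j) => // ij.
    by have := xm i j; rewrite ij jlt xij ltxx => /(_ isT).
  by have := xm j i; rewrite ij ilt xij ltxx => /(_ isT).
- by rewrite size_map size_iota subn0.
- by move=> z /mapP[k]; rewrite mem_index_iota /= => ilt ->; exists (x k) => //; exact: x0.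
- rewrite big_map -(map_eulerian (real_complex R)) E rmorph_prod.
  by apply: eq_bigr => i _; rewrite rmorphB /= map_polyX map_polyC.
Qed.

Lemma eulerian_root_inv n z : root (eulerian C n.+1) z -> root (eulerian C n.+1) z^-1.
Proof.
have [->|z0] := eqVneq z 0; first by rewrite invr0.
by rewrite !rootE eulerian_inv// => /eqP ->; rewrite mulr0.
Qed.

(* The roots are negative, so the only candidate on the unit circle is -1,
   where the polynomial is a positive multiple of a sum of powers of sinc. *)
Lemma eulerian_unit_root q z : (0 < q)%N -> root (eulerian C (2 * q - 1)) z ->
  normc z != 1.
Proof.
move=> q0 zr; have [rs [_ _ rneg E]] := eulerian_complex_roots (2 * q - 2).
have eq1 : (2 * q - 1 = (2 * q - 2).+1)%N by lia.
have [x x0 zE] : exists2 x : R, x < 0 & z = x%:C.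
  by apply: rneg; move: zr; rewrite eq1 E root_prod_XsubC.
apply/negP; rewrite zE normc_real ltr0_norm// => /eqP xE.
have u2 : 0 <= (2^-1 : R) <= 1 by lra.
have := Qsum_gt0 q0 u2; have := Qsum_eulerian q0 u2.
have -> : zu 2^-1 = z.
  rewrite zE /zu (_ : - (2 * pi * 2^-1) = - pi :> R); last by field.
  by rewrite /cis cosN cospi sinN sinpi oppr0 -xE opprK.
rewrite (rootP zr) mulr0 mul0r => /complexI ->.
by rewrite ltxx.
Qed.

(** Inversion exchanges the roots inside and outside the unit circle and none lies on it, so exactly
    half of the 2q - 2 roots are inside. *)
Lemma inner_roots_count q : (0 < q)%N -> exists s : seq C,
  [/\ uniq s, size s = q.-1 & forall z, z \in s <->
     root (eulerian C (2 * q - 1)) z /\ `|z| < 1].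
Proof.
move=> q0; have eq1 : (2 * q - 1 = (2 * q - 2).+1)%N by lia.
have [rs [urs srs rneg E]] := eulerian_complex_roots (2 * q - 2).
have rsP z : (z \in rs) = root (eulerian C (2 * q - 1)) z.
  by rewrite eq1 E root_prod_XsubC.
have n0 z : z \in rs -> z != 0.
  by move=> /rneg[x x0 ->]; rewrite fmorph_eq0 lt_eqF.
pose ins := [seq z <- rs | normc z < 1]; pose out := [seq z <- rs | ~~ (normc z < 1)].
have invP z : z \in rs -> z^-1 \in rs by rewrite !rsP eq1; exact: eulerian_root_inv.
have inj : injective (@GRing.inv C) by exact: invr_inj.
have inout z : (z \in out) = (z^-1 \in ins).
  rewrite !mem_filter -leNgt.
  have -> : (z^-1 \in rs) = (z \in rs).
    by apply/idP/idP => /invP //; rewrite invrK.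
  have [zr|] := boolP (z \in rs); last by rewrite !andbF.
  rewrite !andbT normcV.
  have z1 : normc z != 1 by apply: (eulerian_unit_root q0); rewrite -rsP.
  have p : 0 < normc z by rewrite normc_gt0 n0.
  by rewrite invf_lt1// lt_neqAle eq_sym z1.
have pe : perm_eq out (map (@GRing.inv C) ins).
  apply: uniq_perm; rewrite ?map_inj_uniq ?filter_uniq// => z.
  by rewrite inout -[in RHS](invrK z) mem_map.
have sz : size ins = q.-1.
  have := perm_size pe; rewrite size_map => so.
  have : (size ins + size out)%N = (2 * q - 2)%N.
    by rewrite -srs -(count_predC (fun z => normc z < 1) rs) /ins /out !size_filter.
  by rewrite so; move: (size ins) => k; move: q0; clear; lia.
exists ins; split => [||z]; rewrite ?filter_uniq// mem_filter rsP normCE.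
have -> : ((normc z)%:C < 1) = (normc z < 1) by rewrite -(rmorph1 (real_complex R)) ltcR.
by split => [/andP[]|[-> ->]].
Qed.

Lemma partial_fractions (rs : seq C) (c : C) (z : C) : uniq rs -> c != 0 ->
  (0 < size rs)%N -> z \notin rs ->
  let P := c *: \prod_(r <- rs) ('X - r%:P) in
  (P.[z])^-1 = \sum_(r <- rs) (P^`().[r])^-1 / (z - r).
Proof.
move=> urs c0 s0 zrs P.
pose Q r : {poly C} := c *: \prod_(s <- rem r rs) ('X - s%:P).
have PQ r : r \in rs -> P = ('X - r%:P) * Q r.
  move=> rrs; rewrite /P /Q (perm_big _ (perm_to_rem rrs)) big_cons /=.
  by rewrite -scalerAr.
have dP r : r \in rs -> P^`().[r] = (Q r).[r].
  move=> rrs; rewrite (PQ r rrs) derivM derivB derivX derivC subr0 mul1r.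
  by rewrite !hornerE subrr mul0r addr0.
have Qr r : r \in rs -> (Q r).[r] != 0.
  move=> rrs; rewrite /Q hornerZ mulf_neq0// -[_ != 0]/(~~ root _ r).
  by rewrite root_prod_XsubC mem_rem_uniq// inE eqxx.
(* Lagrange interpolation of the constant 1 at the roots: L has degree below the number of roots and
   takes the value 1 at each, so L = 1. Dividing by P gives the claim. *)
pose L : {poly C} := \sum_(r <- rs) ((Q r).[r])^-1 *: Q r.
have Lrs t : t \in rs -> L.[t] = 1.
  move=> trs; rewrite horner_sum (bigD1_seq t)//= hornerZ mulVf ?Qr//.
  rewrite big_seq_cond big1 ?addr0// => r /andP[rrs rt].
  have Qt : (Q r).[t] = 0.
    apply/eqP; rewrite /Q hornerZ mulf_eq0 -[X in _ || X]/(root _ t).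
    by rewrite root_prod_XsubC mem_rem_uniq// inE [t == r]eq_sym rt trs orbT.
  by rewrite hornerZ Qt mulr0.
have L1 : L = 1.
  apply/eqP; rewrite -subr_eq0; apply/negPn/negP => L0.
  have ar : all (root (L - 1)) rs.
    by apply/allP => t trs; rewrite rootE !hornerE Lrs// subrr.
  have := max_poly_roots L0 ar urs; rewrite ltnNge => /negP; apply.
  rewrite (leq_trans (size_polyD _ _))// geq_max size_polyN size_poly1 s0 andbT.
  rewrite /L big_seq; apply: (big_ind (fun f : {poly C} => (size f <= size rs)%N)).
  - by rewrite size_poly0.
  - by move=> f g hf hg; rewrite (leq_trans (size_polyD _ _))// geq_max hf hg.
  - move=> r rrs; rewrite (leq_trans (size_scale_leq _ _))// /Q.
    rewrite (leq_trans (size_scale_leq _ _))// size_prod_XsubC size_rem//.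
    by rewrite prednK.
have Pz : P.[z] != 0.
  by rewrite /P hornerZ mulf_neq0// -[_ != 0]/(~~ root _ z) root_prod_XsubC.
apply: (mulfI Pz); rewrite mulfV// mulr_sumr.
have := congr1 (fun f : {poly C} => f.[z]) L1; rewrite hornerC => <-.
rewrite horner_sum big_seq [RHS]big_seq; apply: eq_bigr => r rrs.
have zr : z - r != 0 by rewrite subr_eq0; apply: contraNneq zrs => ->.
have -> : P.[z] = (z - r) * (Q r).[z] by rewrite (PQ r rrs) hornerM hornerXsubC.
rewrite hornerZ dP//; move: (Q r).[z] (Q r).[r] (Qr r rrs) => a b b0.
by field; rewrite zr b0.
Qed.

End EulerianRoots.

(** * Integrals of continuous functions *)

Section RealIntegral.
Variable R : realType.
Local Notation mu := (@lebesgue_measure R).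
Implicit Types f F g : R -> R.

Lemma cont_integrable f a b : continuous f -> mu.-integrable `[a, b]%classic (EFin \o f).
Proof.
move=> cf; apply: continuous_compact_integrable; first exact: segment_compact.
exact: continuous_subspaceT.
Qed.

Lemma FTC_segment f F a b : a <= b -> continuous f ->
  (forall x : R, a <= x <= b -> is_derive x (1 : R) F (f x)) ->
  \int[mu]_(x in `[a, b]%classic) f x = F b - F a.
Proof.
rewrite le_eqVlt => /predU1P[<- _ _|ab cf H].
  by rewrite set_itv1 Rintegral_set1 subrr.
rewrite /Rintegral (@continuous_FTC2 _ f F a b) //.
- exact: continuous_subspaceT.
- have c x : a <= x <= b -> {for x, continuous F}.
    move=> /H[d _]; apply: differentiable_continuous; exact/derivable1_diffP.
  split.
  + by move=> x; rewrite in_itv /= => /andP[ax xb]; case: (H x) => //; rewrite !ltW.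
  + by apply: cvg_at_right_filter; apply: c; rewrite lexx ltW.
  + by apply: cvg_at_left_filter; apply: c; rewrite lexx ltW.
- move=> x; rewrite in_itv /= => /andP[ax xb].
  rewrite derive1E; have [_ ->//] : is_derive x (1 : R) F (f x).
  by apply: H; rewrite !ltW.
Qed.

(** The integral starts at -1 and is considered up to B + 1, so that 0 and B are interior points and
    the derivative exists there on both sides. *)
Lemma primitive_exists f B : 0 <= B -> continuous f ->
  exists F, forall x : R, 0 <= x <= B -> is_derive x (1 : R) F (f x).
Proof.
move=> B0 cf; exists (fun x => \int[mu]_(t in [set` `[(-1), x]%R]) f t) => x /andP[x0 xB].
have xu : x < B + 1 by lra.
have [d dE] := @continuous_FTC1_closed _ f (-1) x (B + 1) xu
   (cont_integrable (-1) (B + 1) cf) (lt_le_trans (ltrN10 R) x0) (cf x).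
by constructor; [exact: d|rewrite derive1E in dE; exact: dE].
Qed.

Lemma is_derive_scale (c x : R) : is_derive x (1 : R) (fun s : R => c * s) c.
Proof.
have := is_deriveZ c (is_derive_id x (1 : R)).
by rewrite /GRing.scale /= mulr1.
Qed.

Lemma continuous_scale (c : R) : continuous (fun s : R => c * s).
Proof. by apply: is_derive_continuous => x; exact: is_derive_scale. Qed.

Lemma continuous_comp_scale f (c : R) : continuous f -> continuous (fun s => f (c * s)).
Proof.
by move=> cf x; apply: (@continuous_comp _ _ _ (fun s => c * s) f); [exact: continuous_scale|exact: cf].
Qed.

Lemma is_derive_onem (x : R) : is_derive x (1 : R) (fun s : R => 1 - s) (-1).
Proof.
have := is_deriveB (is_derive_cst (1 : R) x (1 : R)) (is_derive_id x (1 : R)).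
by rewrite sub0r.
Qed.

Lemma is_derive_comp_onem F (x l : R) : is_derive (1 - x) (1 : R) F l ->
  is_derive x (1 : R) (fun s : R => - F (1 - s)) l.
Proof.
move=> d; have := is_deriveN (@is_derive1_comp _ F (fun s : R => 1 - s) x l (-1) d (is_derive_onem x)).
by move/is_derive_eq; apply; rewrite mulrN1 opprK.
Qed.

Lemma continuous_comp_onem f : continuous f -> continuous (fun s : R => f (1 - s)).
Proof.
move=> cf x; apply: (@continuous_comp _ _ _ (fun s : R => 1 - s) f); last exact: cf.
by apply: is_derive_continuous => y; exact: is_derive_onem.
Qed.

Lemma Rint_scale f B c : 0 <= B -> 0 < c -> continuous f ->
  \int[mu]_(x in `[0, B]%classic) f x =
  c * \int[mu]_(x in `[0, B / c]%classic) f (c * x).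
Proof.
move=> B0 c0 cf; have [F HF] := primitive_exists B0 cf.
rewrite (FTC_segment B0 cf HF).
have Bc0 : 0 <= B / c by rewrite divr_ge0// ltW.
have H (x : R) : 0 <= x <= B / c -> is_derive x (1 : R) (fun s => c^-1 * F (c * s)) (f (c * x)).
  move=> /andP[x0 xB].
  have d := HF (c * x); rewrite mulr_ge0 ?(ltW c0)//= in d.
  rewrite ler_pdivlMr// mulrC in xB.
  have := is_deriveZ c^-1 (is_derive1_comp (d xB) (is_derive_scale c x)).
  by move/is_derive_eq; apply; rewrite /GRing.scale /= mulrCA mulVf ?mulr1// gt_eqF.
rewrite (FTC_segment Bc0 (continuous_comp_scale (c := c) cf) H).
have cn : c != 0 by rewrite gt_eqF.
by rewrite mulr0 -mulrBr mulVKf// mulrCA mulfV// mulr1.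
Qed.

Lemma Rint_onem f : continuous f ->
  \int[mu]_(x in `[0, 1]%classic) f (1 - x) = \int[mu]_(x in `[0, 1]%classic) f x.
Proof.
move=> cf; have [F HF] := primitive_exists ler01 cf.
rewrite (FTC_segment ler01 cf HF).
transitivity (- F (1 - 1) - - F (1 - 0)); last by rewrite subrr subr0; ring.
apply: (FTC_segment (F := fun x : R => - F (1 - x)) ler01 (continuous_comp_onem cf)).
move=> x /andP[x0 x1].
by apply: is_derive_comp_onem; apply: HF; lra.
Qed.

Lemma Rint_half f : continuous f ->
  \int[mu]_(x in `[0, 1]%classic) f x =
  \int[mu]_(x in `[0, 2^-1]%classic) f x + \int[mu]_(x in `[0, 2^-1]%classic) f (1 - x).
Proof.
move=> cf; have [F HF] := primitive_exists ler01 cf.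
have h0 : 0 <= 2^-1 :> R by rewrite invr_ge0.
rewrite (FTC_segment ler01 cf HF).
have -> : \int[mu]_(x in `[0, 2^-1]%classic) f x = F 2^-1 - F 0.
  by apply: (FTC_segment h0 cf) => x /andP[x0 x1]; apply: HF; lra.
have -> : \int[mu]_(x in `[0, 2^-1]%classic) f (1 - x) = - F (1 - 2^-1) - - F (1 - 0).
  apply: (FTC_segment (F := fun x : R => - F (1 - x)) h0 (continuous_comp_onem cf)).
  move=> x /andP[x0 x1].
  by apply: is_derive_comp_onem; apply: HF; lra.
have -> : 1 - 2^-1 = 2^-1 :> R by lra.
by rewrite subr0; ring.
Qed.

Lemma Rint_majorant (f g : R -> R) a b : continuous f -> continuous g ->
  (forall x, a <= x <= b -> `|f x| <= g x) ->
  `|\int[mu]_(x in `[a, b]%classic) f x| <= \int[mu]_(x in `[a, b]%classic) g x.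
Proof.
move=> cf cg fg; have If := cont_integrable a b cf.
rewrite (le_trans (le_normr_Rintegral _ If))//; apply: le_Rintegral => //.
- exact: (integrable_norm If).
- exact: cont_integrable.
Qed.

Lemma Rint_bound f a b M : a <= b -> continuous f ->
  (forall x, a <= x <= b -> `|f x| <= M) ->
  `|\int[mu]_(x in `[a, b]%classic) f x| <= M * (b - a).
Proof.
move=> ab cf fM; rewrite (le_trans (Rint_majorant (g := fun=> M) cf _ fM))//.
  by move=> x; exact: cvg_cst.
rewrite Rintegral_cst//= lebesgue_measure_itv /=; case: ifPn => //=.
rewrite lte_fin -leNgt => ba; have -> : a = b by apply/eqP; rewrite eq_le ab ba.
by rewrite subrr.
Qed.

End RealIntegral.

Section ComplexIntegral.
Variable R : realType.
Local Notation C := R[i].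
Local Notation mu := (@lebesgue_measure R).
Implicit Types f g : R -> C.

Definition ccont f := continuous (fun x => complex.Re (f x)) /\
  continuous (fun x => complex.Im (f x)).

Lemma ccont_ext f g : f =1 g -> ccont f -> ccont g.
Proof. by move=> /funext <-. Qed.

Lemma ccont_cst (k : C) : ccont (fun=> k).
Proof. by split => x; exact: cvg_cst. Qed.

Lemma ccont_real (f : R -> R) : continuous f -> ccont (fun x => (f x)%:C).
Proof. by move=> cf; split => //= x; exact: cvg_cst. Qed.

Lemma ccontD f g : ccont f -> ccont g -> ccont (fun x => f x + g x).
Proof.
move=> [f1 f2] [g1 g2]; split => x.
  by under eq_fun do rewrite cReD; exact: continuousD (f1 x) (g1 x).
by under eq_fun do rewrite cImD; exact: continuousD (f2 x) (g2 x).
Qed.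

Lemma ccontM f g : ccont f -> ccont g -> ccont (fun x => f x * g x).
Proof.
move=> [f1 f2] [g1 g2]; split => x.
  under eq_fun do rewrite cReM.
  exact: continuousB (continuousM (f1 x) (g1 x)) (continuousM (f2 x) (g2 x)).
under eq_fun do rewrite cImM.
exact: continuousD (continuousM (f1 x) (g2 x)) (continuousM (f2 x) (g1 x)).
Qed.

Lemma ccontJ f : ccont f -> ccont (fun x => (f x)^*).
Proof.
move=> [f1 f2]; have reJ (z : C) : complex.Re z^* = complex.Re z by case: z.
have imJ (z : C) : complex.Im z^* = - complex.Im z by case: z.
split => x; first by under eq_fun do rewrite reJ; exact: f1.
by under eq_fun do rewrite imJ; exact: continuousN (f2 x).
Qed.

Lemma ccontX f n : ccont f -> ccont (fun x => f x ^+ n).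
Proof.
move=> cf; elim: n => [|n IH].
  by apply: (ccont_ext _ (ccont_cst 1)) => x; rewrite expr0.
by apply: (ccont_ext _ (ccontM cf IH)) => x; rewrite exprS.
Qed.

Lemma ccont_sum (I : Type) (r : seq I) (F : I -> R -> C) :
  (forall i, ccont (F i)) -> ccont (fun x => \sum_(i <- r) F i x).
Proof.
move=> H; elim: r => [|i r IH].
  by apply: (ccont_ext _ (ccont_cst 0)) => x; rewrite big_nil.
by apply: (ccont_ext _ (ccontD (H i) IH)) => x; rewrite big_cons.
Qed.

Lemma ccont_normc_sqr f : ccont f -> continuous (fun x => complex.Re (f x * (f x)^*)).
Proof. by move=> cf; have [] := ccontM cf (ccontJ cf). Qed.

Lemma invc_conj (z : C) : z^-1 = ((complex.Re (z * z^*))^-1)%:C * z^*.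
Proof.
case: z => a b; have E : a * a - b * - b = a ^+ 2 + b ^+ 2 by ring.
by apply: complex_eqP; rewrite ?cReMl ?cImMl /= E; ring.
Qed.

Lemma ccontV f : ccont f -> (forall x, f x != 0) -> ccont (fun x => (f x)^-1).
Proof.
move=> cf f0.
apply: (ccont_ext (fun x => esym (invc_conj (f x)))).
apply: ccontM; last exact: ccontJ.
apply: ccont_real => x; apply: continuousV; last exact: ccont_normc_sqr cf x.
have : normc (f x) != 0 by rewrite normc_eq0.
apply: contra_neq => H; apply/eqP; rewrite -sqrf_eq0; apply/eqP; rewrite -H.
case: (f x) => a b; rewrite /normc /= sqr_sqrtr ?addr_ge0 ?sqr_ge0//; ring.
Qed.

Lemma ccont_cis (c : R) : ccont (fun x => cis (c * x)).
Proof.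
split => x /=.
  apply: (@continuous_comp _ _ _ (fun s : R => c * s) cos); first exact: continuous_scale.
  exact: continuous_cos.
apply: (@continuous_comp _ _ _ (fun s : R => c * s) sin); first exact: continuous_scale.
exact: continuous_sin.
Qed.

Lemma ccont_poly (P : {poly C}) f : ccont f -> ccont (fun x => P.[f x]).
Proof.
move=> cf; apply: (@ccont_ext (fun x => \sum_(i < size P) P`_i * f x ^+ i)) => [x|].
  by rewrite horner_coef.
by apply: ccont_sum => i; apply: ccontM; [exact: ccont_cst|exact: ccontX].
Qed.

Lemma ccont_scale f c : ccont f -> ccont (fun x => f (c * x)).
Proof.
move=> [f1 f2]; split.
  exact: (continuous_comp_scale (f := fun x => complex.Re (f x))).
exact: (continuous_comp_scale (f := fun x => complex.Im (f x))).
Qed.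

Lemma ccont_onem f : ccont f -> ccont (fun x => f (1 - x)).
Proof.
move=> [f1 f2]; split.
  exact: (continuous_comp_onem (f := fun x => complex.Re (f x))).
exact: (continuous_comp_onem (f := fun x => complex.Im (f x))).
Qed.

Lemma eq_cintegral (D : set R) f g : {in D, f =1 g} -> cintegral D f = cintegral D g.
Proof.
move=> fg; rewrite /cintegral; congr (_ +i* _); apply: eq_Rintegral => x xD; by rewrite fg.
Qed.

Lemma eq_cint a b f g : (forall x, a <= x <= b -> f x = g x) ->
  cintegral `[a, b]%classic f = cintegral `[a, b]%classic g.
Proof. by move=> fg; apply: eq_cintegral => x; rewrite inE /= in_itv /= => /fg. Qed.

Lemma cintD a b f g : ccont f -> ccont g ->
  cintegral `[a, b]%classic (fun x => f x + g x) =
  cintegral `[a, b]%classic f + cintegral `[a, b]%classic g.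
Proof.
move=> [f1 f2] [g1 g2]; rewrite /cintegral; apply: complex_eqP => /=.
  under eq_Rintegral do rewrite cReD.
  by rewrite RintegralD//; exact: cont_integrable.
under eq_Rintegral do rewrite cImD.
by rewrite RintegralD//; exact: cont_integrable.
Qed.

Lemma cintZ a b k f : ccont f ->
  cintegral `[a, b]%classic (fun x => k * f x) = k * cintegral `[a, b]%classic f.
Proof.
move=> [f1 f2]; have I1 := cont_integrable a b f1; have I2 := cont_integrable a b f2.
have cz (c : R) (g : R -> R) : continuous g -> continuous (fun x => c * g x).
  by move=> cg x; apply: continuousM; [exact: cvg_cst|exact: cg].
rewrite /cintegral; apply: complex_eqP; rewrite ?cReM ?cImM /=.
  under eq_Rintegral do rewrite cReM.
  by rewrite RintegralB ?RintegralZl//; apply: cont_integrable; exact: cz.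
under eq_Rintegral do rewrite cImM.
by rewrite RintegralD ?RintegralZl//; apply: cont_integrable; exact: cz.
Qed.

Lemma cint0 (D : set R) : cintegral D (fun=> 0) = 0.
Proof.
have z : \int[mu]_(x in D) (0 : R) = 0 by rewrite /Rintegral integral0.
by rewrite /cintegral /= z.
Qed.

Lemma cint_sum a b (I : Type) (r : seq I) (F : I -> R -> C) :
  (forall i, ccont (F i)) ->
  cintegral `[a, b]%classic (fun x => \sum_(i <- r) F i x) =
  \sum_(i <- r) cintegral `[a, b]%classic (F i).
Proof.
move=> H; elim: r => [|i r IH].
  rewrite big_nil; transitivity (cintegral `[a, b]%classic (fun=> 0 : C)); last exact: cint0.
  by apply: eq_cint => x _; rewrite big_nil.
rewrite big_cons -IH -cintD//; last exact: ccont_sum.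
by apply: eq_cint => x _; rewrite big_cons.
Qed.

Lemma cint_scale f B c : 0 <= B -> 0 < c -> ccont f ->
  cintegral `[0, B]%classic f =
  c%:C * cintegral `[0, B / c]%classic (fun x => f (c * x)).
Proof.
move=> B0 c0 [f1 f2]; rewrite /cintegral; apply: complex_eqP; rewrite ?cReMl ?cImMl /=.
  exact: (Rint_scale (f := fun x => complex.Re (f x))).
exact: (Rint_scale (f := fun x => complex.Im (f x))).
Qed.

Lemma cint_onem f : ccont f ->
  cintegral `[0, 1]%classic (fun x => f (1 - x)) = cintegral `[0, 1]%classic f.
Proof.
move=> [f1 f2]; rewrite /cintegral; apply: complex_eqP => /=.
  exact: (Rint_onem (f := fun x => complex.Re (f x))).
exact: (Rint_onem (f := fun x => complex.Im (f x))).
Qed.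

(** The two halves of [0, 1] contribute conjugate values. This is the origin of the real part and of
    the factor 2 in [K1] and [K2]. *)
Lemma cint_hermitian f : ccont f -> (forall x, f (1 - x) = (f x)^*) ->
  cintegral `[0, 1]%classic f =
  (complex.Re (cintegral `[0, 2^-1]%classic (fun x => 2 * f x)))%:C.
Proof.
move=> cf fJ; rewrite cintZ//; have [f1 f2] := cf.
rewrite /cintegral; apply: complex_eqP; rewrite ?cReM /=.
  rewrite (Rint_half (f := fun x => complex.Re (f x)))//.
  have -> : \int[mu]_(x in `[0, 2^-1]%classic) complex.Re (f (1 - x)) =
    \int[mu]_(x in `[0, 2^-1]%classic) complex.Re (f x).
    by apply: eq_Rintegral => x _; rewrite fJ; case: (f x).
  by ring.
rewrite (Rint_half (f := fun x => complex.Im (f x)))//.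
have -> : \int[mu]_(x in `[0, 2^-1]%classic) complex.Im (f (1 - x)) =
    \int[mu]_(x in `[0, 2^-1]%classic) (-1 * complex.Im (f x)).
  by apply: eq_Rintegral => x _; rewrite fJ; case: (f x) => a b /=; ring.
by rewrite RintegralZl//; [ring|exact: cont_integrable].
Qed.

Lemma Re_cint_bound f a b M : a <= b -> ccont f ->
  (forall x, a <= x <= b -> normc (f x) <= M) ->
  `|complex.Re (cintegral `[a, b]%classic f)| <= M * (b - a).
Proof.
move=> ab [f1 _] fM; rewrite /cintegral /=.
apply: Rint_bound => // x /fM; apply: le_trans; exact: Re_le_normc.
Qed.

Lemma normc_cint_majorant (f : R -> C) (g : R -> R) a b : ccont f -> continuous g ->
  (forall x, a <= x <= b -> normc (f x) <= g x) ->
  normc (cintegral `[a, b]%classic f) <= 2 * \int[mu]_(x in `[a, b]%classic) g x.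
Proof.
move=> [f1 f2] cg fg; rewrite (le_trans (normc_le_ReIm _))// [2 * _]mulr_natl mulr2n.
rewrite lerD// /cintegral /=; apply: Rint_majorant => // x /fg; apply: le_trans.
  exact: Re_le_normc.
exact: Im_le_normc.
Qed.

Lemma normc_cint_bound f a b M : a <= b -> ccont f ->
  (forall x, a <= x <= b -> normc (f x) <= M) ->
  normc (cintegral `[a, b]%classic f) <= 2 * (M * (b - a)).
Proof.
move=> ab [f1 f2] fM; rewrite (le_trans (normc_le_ReIm _))// [2 * _]mulr_natl mulr2n.
rewrite lerD// /cintegral /=; apply: Rint_bound => // x /fM; apply: le_trans.
  exact: Re_le_normc.
exact: Im_le_normc.
Qed.

End ComplexIntegral.

(** * Integrals over the unit circle *)

Section CircleIntegrals.
Variable R : realType.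
Local Notation C := R[i].
Local Notation mu := (@lebesgue_measure R).

Lemma zuN (u : R) : zu (- u) = (zu u)^*.
Proof. by rewrite /zu mulrN opprK -cisN opprK. Qed.

Lemma zuJ (u : R) : (zu u)^* = (zu u)^-1.
Proof. by rewrite /zu cisV -cisN. Qed.

Lemma zu_shift (u : R) (m : int) : zu (u + m%:~R) = zu u.
Proof. exact: cis_shift. Qed.

Lemma zu_onem (u : R) : zu (1 - u) = (zu u)^*.
Proof. by rewrite addrC (zu_shift (- u) 1) zuN. Qed.

Lemma zu_fract (u : R) : zu u = zu (fract u).
Proof. by rewrite -(zu_shift (fract u) (Num.floor u)) /fract subrK. Qed.

Lemma zu_expz (u : R) (m : int) : zu u ^ m = cis (- (2 * pi * m%:~R) * u).
Proof. by rewrite /zu -cisMz; congr cis; ring. Qed.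

Lemma ccont_zu_expz (m : int) : ccont (fun u : R => zu u ^ m).
Proof.
apply: (ccont_ext (fun u => esym (zu_expz u m))); exact: ccont_cis.
Qed.

Lemma ccont_zu : ccont (@zu R).
Proof. by apply: (ccont_ext _ (ccont_zu_expz 1)) => u; rewrite expr1z. Qed.

Lemma cint_zu_expz (m : int) :
  cintegral `[0, 1]%classic (fun u : R => zu u ^ m) = (m == 0)%:R.
Proof.
have [->|m0] := eqVneq m 0.
  rewrite /cintegral; apply: complex_eqP => /=.
    by rewrite Rintegral_cst//= lebesgue_measure_itv /= lte_fin ltr01 /= subr0 mulr1.
  by rewrite Rintegral_cst//= mul0r.
set c := - (2 * pi * m%:~R) : R.
have c0 : c != 0 by rewrite oppr_eq0 !mulf_neq0// ?intr_eq0// gt_eqF// pi_gt0.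
have cis1 : cis c = 1 :> C by have := zu_expz 1 m; rewrite zu1 exp1rz mulr1 => ->.
have [cos1 sin1] : cos c = 1 /\ sin c = 0.
  by have := congr1 (@complex.Re R) cis1; have := congr1 (@complex.Im R) cis1.
have ccos : continuous (fun u : R => cos (c * u)).
  by apply: continuous_comp_scale; exact: continuous_cos.
have csin : continuous (fun u : R => sin (c * u)).
  by apply: continuous_comp_scale; exact: continuous_sin.
transitivity (cintegral `[0, 1]%classic (fun u : R => cis (c * u))).
  by apply: eq_cint => u _; rewrite zu_expz.
rewrite /cintegral; apply: complex_eqP => /=.
  transitivity (c^-1 * sin (c * 1) - c^-1 * sin (c * 0)).
    apply: (FTC_segment (F := fun u : R => c^-1 * sin (c * u)) ler01 ccos) => u _.
    have := is_deriveZ c^-1 (is_derive1_comp (is_derive_sin (c * u)) (is_derive_scale c u)).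
    by move/is_derive_eq; apply; rewrite /GRing.scale /= mulrCA mulVf ?mulr1.
  by rewrite mulr1 sin1 !mulr0 sin0 mulr0 subrr.
transitivity (- c^-1 * cos (c * 1) - - c^-1 * cos (c * 0)).
  apply: (FTC_segment (F := fun u : R => - c^-1 * cos (c * u)) ler01 csin) => u _.
  have := is_deriveZ (- c^-1) (is_derive1_comp (is_derive_cos (c * u)) (is_derive_scale c u)).
  by move/is_derive_eq; apply; rewrite /GRing.scale /= mulNr [- sin _ * _]mulNr mulrN opprK mulrCA mulVf ?mulr1.
by rewrite mulr1 cos1 mulr0 cos0 subrr.
Qed.

Section Pole.
Variables (r : C) (r1 : normc r != 1).

Lemma zu_sub_neq0 (u : R) : zu u - r != 0.
Proof. by rewrite subr_eq0; apply: contraNneq r1 => <-; rewrite normc_zu. Qed.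

Let ccont_pole (m : int) : ccont (fun u : R => zu u ^ m / (zu u - r)).
Proof.
apply: ccontM; first exact: ccont_zu_expz.
apply: ccontV; last exact: zu_sub_neq0.
apply: ccontD; [exact: ccont_zu|exact: ccont_cst].
Qed.

Definition pole_int (m : int) : C :=
  cintegral `[0, 1]%classic (fun u : R => zu u ^ m / (zu u - r)).

Lemma pole_intS m : pole_int (m + 1) = (m == 0)%:R + r * pole_int m.
Proof.
rewrite /pole_int -cint_zu_expz -cintZ//.
rewrite -cintD; [|exact: ccont_zu_expz|].
  apply: eq_cint => u _; rewrite expfzDr ?zu_neq0// expr1z.
  by field; exact: zu_sub_neq0.
by apply: ccontM; [exact: ccont_cst|exact: ccont_pole].
Qed.

Lemma pole_int_bounded : exists B, forall m, normc (pole_int m) <= B.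
Proof.
pose d := `|1 - normc r|; have d0 : 0 < d by rewrite normr_gt0 subr_eq0 eq_sym.
exists (2 * (d^-1 * (1 - 0))) => m; apply: normc_cint_bound => //.
move=> u _; rewrite normcM normcV.
have -> : normc (zu u ^ m) = 1 by rewrite zu_expz normc_cis.
rewrite mul1r lef_pV2 ?posrE//; last by rewrite normc_gt0 zu_sub_neq0.
rewrite /d -(normc_zu u) ler_norml; apply/andP; split.
  rewrite lerNl opprB lerBlDl -normcB.
  by rewrite (le_trans _ (ler_normcD _ _))// addrC subrK.
by rewrite lerBlDr (le_trans _ (ler_normcD _ _))// subrK.
Qed.

(** Plays the part of the residue theorem: a bounded family tied to its first member by powers of a
    number of modulus < 1 forces that member to vanish. *)
Let geom_bound (f : nat -> C) (a : C) : normc a < 1 ->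
  (exists B, forall k, normc (f k) <= B) -> (forall k, f 0%N = a ^+ k * f k) -> f 0%N = 0.
Proof.
move=> a1 [B HB] H; apply/eqP; rewrite -normc_eq0 eq_le normc_ge0 andbT.
have cv : ((fun k => B * normc a ^+ k) @ \oo --> (0 : R))%classic.
  have := @cvg_geometric R B (normc a); rewrite /geometric /=; apply.
  by rewrite ger0_norm ?normc_ge0.
apply: (ler_cvg_to (cvg_cst _) cv); exists 0%N => // k _.
by rewrite (H k) normcM normcX mulrC ler_wpM2r ?exprn_ge0 ?normc_ge0.
Qed.

Lemma pole_int_nonpos n : normc r < 1 -> pole_int (- n%:Z) = 0.
Proof.
move=> rlt; have [B HB] := pole_int_bounded.
have := @geom_bound (fun k => pole_int (- (n + k)%N%:Z)) r rlt; rewrite /= addn0; apply.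
  by exists B.
elim=> [|k IH]; first by rewrite addn0 expr0 mul1r.
rewrite IH exprSr -mulrA; congr (_ * _).
have -> : - (n + k)%N%:Z = - (n + k.+1)%N%:Z + 1 by lia.
by rewrite pole_intS (_ : (_ == 0) = false) ?add0r//; lia.
Qed.

(** For |r| < 1 the vanishing at exponent 0 gives the value 1 at exponent 1, from which the
    recurrence climbs. For |r| > 1 the recurrence is read backwards from large exponents, and the
    integral vanishes. *)
Lemma pole_int_pos n : pole_int n.+1 = if normc r < 1 then r ^+ n else 0.
Proof.
have shift k m : pole_int (m.+1 + k)%N = r ^+ k * pole_int m.+1.
  elim: k => [|k IH]; first by rewrite addn0 expr0 mul1r.
  rewrite addnS -[_.+1]addn1 PoszD pole_intS IH exprS mulrA.
  by rewrite (_ : (_ == 0) = false) ?add0r.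
case: ifPn => [rlt|]; last first.
  rewrite -leNgt le_eqVlt eq_sym (negbTE r1) /= => rgt.
  have r0 : r != 0 by rewrite -normc_gt0 (lt_trans ltr01).
  have [B HB] := pole_int_bounded.
  have := @geom_bound (fun k => pole_int (n.+1 + k)%N) r^-1.
  rewrite /= addn0; apply; first by rewrite normcV invf_lt1// (lt_trans ltr01).
    by exists B.
  by move=> k; rewrite shift mulrA -exprMn mulVf// expr1n mul1r.
have one : pole_int 1 = 1.
  have := pole_int_nonpos 0 rlt; rewrite oppr0 => z.
  by have := pole_intS 0; rewrite add0r z mulr0 addr0.
by rewrite -[n.+1]add1n shift one mulr1.
Qed.

End Pole.
End CircleIntegrals.

(** * The kernel as a circle integral *)

Section SplineProducts.
Variable R : realType.
Local Notation C := R[i].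

Lemma continuous_mul (f g : R -> R) : continuous f -> continuous g ->
  continuous (fun x => f x * g x).
Proof. by move=> cf cg x; exact: continuousM (cf x) (cg x). Qed.

Lemma continuous_add (f g : R -> R) : continuous f -> continuous g ->
  continuous (fun x => f x + g x).
Proof. by move=> cf cg x; exact: continuousD (cf x) (cg x). Qed.

Lemma continuous_const (c : R) : continuous (fun _ : R => c).
Proof. by move=> x; exact: cvg_cst. Qed.

Lemma continuous_inv (f : R -> R) : continuous f -> (forall x, f x != 0) ->
  continuous (fun x => (f x)^-1).
Proof. by move=> cf f0 x; exact: continuousV (f0 x) (cf x). Qed.

Lemma continuous_expn (f : R -> R) n : continuous f -> continuous (fun x => f x ^+ n).
Proof. by move=> cf x; exact: continuous_comp (cf x) (@exprn_continuous _ _ _). Qed.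

Lemma conjCE (z : C) : Num.conj z = conjc z. Proof. by []. Qed.

Lemma conjM (z w : C) : conjc (z * w) = conjc z * conjc w.
Proof. exact: (rmorphM (@conjc R)). Qed.

Lemma conjK (z : C) : conjc (conjc z) = z.
Proof. by case: z => a b /=; rewrite opprK. Qed.

Lemma conj_div_real (z : C) (x : R) : conjc (z / x%:C) = conjc z / x%:C.
Proof.
have E : x%:C^-1 = (x^-1)%:C :> C by exact: (esym (fmorphV (real_complex R) x)).
by rewrite E; case: z => a b; apply: complex_eqP => /=; ring.
Qed.

Lemma eulerian_conj n (z : C) : (eulerian C n).[(z^*)%C] = ((eulerian C n).[z])^*.
Proof. by rewrite -[in LHS](map_eulerian (@conjc R)) horner_map. Qed.

Lemma spline_poly_conj p a (z : C) : (spline_poly p a).[(z^*)%C] = ((spline_poly p a).[z])^*.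
Proof.
rewrite /spline_poly !horner_sum rmorph_sum /=; apply: eq_bigr => j _.
rewrite !hornerZ !hornerM !horner_exp !hornerD !hornerN !hornerX !hornerC eulerian_conj.
rewrite !rmorphM !rmorphXn /= rmorphB rmorph1 rmorph_nat fmorphV rmorph_nat.
by rewrite oppr0.
Qed.

Lemma Phi_conj p (t : R) (z : C) : z != 0 -> Phi p t z^* = (Phi p t z)^*.
Proof.
move=> z0; rewrite !PhiE ?conjc_eq0// spline_poly_conj rmorphM /=; congr (_ * _).
by rewrite fmorphXz.
Qed.

(* Agrees with [Qsum (2 * m - 2)] on [0, 1], and is visibly continuous. *)
Definition Qc m (u : R) : R := complex.Re
  (zu u ^ (1 - m%:Z) * (eulerian C (2 * m - 1)).[zu u] / (2 * m - 1)`!%:R).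

Section Fixed.
Variables (m : nat) (m0 : (0 < m)%N).

Lemma fract01 (u : R) : 0 <= fract u <= 1.
Proof. by rewrite fract_ge0 ltW// fract_lt1. Qed.

Lemma Qc_complex (u : R) : (Qc m u)%:C =
  zu u ^ (1 - m%:Z) * (eulerian C (2 * m - 1)).[zu u] / (2 * m - 1)`!%:R.
Proof. by rewrite /Qc zu_fract -(Qsum_eulerian m0 (fract01 u)). Qed.

Lemma QcE (u : R) : 0 <= u <= 1 -> Qc m u = Qsum (2 * m - 2) u.
Proof. by move=> u01; rewrite /Qc -(Qsum_eulerian m0 u01). Qed.

Lemma Qc_fract (u : R) : Qc m u = Qsum (2 * m - 2) (fract u).
Proof. by rewrite -(QcE (fract01 u)) /Qc zu_fract. Qed.

Lemma Qc_gt0 (u : R) : 0 < Qc m u.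
Proof. by rewrite Qc_fract Qsum_gt0// fract01. Qed.

Lemma Qc_lower (u : R) : (3 ^+ (2 * m))^-1 <= Qc m u.
Proof. by rewrite Qc_fract Qsum_lower// fract01. Qed.

Lemma Qc_le1 (u : R) : Qc m u <= 1.
Proof. by rewrite Qc_fract Qsum_le1// fract01. Qed.

Lemma Qc_onem (u : R) : Qc m (1 - u) = Qc m u.
Proof.
apply: complexI; rewrite -[RHS]conjc_real !Qc_complex zu_onem eulerian_conj.
by rewrite !rmorphM /= fmorphXz fmorphV rmorph_nat.
Qed.

Lemma ccont_Qc : ccont (fun u => (Qc m u)%:C).
Proof.
apply: (ccont_ext (fun u => esym (Qc_complex u))).
apply: ccontM; last exact: ccont_cst.
by apply: ccontM; [exact: ccont_zu_expz|apply: ccont_poly; exact: ccont_zu].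
Qed.

Lemma continuous_Qc : continuous (Qc m).
Proof. by have [] := ccont_Qc. Qed.

End Fixed.

Section Kernel.
Variables (q : nat) (q0 : (0 < q)%N).
Local Notation p := (deg q).

Let q20 : (0 < 2 * q)%N. Proof. by rewrite muln_gt0. Qed.

Lemma ccont_Phi (x : R) : ccont (fun u => Phi p (x + q%:R) (zu u)).
Proof.
apply: (ccont_ext (fun u => esym (Phi_shiftE p x q (zu_neq0 u)))).
by apply: ccontM; [exact: ccont_zu_expz|apply: ccont_poly; exact: ccont_zu].
Qed.

Lemma normc_Phi_le1 (x u : R) : normc (Phi p (x + q%:R) (zu u)) <= 1.
Proof.
rewrite zu_fract (le_trans (Phi_le_Qsum q0 (fract01 u) x))//.
exact: Qsum_le1 (fract01 u).
Qed.

(** The product phi(K u, x/K) times the conjugate of phi(K u, t/K), with K scaled away; the two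
    square roots in the denominators combine into Q_(2p). *)
Definition phi_prod (x t u : R) : C :=
  Phi p (x + q%:R) (zu u) * (Phi p (t + q%:R) (zu u))^* / (Qc (2 * q) u)%:C.

Lemma Qc_neq0 m (u : R) : (0 < m)%N -> (Qc m u)%:C != 0 :> C.
Proof. by move=> m0; rewrite fmorph_eq0 gt_eqF// Qc_gt0. Qed.

Lemma ccont_phi_prod x t : ccont (phi_prod x t).
Proof.
apply: ccontM.
  by apply: ccontM; [exact: ccont_Phi|apply: ccontJ; exact: ccont_Phi].
by apply: ccontV; [exact: ccont_Qc|move=> u; exact: Qc_neq0].
Qed.

Lemma phi_prod_onem x t u : phi_prod x t (1 - u) = (phi_prod x t u)^*.
Proof.
rewrite /phi_prod zu_onem !Phi_conj ?zu_neq0// Qc_onem// !conjCE conj_div_real conjM.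
by rewrite conjK.
Qed.

Lemma normc_phi_prod x t u : normc (phi_prod x t u) <= 3 ^+ (4 * q).
Proof.
rewrite /phi_prod !normcM normcV normcJ normc_real (ger0_norm (ltW (Qc_gt0 q20 u))).
rewrite -[leRHS]mul1r ler_pM ?mulr_ge0 ?normc_ge0 ?invr_ge0 ?(ltW (Qc_gt0 _ _))//.
  by rewrite mulr_ile1 ?normc_ge0 ?normc_Phi_le1.
rewrite -[leRHS]invrK lef_pV2 ?posrE ?invr_gt0 ?exprn_gt0 ?Qc_gt0//.
by have := Qc_lower q20 u; rewrite mulnA.
Qed.

(* [lambda * penal q K u = k ^+ (2 * q) * pen (u / K)], see [lambda_penal]. *)
Definition pen (u : R) : R :=
  (2 / pi) ^+ (2 * q) * sin (pi * u) ^+ (2 * q) * (Qc q u / Qc (2 * q) u).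

Lemma pen_ge0 u : 0 <= pen u.
Proof.
by rewrite /pen !mulr_ge0 ?invr_ge0 ?(ltW (Qc_gt0 _ _))// exprM exprn_ge0// sqr_ge0.
Qed.

Lemma pen_le u : pen u <= 3 ^+ (4 * q).
Proof.
have le1 (a : R) : -1 <= a <= 1 -> a ^+ (2 * q) <= 1.
  by move=> a1; rewrite exprM exprn_ile1 ?sqr_ge0// -real_normK ?num_real// exprn_ile1 // ler_norml.
have p2 : 2 / pi <= 1 :> R by rewrite ler_pdivrMr ?pi_gt0// mul1r; exact: pi_ge2.
have p0 : 0 <= 2 / pi :> R by rewrite divr_ge0// pi_ge0.
have e0 (a : R) : 0 <= a ^+ (2 * q) by rewrite exprM exprn_ge0// sqr_ge0.
have a0 : 0 <= Qc q u / Qc (2 * q) u by rewrite divr_ge0// ltW// Qc_gt0.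
have a1 : Qc q u / Qc (2 * q) u <= 3 ^+ (4 * q).
  rewrite -[leRHS]mul1r ler_pM ?invr_ge0 ?(ltW (Qc_gt0 _ _)) ?Qc_le1//.
  rewrite -[leRHS]invrK lef_pV2 ?posrE ?invr_gt0 ?exprn_gt0 ?Qc_gt0//.
  by have := Qc_lower q20 u; rewrite mulnA.
have b1 : (2 / pi) ^+ (2 * q) * sin (pi * u) ^+ (2 * q) <= 1.
  apply: mulr_ile1; [exact: e0|exact: e0|apply: le1|apply: le1].
    by rewrite p2 andbT (le_trans _ p0)// oppr_le0.
  by rewrite sin_geN1 sin_le1.
by rewrite /pen -[leRHS]mul1r ler_pM// mulr_ge0.
Qed.

Lemma pen_onem u : pen (1 - u) = pen u.
Proof.
rewrite /pen !Qc_onem// mulrBr mulr1 sinB sinpi cospi mul0r mulN1r sub0r opprK.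
by [].
Qed.

Lemma continuous_pen : continuous pen.
Proof.
have cs : continuous (fun u : R => sin (pi * u)).
  by apply: continuous_comp_scale; exact: continuous_sin.
apply: continuous_mul.
  by apply: continuous_mul; [exact: continuous_const|exact: continuous_expn].
apply: continuous_mul; first exact: continuous_Qc.
by apply: continuous_inv => [|u]; [exact: continuous_Qc|rewrite gt_eqF// Qc_gt0].
Qed.

Variables (K : nat) (K0 : (0 < K)%N) (lambda : R) (l0 : 0 <= lambda).
Local Notation k := (kq q K lambda).

Lemma K_gt0 : 0 < K%:R :> R. Proof. by rewrite ltr0n. Qed.
Let Kn0 : K%:R != 0 :> R. Proof. by rewrite gt_eqF// K_gt0. Qed.

Let range_div (u : R) : 0 <= u <= K%:R -> 0 <= u / K%:R <= 1.
Proof. by rewrite ler_pdivlMr ?K_gt0// ler_pdivrMr ?K_gt0// mul0r mul1r. Qed.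

Let deg4 : (2 * p = 2 * (2 * q) - 2)%N. Proof. by rewrite /deg mulnBr. Qed.

Lemma phiE (u x : R) : phi q K u x =
  Phi p (K%:R * x + q%:R) (zu (u / K%:R)) / (Num.sqrt (Qsum (2 * p) (u / K%:R)))%:C.
Proof.
have E : cexp (- 2 * pi%:C * 'i%C * u%:C / K%:R) = zu (u / K%:R).
  rewrite /zu -cexp_i; congr cexp.
  rewrite -[K%:R : C](rmorph_nat (real_complex R)) -(fmorphV (real_complex R)) /=.
  by apply: complex_eqP; rewrite ?cReM ?cImM /=; ring.
by rewrite /phi (deg_half _ q0) E.
Qed.

Lemma phi_mul (u x t : R) : 0 <= u <= K%:R ->
  phi q K u x * (phi q K u t)^* = phi_prod (K%:R * x) (K%:R * t) (u / K%:R).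
Proof.
move=> /range_div u01; rewrite !phiE deg4 -QcE//.
have Q0 := Qc_gt0 q20 (u / K%:R).
rewrite conjCE conj_div_real -conjCE /phi_prod -[in RHS](sqr_sqrtr (ltW Q0)).
by rewrite rmorphXn /= invfM; ring.
Qed.

Lemma lroot_pow : lroot q lambda ^+ (2 * q) = lambda.
Proof.
rewrite /lroot -powR_mulrn ?powR_ge0// -powRrM mulVf ?powRr1//.
by rewrite pnatr_eq0 -lt0n.
Qed.

Lemma lroot_ge0 : 0 <= lroot q lambda.
Proof. exact: powR_ge0. Qed.

Lemma kq_ge0 : 0 <= k.
Proof. by rewrite /kq !mulr_ge0 ?lroot_ge0 ?pi_ge0. Qed.

Lemma lambda_penal (u : R) : 0 <= u <= K%:R ->
  lambda * penal q K u = k ^+ (2 * q) * pen (u / K%:R).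
Proof.
have E : (2 * p - 2 * q = 2 * q - 2)%N by rewrite /deg; lia.
move=> /range_div u01; rewrite /penal E deg4 -!QcE//.
rewrite -[in LHS]lroot_pow /pen !mulrA; congr (_ / _); congr (_ * _).
rewrite -!exprMn /kq; congr (_ ^+ _); rewrite /sinc -[pi * u / K%:R]mulrA.
move: u01; clear E; move E : (u / K%:R) => v _; have -> : u = v * K%:R by rewrite -E mulfVK.
rewrite mulf_eq0; have := pi_gt0 R => P0; rewrite (gt_eqF P0) /=.
have [->|v0] := eqVneq v 0; first by rewrite !mulr0 mul0r !mulr0 sin0 !mulr0 mul0r.
move: (sin _) P0; move: (@pi R) => P s P0.
by field; rewrite v0 gt_eqF.
Qed.

Lemma Wker_phi_prod x t : Wker q K lambda x t = K%:R%:C *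
  cintegral `[0, 1]%classic (fun u => phi_prod (K%:R * x) (K%:R * t) u /
     (1 + k ^+ (2 * q) * pen u)%:C).
Proof.
pose f u := phi_prod (K%:R * x) (K%:R * t) u / (1 + k ^+ (2 * q) * pen u)%:C.
have den0 u : 0 < 1 + k ^+ (2 * q) * pen u.
  by rewrite ltr_pwDl// mulr_ge0 ?pen_ge0// exprn_ge0// kq_ge0.
have cf : ccont f.
  apply: ccontM; first exact: ccont_phi_prod.
  apply: ccontV => [|u]; last by rewrite fmorph_eq0 gt_eqF.
  apply: ccont_real; apply: continuous_add; first exact: continuous_const.
  by apply: continuous_mul; [exact: continuous_const|exact: continuous_pen].
have cg : ccont (fun u => f (K%:R^-1 * u)) := ccont_scale _ cf.
have := cint_scale (B := K%:R) (c := K%:R) (ltW K_gt0) K_gt0 cg; rewrite (divff Kn0) => H.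
rewrite /Wker (_ : cintegral _ _ =
   cintegral `[0, K%:R]%classic (fun u => f (K%:R^-1 * u))); last first.
  apply: eq_cint => u uK; rewrite phi_mul// lambda_penal// /f.
  by rewrite [_^-1 * u]mulrC.
rewrite H; congr (_ * _); apply: eq_cint => u _.
by rewrite mulKf.
Qed.

End Kernel.
End SplineProducts.

(** * The regression spline kernel by partial fractions *)

Section RegressionKernel.
Variable R : realType.
Local Notation C := R[i].
Local Notation mu := (@lebesgue_measure R).
Variables (q : nat) (q0 : (0 < q)%N).
Local Notation p := (deg q).
Local Notation P := (P2p q : {poly C}).

Let q20 : (0 < 2 * q)%N. Proof. by rewrite muln_gt0. Qed.
Let degE : (2 * p + 1 = 2 * (2 * q) - 1)%N. Proof. by rewrite /deg; lia. Qed.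
Let deg_gt0 : (0 < p)%N. Proof. by rewrite /deg; lia. Qed.

Let fact_neq0 : ((2 * p + 1)`!%:R : C)^-1 != 0.
Proof. by rewrite invr_eq0 pnatr_eq0 -lt0n fact_gt0. Qed.

Lemma root_P2p (z : C) : root P z = root (eulerian C (2 * (2 * q) - 1)) z.
Proof. by rewrite P2pE rootZ// degE. Qed.

Lemma P2p_unit_root (z : C) : root P z -> normc z != 1.
Proof. by rewrite root_P2p; exact: eulerian_unit_root. Qed.

Lemma P2p_factor : exists rs : seq C, [/\ uniq rs, size rs = (2 * p)%N &
  P = ((2 * p + 1)`!%:R)^-1 *: \prod_(r <- rs) ('X - r%:P)].
Proof.
have [rs [urs srs _ E]] := @eulerian_complex_roots R (2 * p).
by exists rs; split => //; rewrite P2pE addn1 E.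
Qed.

Lemma inner_rootsP : [/\ uniq (inner_roots q : seq C), size (inner_roots q : seq C) = p &
  forall z : C, z \in inner_roots q <-> root P z /\ `|z| < 1].
Proof.
have [s [us ss Hs]] := inner_roots_count R q20.
have H : exists s : seq C, [/\ uniq s, size s = p & forall z, z \in s <-> root P z /\ `|z| < 1].
  exists s; split => //; first by rewrite ss /deg; lia.
  by move=> z; rewrite root_P2p.
exact: (xgetPex [::] H).
Qed.

Lemma big_inner_roots (rs : seq C) (F : C -> C) : uniq rs -> (forall z, (z \in rs) = root P z) ->
  \sum_(r <- rs | normc r < 1) F r = \sum_(j < p) F (inner_roots q)`_j.
Proof.
move=> urs rsP; have [us ss Hs] := inner_rootsP.
rewrite -(big_mkord xpredT (fun j => F (inner_roots q)`_j)) -ss -(big_nth 0 xpredT F).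
have pe : perm_eq [seq r <- rs | normc r < 1] (inner_roots q).
  apply: uniq_perm => // [|z]; first exact: filter_uniq.
  rewrite mem_filter rsP; apply/andP/idP.
    by move=> [n1 rz]; apply/Hs; split => //; rewrite normCE ltcR.
  by move/Hs => [rz]; rewrite normCE ltcR.
transitivity (\sum_(r <- [seq r <- rs | normc r < 1]) F r); first by rewrite big_filter.
exact: perm_big pe.
Qed.

Lemma P2p_zu_neq0 (u : R) : P.[zu u] != 0.
Proof.
by apply/negP => rz; have := P2p_unit_root rz; rewrite normc_zu eqxx.
Qed.

Definition circle_int (n : int) : C :=
  cintegral `[0, 1]%classic (fun u : R => zu u ^ n / P.[zu u]).

Lemma ccont_circle n : ccont (fun u : R => zu u ^ n / P.[zu u]).
Proof.
apply: ccontM; first exact: ccont_zu_expz.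
by apply: ccontV; [apply: ccont_poly; exact: ccont_zu|exact: P2p_zu_neq0].
Qed.

Lemma circle_int_pos n : circle_int n.+1 =
  \sum_(j < p) (P^`().[(inner_roots q)`_j])^-1 * (inner_roots q)`_j ^+ n.
Proof.
have [rs [urs srs PE]] := P2p_factor.
have rsP z : (z \in rs) = root P z by rewrite PE rootZ// root_prod_XsubC.
rewrite -(big_inner_roots (fun r => P^`().[r]^-1 * r ^+ n) urs rsP).
have rs1 r : r \in rs -> normc r != 1 by rewrite rsP; exact: P2p_unit_root.
have s0 : (0 < size rs)%N by rewrite srs muln_gt0.
(* The test for membership in [rs] makes every summand continuous: [cint_sum] asks this for all
   indices r, and an arbitrary r may lie on the circle. *)
transitivity (cintegral `[0, 1]%classic (fun u : R =>
    \sum_(r <- rs) if r \in rs then P^`().[r]^-1 * (zu u ^ n.+1 / (zu u - r)) else 0)).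
  apply: eq_cint => u _.
  have zrs : zu u \notin rs by apply/negP => /rs1; rewrite normc_zu eqxx.
  rewrite {1}PE (partial_fractions urs fact_neq0 s0 zrs) -PE mulr_sumr.
  rewrite big_seq [RHS]big_seq; apply: eq_bigr => r rrs; rewrite rrs; ring.
rewrite cint_sum => [|r]; last first.
  case rrs: (r \in rs); last exact: ccont_cst.
  apply: ccontM; first exact: ccont_cst.
  apply: ccontM; first exact: ccont_zu_expz.
  apply: ccontV; last by move=> u; apply: zu_sub_neq0; exact: rs1.
  by apply: ccontD; [exact: ccont_zu|exact: ccont_cst].
rewrite big_seq [RHS]big_mkcond [RHS]big_seq; apply: eq_bigr => r rrs; rewrite rrs.
rewrite cintZ; last first.
  apply: ccontM; first exact: ccont_zu_expz.
  apply: ccontV; last by move=> u; apply: zu_sub_neq0; exact: rs1.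
  by apply: ccontD; [exact: ccont_zu|exact: ccont_cst].
have := pole_int_pos (rs1 _ rrs) n; rewrite /pole_int => ->.
by case: ifP; rewrite ?mulr0.
Qed.

(* Since P2p is self-reciprocal, this moves nonpositive exponents to positive ones. *)
Lemma circle_int_sym n : circle_int n = circle_int ((2 * p)%N%:Z - n).
Proof.
rewrite /circle_int -[LHS](cint_onem (ccont_circle n)); apply: eq_cint => u _.
rewrite zu_onem zuJ P2pE !hornerZ addn1 eulerian_inv ?zu_neq0//.
have z0 := zu_neq0 u; have := P2p_zu_neq0 u.
rewrite P2pE addn1 hornerZ; move: (_^-1) (_.[_]) => c E cE0.
rewrite expfzDr// exprz_inv mulrCA invfM invrK -[zu u ^+ _]/(zu u ^ (2 * p)%N%:Z).
by rewrite [in RHS]mulrAC; ring.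
Qed.

(** Origin of the exponent in [Krs]: for n <= 0 reflection replaces n by 2p - n, and 2p - n - 1 = |n
    - 1| + (2p - 2). *)
Lemma circle_intE n : circle_int n =
  \sum_(j < p) (P^`().[(inner_roots q)`_j])^-1 *
    (inner_roots q)`_j ^+ (absz (n - 1)%R + (2 * p - 2) * (n <= 0)%R)%N.
Proof.
have [n0|n0] := lerP n 0.
  rewrite circle_int_sym muln1.
  have -> : (2 * p)%N%:Z - n = (absz (n - 1) + (2 * p - 2)).+1 by lia.
  exact: circle_int_pos.
rewrite muln0 addn0; case: n n0 => // -[//|n] _.
by rewrite circle_int_pos; apply: eq_bigr => j _; congr (_ * _ ^+ _); lia.
Qed.

(** On the circle conjugation is z -> 1/z and Q_(2p) = z^-p P_2p(z); with these the identity
    defining the alpha_l becomes an expansion of the integrand. *)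
Lemma phi_prodE (x t u : R) : phi_prod q x t u =
  \sum_(l < (2 * p).+1) alpha q l (fract x) (fract t) * (zu u ^ (dxt x t + l%:Z) / P.[zu u]).
Proof.
have z0 := zu_neq0 u.
have /esym A := alphaP q0 x t z0; rewrite deg_half// in A.
have -> : \sum_(l < (2 * p).+1) alpha q l (fract x) (fract t) *
    (zu u ^ (dxt x t + l%:Z) / P.[zu u]) =
  zu u ^ (dxt x t) / P.[zu u] *
  \sum_(l < (2 * p).+1) alpha q l (fract x) (fract t) * zu u ^+ l.
  rewrite mulr_sumr; apply: eq_bigr => l _; rewrite expfzDr//.
  rewrite -[zu u ^ l%:Z]/(zu u ^+ l); move: (zu u ^ _) (zu u ^+ l) (_^-1) (alpha _ _ _ _).
  by move=> a b c d; ring.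
have Pc : Num.conj (Phi p (t + q%:R) (zu u)) = Phi p (t + q%:R) (zu u)^-1.
  by rewrite -zuJ; exact: (esym (Phi_conj _ _ z0)).
rewrite A /phi_prod Pc.
have -> : (Qc (2 * q) u)%:C = zu u ^ (- p%:Z) * P.[zu u].
  rewrite Qc_complex// P2pE hornerZ degE mulrAC -mulrA; congr (_ ^ _ * _).
  by rewrite /deg; lia.
move: (dxt x t) (Phi p _ _) (Phi p _ _) => d f g.
rewrite (expfzDr p%:Z (- d) z0) -!invr_expz.
have := expfz_neq0 p%:Z z0; have := expfz_neq0 d z0; have := P2p_zu_neq0 u.
move: (P.[_]) (_ ^ p%:Z) (_ ^ d) => a b c a0 c0 b0.
by field; rewrite a0 b0 c0.
Qed.

Lemma cint_phi_prod (x t : R) :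
  cintegral `[0, 1]%classic (phi_prod q x t) = Krs q x t.
Proof.
transitivity (cintegral `[0, 1]%classic (fun u : R =>
  \sum_(l < (2 * p).+1) alpha q l (fract x) (fract t) *
     (zu u ^ (dxt x t + l%:Z) / P.[zu u]))).
  by apply: eq_cint => u _; rewrite phi_prodE.
rewrite cint_sum => [|l]; last first.
  by apply: ccontM; [exact: ccont_cst|exact: ccont_circle].
rewrite /Krs exchange_big /=; apply: eq_bigr => l _.
rewrite cintZ; last exact: ccont_circle.
rewrite -/(circle_int _) circle_intE mulr_sumr; apply: eq_bigr => j _.
by rewrite mulrA.
Qed.

End RegressionKernel.

(** * Bandwidth and normalising constants *)

Section Constants.
Variable R : realType.
Local Notation mu := (@lebesgue_measure R).
Variables (q K : nat) (q0 : (0 < q)%N) (K0 : (0 < K)%N) (lambda : R) (l0 : 0 <= lambda).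
Local Notation k := (kq q K lambda).

Definition lorentz (x : R) : R := (1 + x ^+ (2 * q))^-1.

Lemma even_pow_ge0 (x : R) : 0 <= x ^+ (2 * q).
Proof. by rewrite exprM exprn_ge0// sqr_ge0. Qed.

Lemma lorentz_den_gt0 (x : R) : 0 < 1 + x ^+ (2 * q).
Proof. by rewrite ltr_pwDl// even_pow_ge0. Qed.

Lemma lorentz_gt0 (x : R) : 0 < lorentz x.
Proof. by rewrite invr_gt0 lorentz_den_gt0. Qed.

Lemma continuous_lorentz : continuous lorentz.
Proof.
apply: continuous_inv => [|x]; last by rewrite gt_eqF// lorentz_den_gt0.
by apply: continuous_add; [exact: continuous_const|apply: continuous_expn => x; exact: cvg_id].
Qed.

Let K0R : 0 < K%:R :> R. Proof. exact: K_gt0. Qed.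

Lemma bandwidthE : bandwidth q K lambda =
  (\int[mu]_(x in `[0, K%:R]%classic) lorentz (lroot q lambda * pi * x))^-1.
Proof.
rewrite /bandwidth; congr (_^-1); apply: eq_Rintegral => x _.
by rewrite /lorentz -mulrA [in RHS]exprMn lroot_pow.
Qed.

(** The integrand is bounded below by its value at the right end K, where its argument equals
    k_q. *)
Lemma bandwidth_integral_gt0 :
  0 < \int[mu]_(x in `[0, K%:R]%classic) lorentz (lroot q lambda * pi * x).
Proof.
have cl : continuous (fun x => lorentz (lroot q lambda * pi * x)).
  by apply: continuous_comp_scale; exact: continuous_lorentz.
apply: (@lt_le_trans _ _ (lorentz k * K%:R)); first by rewrite mulr_gt0// lorentz_gt0.
have -> : lorentz k * K%:R = \int[mu]_(x in `[0, K%:R]%classic) lorentz k.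
  by rewrite Rintegral_cst//= lebesgue_measure_itv /= lte_fin K0R /= subr0.
apply: le_Rintegral => //.
- by apply: cont_integrable; exact: continuous_const.
- exact: cont_integrable.
move=> x; rewrite /= in_itv /= => /andP[x0 xK].
rewrite /lorentz lef_pV2 ?posrE ?lorentz_den_gt0// lerD2l lerXn2r ?nnegrE ?kq_ge0//.
  by rewrite !mulr_ge0 ?lroot_ge0 ?pi_ge0.
by rewrite /kq ler_wpM2l// mulr_ge0 ?lroot_ge0 ?pi_ge0.
Qed.

Lemma kq_integral : 0 < k -> \int[mu]_(x in `[0, k]%classic) lorentz x =
  lroot q lambda * pi * \int[mu]_(x in `[0, K%:R]%classic) lorentz (lroot q lambda * pi * x).
Proof.
move=> k0; have c0 : 0 < lroot q lambda * pi by move: k0; rewrite /kq pmulr_lgt0.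
rewrite (Rint_scale (c := lroot q lambda * pi) (ltW k0) c0 continuous_lorentz).
by rewrite /kq [_ * K%:R]mulrC mulfK// gt_eqF.
Qed.

(** This cancels the scaling of both arguments by K in [phi]. When k_q = 0 the root of lambda is 0,
    the bandwidth integrand is 1, and the conventional value of [cst1] gives the same relation. *)
Lemma cst1_bandwidth : cst1 q K lambda * bandwidth q K lambda = K%:R^-1.
Proof.
have Bn := bandwidth_integral_gt0.
rewrite /cst1 bandwidthE; case: eqP => [k0|/eqP k0].
  have r0 : lroot q lambda = 0.
    by apply/eqP; move: k0 => /eqP; rewrite /kq !mulf_eq0 (gt_eqF (pi_gt0 R)) (gt_eqF K0R) !orbF.
  rewrite mul1r; congr (_^-1).
  transitivity (\int[mu]_(x in `[0, K%:R]%classic) (1 : R)).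
    apply: eq_Rintegral => x _; rewrite r0 !mul0r /lorentz expr0n muln_eq0 /= (gtn_eqF q0).
    by rewrite addr0 invr1.
  by rewrite Rintegral_cst//= lebesgue_measure_itv /= lte_fin K0R /= subr0 mul1r.
have kp : 0 < k by rewrite lt0r k0 kq_ge0.
have := kq_integral kp; rewrite {1}/lorentz => ->.
move: Bn k0; rewrite {2}/kq; move: (\int[mu]_(x in _) _) => B B0 k0.
rewrite mulrA mulfK ?(gt_eqF B0)// /kq invfM -mulrA mulrCA.
by rewrite mulVf ?mulr1//; move: k0; rewrite mulf_eq0 negb_or => /andP[].
Qed.

Lemma cst2_bandwidth : 0 < k -> cst2 q K lambda * bandwidth q K lambda = lroot q lambda.
Proof.
move=> k0; have Bn := bandwidth_integral_gt0.
rewrite /cst2 bandwidthE; have := kq_integral k0; rewrite {1}/lorentz => ->.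
move: Bn; move: (\int[mu]_(x in _) _) => B B0.
rewrite !mulrA mulfK ?(gt_eqF B0)// mulrC mulrA mulfV ?mul1r//.
by rewrite gt_eqF// pi_gt0.
Qed.

End Constants.

(** * The case k_q < 1 *)

Section SmallBandwidth.
Variable R : realType.
Local Notation C := R[i].
Variables (q K : nat) (q0 : (0 < q)%N) (K0 : (0 < K)%N) (lambda : R) (l0 : 0 <= lambda).
Local Notation k := (kq q K lambda).

Lemma kernel_phi_prod (c x t : R) :
  (c * bandwidth q K lambda)%:C * Wker q K lambda (bandwidth q K lambda * (c * x))
    (bandwidth q K lambda * (c * t)) =
  c%:C * eqkernel q K lambda (c * x) (c * t).
Proof. by rewrite /eqkernel rmorphM /= -[LHS]mulrA. Qed.

Lemma pen_den_gt0 (u : R) : 0 < 1 + k ^+ (2 * q) * pen q u.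
Proof. by rewrite ltr_pwDl// mulr_ge0 ?pen_ge0// even_pow_ge0. Qed.

Lemma ccont_pen_den : ccont (fun u : R => ((1 + k ^+ (2 * q) * pen q u)%:C)^-1 : C).
Proof.
apply: ccontV => [|u]; last by rewrite fmorph_eq0 gt_eqF// pen_den_gt0.
apply: ccont_real; apply: continuous_add; first exact: continuous_const.
by apply: continuous_mul; [exact: continuous_const|exact: continuous_pen].
Qed.

(** The quotient m / (1 + k_q^(2q) m) left after removing the m = 0 part, with m = [pen]; the factor
    k_q^(2q) is kept outside. *)
Definition K1_density (x t u : R) : C :=
  (pen q u)%:C * (phi_prod q x t u / (1 + k ^+ (2 * q) * pen q u)%:C).

Lemma ccont_K1_density x t : ccont (K1_density x t).
Proof.
apply: ccontM; first by apply: ccont_real; exact: continuous_pen.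
by apply: ccontM; [exact: ccont_phi_prod|exact: ccont_pen_den].
Qed.

Lemma K1E x t : K1 q K lambda x t =
  complex.Re (cintegral `[0, 2^-1]%classic (fun u => 2 * K1_density x t u)).
Proof.
rewrite /K1; congr complex.Re; apply: eq_cint => u /andP[u0 u2].
have u01 : 0 <= u <= 1 by rewrite u0; lra.
have KR0 : 0 < K%:R :> R by exact: K_gt0.
have Kn : K%:R != 0 :> R by rewrite gt_eqF.
have uK : 0 <= K%:R * u <= K%:R.
  by case/andP: u01 => ? ?; rewrite mulr_ge0 ?(ltW KR0)//= -[leRHS]mulr1 ler_wpM2l// ltW.
have Ku : K%:R * u / K%:R = u by rewrite mulrC mulKf.
rewrite -[_ * phi _ _ _ _ * _]mulrA phi_mul// lambda_penal// Ku ![K%:R * (_ / K%:R)]mulrCA !divff// !mulr1.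
have -> : (4 * q - 2 = 2 * (2 * q) - 2)%N by rewrite (mulnA 2 2 q).
rewrite -!QcE// ?muln_gt0// /K1_density.
have := pen_den_gt0 u; move: (1 + _) => D D0.
have q2 : (0 < 2 * q)%N by rewrite muln_gt0.
have := Qc_gt0 q2 u; rewrite /pen; move: (Qc _ _) (Qc _ _) => Q1 Q2 Q20.
have P0 : 0 < pi ^+ (2 * q) :> R by rewrite exprn_gt0// pi_gt0.
rewrite expr_div_n; move: P0; move: (pi ^+ _) (2 ^+ _) (sin _ ^+ _) => P A B P0.
move: (phi_prod _ _ _ _) => f.
have -> : (P * Q2 * D)%:C^-1 = ((P * Q2 * D)^-1)%:C :> C by rewrite fmorphV.
have -> : D%:C^-1 = (D^-1)%:C :> C by rewrite fmorphV.
have -> : 2 = (2 : R)%:C :> C by rewrite rmorph_nat.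
have E : 2 * A * B * Q1 / (P * Q2 * D) = 2 * (A / P * B * (Q1 / Q2)) / D.
  by field; rewrite !gt_eqF.
by rewrite mulrAC -rmorphM /= E !rmorphM /=; ring.
Qed.

Lemma normc_K1_density x t u : normc (K1_density x t u) <= 3 ^+ (4 * q) * 3 ^+ (4 * q).
Proof.
rewrite /K1_density normcM (normcM (phi_prod _ _ _ _)) normcV !normc_real (ger0_norm (pen_ge0 q0 u)).
rewrite (ger0_norm (ltW (pen_den_gt0 u))).
rewrite ler_pM ?pen_ge0 ?mulr_ge0 ?normc_ge0 ?invr_ge0 ?(ltW (pen_den_gt0 u)) ?pen_le//.
rewrite -[leRHS]mulr1 ler_pM ?normc_ge0 ?invr_ge0 ?(ltW (pen_den_gt0 u)) ?normc_phi_prod//.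
by rewrite invf_le1 ?pen_den_gt0// lerDl mulr_ge0 ?pen_ge0// even_pow_ge0.
Qed.

Lemma K1_bounded x t : `|K1 q K lambda x t| <= 3 ^+ (4 * q) * 3 ^+ (4 * q).
Proof.
rewrite K1E; have h0 : 0 <= 2^-1 :> R by rewrite invr_ge0.
have cf : ccont (fun u => 2 * K1_density x t u).
  by apply: ccontM; [exact: ccont_cst|exact: ccont_K1_density].
have H u : 0 <= u <= 2^-1 -> normc (2 * K1_density x t u) <= 2 * (3 ^+ (4 * q) * 3 ^+ (4 * q)).
  by move=> _; rewrite normcM normc_nat ler_wpM2l// normc_K1_density.
have := Re_cint_bound h0 cf H; rewrite subr0.
by rewrite mulrAC mulfV ?mul1r// pnatr_eq0.
Qed.

(** From 1 / (1 + k^(2q) m) = 1 - k^(2q) m / (1 + k^(2q) m): the constant 1 integrates to [Krs], and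
    the rest is real by Hermitian symmetry. *)
Lemma kernel_small x t :
  (cst1 q K lambda)%:C * eqkernel q K lambda (cst1 q K lambda * x) (cst1 q K lambda * t) =
  Krs q x t - (k ^+ (2 * q) * K1 q K lambda x t)%:C.
Proof.
have KR0 : 0 < K%:R :> R by exact: K_gt0.
have Kn : K%:R != 0 :> R by rewrite gt_eqF.
have E y : K%:R * (bandwidth q K lambda * (cst1 q K lambda * y)) = y.
  by rewrite [bandwidth _ _ _ * _]mulrA [bandwidth _ _ _ * _]mulrC cst1_bandwidth// mulVKf.
rewrite -kernel_phi_prod Wker_phi_prod// !E cst1_bandwidth//.
rewrite mulrA -rmorphM /= mulVf// mul1r rmorphM /= K1E.
rewrite -cint_hermitian; first last.
- move=> u; rewrite /K1_density phi_prod_onem// pen_onem//.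
  move: (pen q u) (phi_prod q x t u) (1 + _) => a f D.
  have {}E : D%:C^-1 = (D^-1)%:C :> C by rewrite fmorphV.
  by rewrite E; case: f => b c; apply: complex_eqP => /=; ring.
- exact: ccont_K1_density.
rewrite -cint_phi_prod// -mulNr -cintZ; last exact: ccont_K1_density.
rewrite -cintD; [|exact: ccont_phi_prod|]; last first.
  by apply: ccontM; [exact: ccont_cst|exact: ccont_K1_density].
apply: eq_cint => u _; rewrite /K1_density.
have := pen_den_gt0 u; move: (k ^+ _) (pen _ _) (phi_prod _ _ _ _) => a b f D0.
have D1 : (1 + a * b)%:C != 0 :> C by rewrite fmorph_eq0 gt_eqF.
by move: D1; rewrite rmorphD rmorphM rmorph1 /= => D1; field.
Qed.

End SmallBandwidth.

(** * The cosine transform of 1 / (1 + y ^+ (2 * q)) *)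

Section IntegralTools.
Variable R : realType.
Local Notation C := R[i].
Local Notation mu := (@lebesgue_measure R).

Lemma Rint_split (f : R -> R) a b : 0 <= a -> a <= b -> continuous f ->
  \int[mu]_(x in `[0, b]%classic) f x =
  \int[mu]_(x in `[0, a]%classic) f x + \int[mu]_(x in `[a, b]%classic) f x.
Proof.
move=> a0 ab cf; have b0 := le_trans a0 ab.
have [F HF] := primitive_exists b0 cf.
rewrite (FTC_segment b0 cf HF).
have -> : \int[mu]_(x in `[0, a]%classic) f x = F a - F 0.
  by apply: (FTC_segment a0 cf) => x /andP[x0 xa]; apply: HF; rewrite x0 (le_trans xa).
have -> : \int[mu]_(x in `[a, b]%classic) f x = F b - F a.
  by apply: (FTC_segment ab cf) => x /andP[ax xb]; apply: HF; rewrite xb (le_trans a0).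
by ring.
Qed.

Lemma cint_split (f : R -> C) a b : 0 <= a -> a <= b -> ccont f ->
  cintegral `[0, b]%classic f = cintegral `[0, a]%classic f + cintegral `[a, b]%classic f.
Proof.
move=> a0 ab [f1 f2]; rewrite /cintegral; apply: complex_eqP; rewrite ?cReD ?cImD /=.
  exact: (Rint_split (f := fun x => complex.Re (f x))).
exact: (Rint_split (f := fun x => complex.Im (f x))).
Qed.

Lemma Rint_subst (f th dth : R -> R) T : 0 <= T -> continuous f -> continuous dth ->
  th 0 = 0 -> (forall y : R, is_derive y (1 : R) th (dth y)) ->
  (forall y, 0 <= y <= T -> 0 <= th y <= 1) ->
  \int[mu]_(y in `[0, T]%classic) (f (th y) * dth y) = \int[mu]_(u in `[0, th T]%classic) f u.
Proof.
move=> T0 cf cd th0 dt th01.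
have [F HF] := primitive_exists ler01 cf.
have /andP[tT0 tT1] : 0 <= th T <= 1 by apply: th01; rewrite T0 lexx.
have -> : \int[mu]_(u in `[0, th T]%classic) f u = F (th T) - F (th 0).
  rewrite th0; apply: (FTC_segment tT0 cf) => x /andP[x0 xT]; apply: HF.
  by rewrite x0 (le_trans xT).
apply: (FTC_segment (F := fun y : R => F (th y)) T0).
  apply: continuous_mul => // y; apply: (@continuous_comp _ _ _ th f); last exact: cf.
  by apply: is_derive_continuous => s; exact: dt.
move=> y y0T; have := is_derive1_comp (HF _ (th01 y y0T)) (dt y).
exact.
Qed.

Lemma cint_subst (f : R -> C) (th dth : R -> R) T : 0 <= T -> ccont f -> continuous dth ->
  th 0 = 0 -> (forall y : R, is_derive y (1 : R) th (dth y)) ->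
  (forall y, 0 <= y <= T -> 0 <= th y <= 1) ->
  cintegral `[0, T]%classic (fun y => f (th y) * (dth y)%:C) =
  cintegral `[0, th T]%classic f.
Proof.
move=> T0 [f1 f2] cd th0 dt th01; rewrite /cintegral; apply: complex_eqP => /=.
  rewrite -(Rint_subst T0 f1 cd th0 dt th01); apply: eq_Rintegral => y _.
  by rewrite cReM /= mulr0 subr0.
rewrite -(Rint_subst T0 f2 cd th0 dt th01); apply: eq_Rintegral => y _.
by rewrite cImM /= mulr0 add0r.
Qed.

Lemma cint_half (f : R -> C) : ccont f -> (forall x, f (1 - x) = f x) ->
  cintegral `[0, 1]%classic f = 2 * cintegral `[0, 2^-1]%classic f.
Proof.
move=> [f1 f2] sym.
have -> : 2 = (2 : R)%:C :> C by rewrite rmorph_nat.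
rewrite /cintegral; apply: complex_eqP; rewrite ?cReMl ?cImMl /=.
  rewrite (Rint_half (f := fun x => complex.Re (f x)) f1) mulr_natl mulr2n.
  by congr (_ + _); apply: eq_Rintegral => x _; rewrite sym.
rewrite (Rint_half (f := fun x => complex.Im (f x)) f2) mulr_natl mulr2n.
by congr (_ + _); apply: eq_Rintegral => x _; rewrite sym.
Qed.

Lemma continuous_bounded (f : R -> R) : continuous f ->
  exists B, forall x, 0 <= x <= 1 -> `|f x| <= B.
Proof.
move=> cf; have cn : continuous (fun x => `|f x|).
  by move=> x; apply: (continuous_comp (cf x)); exact: norm_continuous.
have [c _ H] := EVT_max ler01 (continuous_subspaceT cn).
by exists `|f c| => x x01; apply: H; rewrite in_itv.
Qed.

Lemma ccont_bounded (f : R -> C) : ccont f ->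
  exists B, forall x, 0 <= x <= 1 -> normc (f x) <= B.
Proof.
move=> [/continuous_bounded[B1 H1] /continuous_bounded[B2 H2]].
exists (B1 + B2) => x x01; rewrite (le_trans (normc_le_ReIm _))//.
by rewrite lerD ?H1 ?H2.
Qed.

Lemma continuous_atan_den : continuous (fun x : R => (1 + x ^+ 2)^-1).
Proof.
apply: continuous_inv => [|x]; last by rewrite gt_eqF// ltr_pwDl// sqr_ge0.
by apply: continuous_add; [exact: continuous_const|apply: continuous_expn => x; exact: cvg_id].
Qed.

Lemma Rint_atan (a b : R) : a <= b ->
  \int[mu]_(x in `[a, b]%classic) (1 + x ^+ 2)^-1 = atan b - atan a.
Proof. by move=> ab; exact: (FTC_segment ab continuous_atan_den). Qed.

Lemma cvg_atan_tail (c T : R) : 0 < c ->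
  ((fun N => pi / 2 - atan (c * (T + N%:R))) @ \oo --> (0 : R))%classic.
Proof.
move=> c0; rewrite -(subrr (pi / 2 : R)); apply: cvgB; first exact: cvg_cst.
apply: (cvg_comp _ _ _ (@cvgy_atan R)).
apply/cvgryPge => A; near=> N.
rewrite -ler_pdivrMl// -lerBlDl; near: N.
have [m Hm] : exists m : nat, `|c^-1 * A - T| <= m%:R.
  by exists (Num.bound `|c^-1 * A - T|); exact: ltW (archi_boundP (normr_ge0 _)).
exists m => // N /= mN; rewrite (le_trans (ler_norm _))// (le_trans Hm)// ler_nat.
Unshelve. all: by end_near.
Qed.

End IntegralTools.

(** * Exact integrals against 1 / (y^2 + a^2) *)

Section CosineTransform.
Variable R : realType.
Local Notation C := R[i].
Local Notation mu := (@lebesgue_measure R).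

Lemma normc_sqr (z : C) : normc z ^+ 2 = complex.Re z ^+ 2 + complex.Im z ^+ 2.
Proof. by case: z => a b; rewrite /normc sqr_sqrtr ?addr_ge0 ?sqr_ge0. Qed.

Lemma onep_neq0 (b : C) : 0 < complex.Re b -> 1 + b != 0.
Proof.
by move=> b0; apply/negP => /eqP /(congr1 (@complex.Re R)); rewrite cReD /=; lra.
Qed.

Lemma normc_cayley (b : C) : 0 < complex.Re b -> normc ((1 - b) / (1 + b)) < 1.
Proof.
move=> b0; rewrite normcM normcV ltr_pdivrMr ?normc_gt0 ?onep_neq0// mul1r.
rewrite -(@ltr_pXn2r _ 2) ?nnegrE ?normc_ge0// !normc_sqr !cReD !cImD cReN cImN /=.
by move: b0; case: b => r s /=; nra.
Qed.

Section Fixed.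
Variables (a : C) (a0 : 0 < complex.Re a).

Definition quad (y : R) : C := (y ^+ 2)%:C + a ^+ 2.

(** y^2 + a^2 = (a + i y)(a - i y), and each factor has modulus at least Re a; the proof checks this
    by expanding the squared modulus. *)
Lemma normc_quad (y : R) : complex.Re a ^+ 2 <= normc (quad y).
Proof.
rewrite -(@ler_pXn2r _ 2) ?nnegrE ?sqr_ge0 ?normc_ge0// normc_sqr /quad.
rewrite cReD cImD expr2 cReM cImM /=; case: a => b c /=.
have := sqr_ge0 b; have := sqr_ge0 c; have := sqr_ge0 y.
rewrite -!expr2; move: (y ^+ 2) => s s0 c0 b0.
have : 0 <= (s - c ^+ 2) ^+ 2 by exact: sqr_ge0.
by nra.
Qed.

Lemma quad_neq0 (y : R) : quad y != 0.
Proof. by rewrite -normc_gt0 (lt_le_trans _ (normc_quad y))// exprn_gt0. Qed.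

Lemma normc_quadV : exists2 M, 0 < M & forall y : R, normc (quad y)^-1 <= M * (1 + y ^+ 2)^-1.
Proof.
set n2 := normc a ^+ 2; have n20 : 0 <= n2 by exact: sqr_ge0.
have al0 : 0 < complex.Re a ^+ 2 by rewrite exprn_gt0.
have aln : complex.Re a ^+ 2 <= n2 by rewrite /n2 normc_sqr lerDl sqr_ge0.
exists (2 * (n2 + 1) / complex.Re a ^+ 2).
  by rewrite divr_gt0// mulr_gt0// ltr_wpDl.
move=> y; have y1 : 0 < 1 + y ^+ 2 by rewrite ltr_pwDl// sqr_ge0.
have Q0 : 0 < normc (quad y) by rewrite normc_gt0 quad_neq0.
rewrite normcV ler_pdivlMr// mulrC ler_pdivrMr// mulrAC ler_pdivlMr//.
have h1 := normc_quad y.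
have h2 : y ^+ 2 - n2 <= normc (quad y).
  have := ler_normcD (quad y) (- a ^+ 2); rewrite /quad addrK normc_opp normcX -/n2.
  by rewrite normc_real ger0_norm ?sqr_ge0// lerBlDr.
move: al0 aln h1 h2 y1; move: (normc _) (complex.Re a ^+ 2) (y ^+ 2) => Q al s.
move=> al0 aln h1 h2 y1.
(* For large y, y^2 - |a|^2 is at least (1 + y^2) / 2; otherwise 1 + y^2 is bounded and (Re a)^2
   suffices. *)
have [h|h] := lerP (2 * (n2 + 1)) (1 + s); nra.
Qed.

Lemma ccont_quadV : ccont (fun y => (quad y)^-1).
Proof.
apply: ccontV; last exact: quad_neq0.
apply: ccontD; last exact: ccont_cst.
by apply: ccont_real; apply: continuous_expn => x; exact: cvg_id.
Qed.

Variables (n : nat) (c : R) (c0 : 0 < c).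

Let b : C := c%:C * a.
Let rho : C := (1 - b) / (1 + b).

Let Reb : 0 < complex.Re b. Proof. by rewrite /b cReMl mulr_gt0. Qed.

Let b_neq0 : b != 0.
Proof. by apply: contraTneq Reb => ->; rewrite ltxx. Qed.

Let b1_neq0 : 1 + b != 0. Proof. exact: onep_neq0. Qed.

Let rho_lt1 : normc rho < 1. Proof. exact: normc_cayley. Qed.

(** Under c y = tan (pi u), y^2 + a^2 equals [trig u] divided by (c cos (pi u))^2, where b = c a. *)
Let trig (u : R) : C := (sin (pi * u) ^+ 2)%:C + b ^+ 2 * (cos (pi * u) ^+ 2)%:C.

(** As a function of z, the right-hand side has the zeros rho and 1 / rho, and |rho| < 1 because Re
    b > 0. *)
Let trigE u : 4 * zu u * trig u = ((1 + b) * zu u - (1 - b)) * ((1 + b) - (1 - b) * zu u).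
Proof.
have z0 := zu_neq0 u.
have E : (complex.Re (zu u))%:C * 2 * zu u = zu u ^+ 2 + 1.
  have : zu u * (zu u)^-1 = 1 by rewrite mulfV.
  rewrite -zuJ; case: (zu u) => r s.
  move=> /[dup] /(congr1 (@complex.Re R)) + /(congr1 (@complex.Im R)).
  rewrite cReM cImM /= => h1 h2.
  rewrite expr2; apply: complex_eqP; rewrite !(cReM, cImM, cReD, cImD) /=; lra.
have ReE : complex.Re (zu u) = cos (2 * pi * u) by rewrite /zu /= cosN.
have sE : (sin (pi * u) ^+ 2)%:C = (1 - (complex.Re (zu u))%:C) / 2 :> C.
  have -> : (1 - (complex.Re (zu u))%:C) / 2 = ((1 - complex.Re (zu u)) / 2)%:C :> C.
    by rewrite rmorphM rmorphB fmorphV rmorph1 rmorph_nat.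
  by congr (_%:C); rewrite ReE -mulrA mulr_natl cos_mulr2n cos2sin2 -mulr_natr; field.
have cE : (cos (pi * u) ^+ 2)%:C = (1 + (complex.Re (zu u))%:C) / 2 :> C.
  have -> : (1 + (complex.Re (zu u))%:C) / 2 = ((1 + complex.Re (zu u)) / 2)%:C :> C.
    by rewrite rmorphM rmorphD fmorphV rmorph1 rmorph_nat.
  by congr (_%:C); rewrite ReE -mulrA mulr_natl cos_mulr2n -mulr_natr; field.
rewrite /trig sE cE; move: E; move: (zu u) (b) => z B.
rewrite -/(real_complex R (complex.Re z)); move: (real_complex R _) => r E.
have -> : 4 * z * ((1 - r) / 2 + B ^+ 2 * ((1 + r) / 2)) =
  2 * z - r * 2 * z + B ^+ 2 * (2 * z + r * 2 * z) by field.
by rewrite E; ring.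
Qed.

Let rho_neq1 : normc rho != 1. Proof. by rewrite lt_eqF. Qed.

Let trig_neq0 u : trig u != 0.
Proof.
have z1 := zu_sub_neq0 rho_neq1 u; have z2 := zu_sub_neq0 rho_neq1 (1 - u).
have h1 : (1 + b) * zu u - (1 - b) = (1 + b) * (zu u - rho) by rewrite /rho; field.
have h2 : (1 + b) - (1 - b) * zu u = (1 + b) * zu u * (zu (1 - u) - rho).
  by rewrite zu_onem zuJ /rho; field; rewrite zu_neq0 b1_neq0.
have := trigE u; rewrite h1 h2; apply: contra_eq_neq => ->.
by rewrite mulr0 eq_sym !mulf_neq0// zu_neq0.
Qed.

Let trigVE u : (trig u)^-1 = b^-1 * (rho / (zu u - rho) + zu (1 - u) / (zu (1 - u) - rho)).
Proof.
have z1 := zu_sub_neq0 rho_neq1 u; have z2 := zu_sub_neq0 rho_neq1 (1 - u).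
have z0 := zu_neq0 u; have t0 := trig_neq0 u.
have h1 : (1 + b) * zu u - (1 - b) = (1 + b) * (zu u - rho) by rewrite /rho; field.
have h2 : (1 + b) - (1 - b) * zu u = (1 + b) * zu u * (zu (1 - u) - rho).
  by rewrite zu_onem zuJ /rho; field; rewrite zu_neq0 b1_neq0.
have h3 : rho / (zu u - rho) + zu (1 - u) / (zu (1 - u) - rho) =
  (4 * b / (1 + b) ^+ 2) / ((zu u - rho) * (zu (1 - u) - rho)).
  have -> : 4 * b / (1 + b) ^+ 2 = 1 - rho ^+ 2 by rewrite /rho; field.
  move: z2; rewrite zu_onem zuJ => z2.
  move: z0 z1 z2; move: (rho) (zu u) => r z z0 z1 z2.
  have := mulf_neq0 z0 z2; rewrite mulrBr mulfV// => z3.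
  by field; rewrite z0 z1 andbT mulNr mulrC.
have T := trigE u; rewrite h1 h2 in T.
have -> : (trig u)^-1 = 4 * zu u / (4 * zu u * trig u) by field; rewrite t0 z0.
rewrite T h3; move: z1 z2; move: (zu (1 - u)) => z' z1 z2.
by field; rewrite z0 z1 z2 b1_neq0 b_neq0.
Qed.

Let cosn (u : R) : C := (cos (2 * n%:R * (pi * u)))%:C.

Let cosnE u : cosn u = (zu u ^ n%:Z + zu (1 - u) ^ n%:Z) / 2.
Proof.
rewrite zu_onem -zuN !zu_expz /cosn; apply: (canRL (mulfK _)); first by rewrite pnatr_eq0.
have -> : - (2 * pi * n%:~R) * - u = 2 * n%:R * (pi * u) :> R by ring.
have -> : - (2 * pi * n%:~R) * u = - (2 * n%:R * (pi * u)) :> R by ring.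
rewrite /cis cosN sinN.
by apply: complex_eqP; rewrite ?cReMl ?cImMl ?cReD ?cImD /=; ring.
Qed.

Let ccont_trigV : ccont (fun u => (trig u)^-1).
Proof.
apply: ccontV; last exact: trig_neq0.
have cs (f : R -> R) : continuous f -> ccont (fun u : R => (f (pi * u) ^+ 2)%:C : C).
  by move=> cf; apply: ccont_real; apply: continuous_expn; exact: continuous_comp_scale.
apply: ccontD; first by apply: cs; exact: continuous_sin.
by apply: ccontM; [exact: ccont_cst|apply: cs; exact: continuous_cos].
Qed.

Let ccont_cosn : ccont cosn.
Proof.
apply: ccont_real; apply: (continuous_comp_scale (f := fun v => cos (2 * n%:R * v))).
by apply: continuous_comp_scale; exact: continuous_cos.
Qed.

Let trig_onem u : trig (1 - u) = trig u.
Proof.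
rewrite /trig mulrBr mulr1 sinB cosB sinpi cospi !mul0r mulN1r sub0r opprK addr0.
by rewrite mulN1r sqrrN.
Qed.

Let cosn_onem u : cosn (1 - u) = cosn u.
Proof. by rewrite !cosnE opprB addrCA subrr addr0 addrC. Qed.

(** Since [trig] is invariant under u -> 1 - u, the cosine may be replaced by z^n. After reflection
    of the second partial fraction both terms are values of [pole_int] at rho, with exponents n and
    1 - n; the nonpositive one vanishes. *)
Lemma cint_trig : cintegral `[0, 1]%classic (fun u => cosn u * (trig u)^-1) = rho ^+ n / b.
Proof.
have ccont_z m : ccont (fun u => zu u ^ m / (zu u - rho)).
  apply: ccontM; first exact: ccont_zu_expz.
  apply: ccontV; last exact: zu_sub_neq0.
  by apply: ccontD; [exact: ccont_zu|exact: ccont_cst].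
have cz : ccont (fun u => 2^-1 * (zu u ^ n%:Z * (trig u)^-1)).
  by apply: ccontM; [exact: ccont_cst|apply: ccontM => //; exact: ccont_zu_expz].
transitivity (cintegral `[0, 1]%classic (fun u => zu u ^ n%:Z * (trig u)^-1)).
  transitivity (cintegral `[0, 1]%classic (fun u => 2^-1 * (zu u ^ n%:Z * (trig u)^-1)) +
     cintegral `[0, 1]%classic (fun u => 2^-1 * (zu (1 - u) ^ n%:Z * (trig (1 - u))^-1))).
    rewrite -cintD//; last exact: ccont_onem cz.
    by apply: eq_cint => u _; rewrite cosnE trig_onem; ring.
  rewrite (cint_onem cz) -cintD//; apply: eq_cint => u _; by field; exact: trig_neq0.
pose g u := b^-1 * (zu u ^ (1 - n%:Z) / (zu u - rho)).
have cg : ccont g by apply: ccontM; [exact: ccont_cst|exact: ccont_z].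
transitivity (cintegral `[0, 1]%classic (fun u => b^-1 * rho * (zu u ^ n%:Z / (zu u - rho))) +
  cintegral `[0, 1]%classic (fun u => g (1 - u))).
  rewrite -cintD; [|by apply: ccontM; [exact: ccont_cst|exact: ccont_z]|exact: ccont_onem].
  apply: eq_cint => u _; rewrite trigVE /g.
  have -> : zu (1 - u) ^ (1 - n%:Z) = zu (1 - u) * zu u ^ n%:Z.
    rewrite expfzDr ?zu_neq0// expr1z zu_onem zuJ exprz_inv opprK//.
  by ring.
rewrite (cint_onem cg) cintZ// [cintegral _ g]cintZ// -!/(pole_int _ _).
case: n => [|m].
  have := pole_int_nonpos rho_neq1 0 rho_lt1; rewrite oppr0 => ->.
  by rewrite (pole_int_pos rho_neq1 0) rho_lt1 mulr0 add0r expr0 mulr1 mul1r.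
have := pole_int_nonpos rho_neq1 m rho_lt1; have -> : 1 - m.+1%:Z = - m%:Z by lia.
by move=> ->; rewrite pole_int_pos// rho_lt1 mulr0 addr0 exprS; ring.
Qed.

(* The substitution c * y = tan (pi * u) turns the integral over [0, +oo[ into
   half of the circle integral [cint_trig]. *)
Lemma quad_cosine_limit : exists B, forall T, 0 <= T ->
  normc (cintegral `[0, T]%classic (fun y =>
    (cos (2 * n%:R * atan (c * y)))%:C * (quad y)^-1) - (pi / 2)%:C / a * rho ^+ n) <=
  B * (pi / 2 - atan (c * T)).
Proof.
pose G u := (pi * c)%:C * (cosn u * (trig u)^-1).
have cG : ccont G.
  by apply: ccontM; [exact: ccont_cst|exact: ccontM].
have [B HB] := ccont_bounded cG.
exists (2 * (B * pi^-1)) => T T0.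
have p0 := pi_gt0 R; have pn : pi != 0 :> R by rewrite gt_eqF.
have a_neq0 : a != 0 by apply: contraTneq a0 => ->; rewrite ltxx.
pose th y := pi^-1 * atan (c * y).
have dth (y : R) : is_derive y (1 : R) th (pi^-1 * ((1 + (c * y) ^+ 2)^-1 * c)).
  have := is_deriveZ pi^-1 (is_derive1_comp (is_derive1_atan (c * y)) (is_derive_scale c y)).
  exact.
have at0 y : 0 <= y -> 0 <= atan (c * y).
  by move=> y0; rewrite -(atan0 R) le_atan// mulr_ge0// ltW.
have th2 y : 0 <= y -> 0 <= th y <= 2^-1.
  move=> y0; rewrite /th mulr_ge0 ?invr_ge0 ?(ltW p0) ?at0//= ler_pdivrMl//.
  exact: ltW (atan_ltpi2 _).
have th01 y : 0 <= y <= T -> 0 <= th y <= 1.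
  by move=> /andP[/th2 /andP[-> h] _]; rewrite (le_trans h)//; lra.
have cdth : continuous (fun y => pi^-1 * ((1 + (c * y) ^+ 2)^-1 * c)).
  apply: continuous_mul; first exact: continuous_const.
  apply: continuous_mul; last exact: continuous_const.
  exact: (continuous_comp_scale (f := fun x => (1 + x ^+ 2)^-1) (@continuous_atan_den R)).
have th00 : th 0 = 0 by rewrite /th mulr0 atan0 mulr0.
have := cint_subst T0 cG cdth th00 dth th01.
rewrite (_ : cintegral _ _ = cintegral `[0, T]%classic (fun y =>
    (cos (2 * n%:R * atan (c * y)))%:C * (quad y)^-1)); last first.
  apply: eq_cint => y /andP[y0 _]; rewrite /G /cosn /trig.
  have -> : pi * th y = atan (c * y) by rewrite /th mulrA mulfV// mul1r.
  have C0 : 1 + (c * y) ^+ 2 != 0 by rewrite gt_eqF// ltr_pwDl// sqr_ge0.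
  have cE : cos (atan (c * y)) ^+ 2 = (1 + (c * y) ^+ 2)^-1.
    by rewrite cos_atan exprVn sqr_sqrtr// addr_ge0// sqr_ge0.
  have sE : sin (atan (c * y)) ^+ 2 = (c * y) ^+ 2 * (1 + (c * y) ^+ 2)^-1.
    by rewrite sin2cos2 cE; field.
  rewrite sE cE; move: (cos _)%:C => k.
  have -> : ((c * y) ^+ 2 / (1 + (c * y) ^+ 2))%:C + b ^+ 2 * ((1 + (c * y) ^+ 2)^-1)%:C =
     (c ^+ 2 / (1 + (c * y) ^+ 2))%:C * quad y.
    move: (_^-1 : R) => D; rewrite /quad /b.
    have -> : ((c * y) ^+ 2 * D)%:C = c%:C ^+ 2 * (y ^+ 2)%:C * D%:C :> C.
      by rewrite exprMn !rmorphM.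
    have -> : (c ^+ 2 * D)%:C = c%:C ^+ 2 * D%:C :> C by rewrite !rmorphM.
    by ring.
  have Q0 := quad_neq0 y.
  rewrite invfM -fmorphV /=.
  have E : (pi * c)%:C * ((c ^+ 2 / (1 + (c * y) ^+ 2))^-1)%:C *
     (pi^-1 * ((1 + (c * y) ^+ 2)^-1 * c))%:C = 1 :> C.
    rewrite -!rmorphM -[RHS](rmorph1 (real_complex R)) /=; congr (_%:C).
    move: C0 pn; move: (@pi R) (1 + _) => P D D0 P0; field.
    by rewrite D0 P0 gt_eqF.
  by rewrite -[RHS]mul1r -[X in _ = X * _]E; ring.
move=> ->; have -> : (pi / 2)%:C / a * rho ^+ n = cintegral `[0, 2^-1]%classic G.
  have sG x : G (1 - x) = G x by rewrite /G trig_onem cosn_onem.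
  apply: (@mulfI _ 2); first by rewrite pnatr_eq0.
  rewrite -(cint_half cG sG) cintZ; last exact: ccontM.
  rewrite cint_trig /b !rmorphM fmorphV rmorph_nat /=.
  have cn : c%:C != 0 :> C by rewrite fmorph_eq0 gt_eqF.
  by field; rewrite cn a_neq0.
have /andP[t0 t2] := th2 _ T0.
rewrite (cint_split t0 t2 cG) normcB addrAC subrr add0r.
have := normc_cint_bound t2 cG (fun x => _ : _ -> normc (G x) <= B).
have -> : 2^-1 - th T = pi^-1 * (pi / 2 - atan (c * T)) by rewrite /th mulrBr mulrA mulVf// mul1r.
rewrite -!mulrA; apply=> x /andP[x0 x1]; apply: HB.
by rewrite (le_trans t0)//=; lra.
Qed.

End Fixed.
End CosineTransform.

(** * From powers of the Cayley transform to the exponential *)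

Section ExponentialLimit.
Variable R : realType.
Local Notation C := R[i].
Local Notation mu := (@lebesgue_measure R).

Lemma cderivM (f g f' g' : R -> C) : cderiv f f' -> cderiv g g' ->
  cderiv (fun t => f t * g t) (fun t => f' t * g t + f t * g' t).
Proof.
move=> Hf Hg t; have [f1 f2] := Hf t; have [g1 g2] := Hg t.
rewrite cReD cImD !cReM !cImM; split.
  under eq_fun do rewrite cReM.
  have := is_deriveB (is_deriveM f1 g1) (is_deriveM f2 g2).
  by move/is_derive_eq; apply; rewrite /GRing.scale /=; ring.
under eq_fun do rewrite cImM.
have := is_deriveD (is_deriveM f1 g2) (is_deriveM f2 g1).
by move/is_derive_eq; apply; rewrite /GRing.scale /=; ring.
Qed.

Lemma cderiv_cexp (z : C) :
  cderiv (fun t => cexp (t%:C * z)) (fun t => cexp (t%:C * z) * z).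
Proof.
have de (t : R) : is_derive t (1 : R) (fun s : R => expR (complex.Re z * s))
    (expR (complex.Re z * t) * complex.Re z).
  have := is_derive1_comp (is_derive_expR (complex.Re z * t)) (is_derive_scale (complex.Re z) t).
  exact.
have H := cderivM (cderiv_real de) (cderiv_cis (complex.Im z)).
have E t : cexp (t%:C * z) = (expR (complex.Re z * t))%:C * cis (complex.Im z * t).
  by rewrite cexpE cReMl cImMl ![t * _]mulrC.
apply: (cderiv_eq _ _ H) => t; first by rewrite E.
rewrite E [X in _ = _ * X](complexE z); have -> : (expR (complex.Re z * t) * complex.Re z)%:C =
  (expR (complex.Re z * t))%:C * (complex.Re z)%:C :> C by rewrite rmorphM.
by ring.
Qed.

(** The mean value bound is applied twice along t -> t z, and each use costs a factor 2. *)
Lemma cexp_quadratic (z : C) : complex.Re z <= 0 ->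
  normc (cexp z - (1 + z)) <= 4 * normc z ^+ 2.
Proof.
move=> z0.
have e1 t : 0 <= t <= 1 -> normc (cexp (t%:C * z)) <= 1.
  move=> /andP[t0 _]; rewrite normc_cexp cReMl -[leRHS](@expR0 R) ler_expR.
  by rewrite mulr_ge0_le0.
have d1 := cderiv_cexp z.
have h1 t : 0 <= t <= 1 -> normc (cexp (t%:C * z) - 1) <= 2 * normc z.
  move=> /andP[t0 t1].
  have := @cderiv_mean_value _ _ _ 0 t (normc z) d1 t0.
  rewrite mul0r cexp0 => H; rewrite (le_trans (H _))//.
    move=> s /andP[s0 st]; rewrite normcM -[leRHS]mul1r ler_wpM2r ?normc_ge0// e1//.
    by rewrite s0 (le_trans st).
  by rewrite subr0 mulrA ler_piMr// mulr_ge0// normc_ge0.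
have dl : cderiv (fun t : R => t%:C * (- z)) (fun=> 1 * (- z)).
  apply: cderivZ; apply: (cderiv_eq _ _ (cderiv_real (is_derive_scale 1))) => t.
    by rewrite mul1r.
  by rewrite rmorph1.
have := @cderiv_mean_value _ _ _ 0 1 (2 * normc z * normc z) (cderivD d1 dl) ler01.
rewrite rmorph1 !mul1r mul0r mul0r cexp0 addr0 subr0 mulr1 => H.
have -> : cexp z - (1 + z) = cexp z - z - 1 by ring.
rewrite (le_trans (H _))//; last by rewrite expr2; lra.
move=> t t01; have -> : cexp (t%:C * z) * z + - z = (cexp (t%:C * z) - 1) * z by ring.
by rewrite normcM ler_wpM2r ?normc_ge0// h1.
Qed.

Lemma normc_expB (x y : C) n : normc x <= 1 -> normc y <= 1 ->
  normc (x ^+ n - y ^+ n) <= n%:R * normc (x - y).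
Proof.
move=> x1 y1; elim: n => [|n IH]; first by rewrite subrr normc0 mul0r.
have -> : x ^+ n.+1 - y ^+ n.+1 = x ^+ n * (x - y) + (x ^+ n - y ^+ n) * y.
  by rewrite !exprSr; ring.
have lS : n.+1%:R = n%:R + 1 :> R by rewrite natr1.
rewrite (le_trans (ler_normcD _ _))// lS [leRHS]mulrDl mul1r addrC lerD//.
  by rewrite normcM (le_trans _ IH)// ler_piMr// normc_ge0.
by rewrite normcM normcX ler_piMl ?normc_ge0// exprn_ile1// normc_ge0.
Qed.

(** Both bases agree with 1 - 2b to second order; 18 = 2 + 4 * 2^2 collects the two remainders. For
    b of order 1/n the bound is O(1/n). *)
Lemma cayley_exp (b : C) n : 0 < complex.Re b ->
  normc (((1 - b) / (1 + b)) ^+ n - cexp (- (n%:R * (2 * b)))) <= n%:R * (18 * normc b ^+ 2).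
Proof.
move=> b0.
have b1_ge1 : 1 <= normc (1 + b).
  rewrite (le_trans _ (Re_le_normc _))// cReD /= ger0_norm; lra.
have b1_neq0 : 1 + b != 0 by rewrite -normc_gt0 (lt_le_trans ltr01).
have rho1 := ltW (normc_cayley b0).
have Re2 : complex.Re (- (2 * b)) <= 0.
  by rewrite cReN cReM /= oppr_le0; case: (b) b0 => r s /=; lra.
have e1 : normc (cexp (- (2 * b))) <= 1.
  by rewrite normc_cexp -[leRHS](@expR0 R) ler_expR.
have -> : - (n%:R * (2 * b)) = n%:R * - (2 * b) by ring.
rewrite cexpMn (le_trans (normc_expB _ rho1 e1))// ler_wpM2l//.
have -> : (1 - b) / (1 + b) - cexp (- (2 * b)) =
  2 * b ^+ 2 / (1 + b) + - (cexp (- (2 * b)) - (1 + - (2 * b))) by field.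
rewrite (le_trans (ler_normcD _ _))// normc_opp.
have h1 := cexp_quadratic Re2; rewrite normc_opp normcM normc_nat in h1.
have h2 : normc (2 * b ^+ 2 / (1 + b)) <= 2 * normc b ^+ 2.
  rewrite !normcM normcV normc_nat -expr2 ler_piMr ?mulr_ge0 ?sqr_ge0 ?normc_ge0//.
  by rewrite invf_le1// normc_gt0.
by rewrite (le_trans (lerD h2 h1))// exprMn; lra.
Qed.

Lemma cos_lip (x y : R) : `|cos x - cos y| <= `|x - y|.
Proof.
by rewrite (le_trans _ (normc_cisB x y))// (le_trans _ (Re_le_normc _)).
Qed.

Lemma atanB_le (x : R) : 0 <= x -> `|x - atan x| <= x ^+ 3.
Proof.
move=> x0.
have d (s : R) : is_derive s (1 : R) (fun s : R => s - atan s) (1 - (1 + s ^+ 2)^-1).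
  exact: is_deriveB.
have [c /andP[c0 cx]] := mean_value x0 d.
rewrite atan0 !subr0 => ->.
have c1 : 0 < 1 + c ^+ 2 by rewrite ltr_pwDl// sqr_ge0.
have -> : 1 - (1 + c ^+ 2)^-1 = c ^+ 2 / (1 + c ^+ 2) by field; rewrite gt_eqF.
rewrite ger0_norm ?mulr_ge0 ?sqr_ge0 ?invr_ge0 ?(ltW c1)// [leRHS]exprSr ler_wpM2r//.
rewrite ler_pdivrMr// (le_trans (_ : _ <= x ^+ 2))//.
  by rewrite lerXn2r ?nnegrE// (le_trans c0).
by rewrite ler_peMr ?sqr_ge0// lerDl sqr_ge0.
Qed.

Section Fixed.
Variables (a : C) (a0 : 0 < complex.Re a).

(** The constant in [quad_cosine_limit] depends on n and c. Sending the endpoint to infinity removes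
    it and leaves only the tail of M / (1 + y^2), uniform in n and c. *)
Let tail_bound M n c T : 0 < c -> 0 <= T -> 0 < M ->
  (forall y : R, normc (quad a y)^-1 <= M * (1 + y ^+ 2)^-1) ->
  normc (cintegral `[0, T]%classic (fun y =>
    (cos (2 * n%:R * atan (c * y)))%:C * (quad a y)^-1) -
    (pi / 2)%:C / a * ((1 - c%:C * a) / (1 + c%:C * a)) ^+ n) <=
  2 * M * (pi / 2 - atan T).
Proof.
move=> c0 T0 M0 HM; have [B HB] := quad_cosine_limit a0 n c0.
set f := fun y => _ : C; set L := _ / a * _.
have cf : ccont f.
  apply: ccontM; last exact: ccont_quadV.
  apply: ccont_real; apply: (continuous_comp_scale (f := fun x => cos (2 * n%:R * atan x))).
  have ca : continuous (fun x : R => 2 * n%:R * atan x).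
    by apply: continuous_mul; [exact: continuous_const|move=> x; exact: continuous_atan].
  by move=> x; apply: (continuous_comp (ca x)); exact: continuous_cos.
have cvB : ((fun N => B * (pi / 2 - atan (c * (T + N%:R)))) @ \oo --> (0 : R))%classic.
  by rewrite -(mulr0 B); apply: cvgMr; exact: cvg_atan_tail.
apply: (ler_cvg0D cvB) => N _.
have N0 : 0 <= N%:R :> R by [].
have TN : T <= T + N%:R by rewrite lerDl.
have := HB (T + N%:R) (addr_ge0 T0 N0).
rewrite (cint_split T0 TN cf) => HN.
have -> : cintegral `[0, T]%classic f - L = (cintegral `[0, T]%classic f +
  cintegral `[T, (T + N%:R)]%classic f - L) + - cintegral `[T, (T + N%:R)]%classic f by ring.
rewrite (le_trans (ler_normcD _ _))// normc_opp lerD//.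
have cg : continuous (fun x : R => M * (1 + x ^+ 2)^-1).
  by apply: continuous_mul; [exact: continuous_const|exact: continuous_atan_den].
rewrite (le_trans (normc_cint_majorant (g := fun y => M * (1 + y ^+ 2)^-1) cf cg _))//.
  move=> x _; rewrite /f normcM normc_real (le_trans _ (HM x))//.
  by rewrite ler_piMl ?normc_ge0// ler_norml cos_geN1 cos_le1.
rewrite RintegralZl//; last exact: cont_integrable (@continuous_atan_den R).
rewrite Rint_atan// mulrA ler_wpM2l ?mulr_ge0 ?(ltW M0)// lerD2r.
exact: ltW (atan_ltpi2 _).
Qed.

(* [2 n atan (w y / (2 n))] tends to [w y], uniformly for y in [0, T], while
   ((1 - h) / (1 + h)) ^ n with h = a w / (2 n) tends to exp (- a w). *)
Lemma quad_cosine : exists M, forall w T : R, 0 <= w -> 0 <= T ->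
  normc (cintegral `[0, T]%classic (fun y => (cos (w * y))%:C * (quad a y)^-1) -
    (pi / 2)%:C / a * cexp (- (w%:C * a))) <= M * (pi / 2 - atan T).
Proof.
have [M M0 HM] := normc_quadV a0; exists (2 * M) => w T w0 T0.
(* At w = 0 the choice c = w / (2n) would not be positive; the case n = 0, c = 1 of [tail_bound]
   gives the claim directly. *)
move: w0; rewrite le_eqVlt => /predU1P[<-|w0].
  have := tail_bound 0 ltr01 T0 M0 HM; rewrite expr0 mul0r oppr0 cexp0.
  rewrite mulr1 (_ : cintegral _ _ = cintegral `[0, T]%classic
    (fun y => (cos (0 * y))%:C * (quad a y)^-1)) ?mulr1//.
  by apply: eq_cint => y _; rewrite mulr0 !mul0r.
set L := (pi / 2)%:C / a.
have MT : 0 <= M * T by rewrite mulr_ge0// ltW.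
have HMT : forall y : R, normc (quad a y)^-1 <= M.
  move=> y; rewrite (le_trans (HM y))// ler_piMr ?(ltW M0)// invf_le1.
    by rewrite lerDl sqr_ge0.
  by rewrite ltr_pwDl// sqr_ge0.
(* [k1 / n] bounds the change of the integral, through |x - atan x| <= x^3, and [k2 / n] that of the
   limit value, through [cayley_exp]. *)
pose k1 := 2 * (M * T) * (w * T) ^+ 3; pose k2 := normc L * (18 * (w * normc a) ^+ 2).
have M0' := ltW M0; have w0' := ltW w0.
have k10 : 0 <= k1 by rewrite /k1 !mulr_ge0.
have k20 : 0 <= k2 by rewrite /k2 !mulr_ge0 ?normc_ge0// sqr_ge0.
apply: (ler_cvg0D (cvg_harmonicZ (k1 + k2))) => N _.
set n := N.+1; have n1 : 1 <= n%:R :> R by rewrite ler1n.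
have n0 : 0 < n%:R :> R by rewrite ltr0n.
pose c := w / (2 * n%:R).
have c0 : 0 < c by rewrite divr_gt0// mulr_gt0.
have nc : 2 * n%:R * c = w by rewrite /c mulrC divfK// mulf_neq0// gt_eqF.
have H2 := tail_bound n c0 T0 M0 HM.
pose F y : C := (cos (2 * n%:R * atan (c * y)))%:C * (quad a y)^-1.
pose G y : C := (cos (w * y))%:C * (quad a y)^-1.
have cF : ccont F.
  apply: ccontM; last exact: ccont_quadV.
  apply: ccont_real; apply: (continuous_comp_scale (f := fun x => cos (2 * n%:R * atan x))).
  have ca : continuous (fun x : R => 2 * n%:R * atan x).
    by apply: continuous_mul; [exact: continuous_const|move=> x; exact: continuous_atan].
  by move=> x; apply: (continuous_comp (ca x)); exact: continuous_cos.
have cG : ccont G.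
  apply: ccontM; last exact: ccont_quadV.
  by apply: ccont_real; apply: continuous_comp_scale; exact: continuous_cos.
set rho := (1 - c%:C * a) / (1 + c%:C * a) in H2.
have Rec : 0 < complex.Re (c%:C * a) by rewrite cReMl mulr_gt0.
have H3 : normc (L * (rho ^+ n - cexp (- (w%:C * a)))) <= k2 * n%:R^-1.
  rewrite normcM /k2 -mulrA ler_wpM2l ?normc_ge0//.
  have := cayley_exp n Rec; rewrite -/rho.
  have -> : n%:R * (2 * (c%:C * a)) = w%:C * a :> C.
    by rewrite -nc !rmorphM !rmorph_nat /=; ring.
  move=> h; rewrite (le_trans h)// normcM normc_real (ger0_norm (ltW c0)) /c.
  have -> : n%:R * (18 * (w / (2 * n%:R) * normc a) ^+ 2) =
    18 * (w * normc a) ^+ 2 / n%:R / 4.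
    by move: n0; move: (n%:R : R) => m m0; field; rewrite gt_eqF.
  have s0 : 0 <= 18 * (w * normc a) ^+ 2 / n%:R.
    by rewrite divr_ge0 ?(ltW n0)// mulr_ge0// sqr_ge0.
  by rewrite ler_piMr// invf_le1//; lra.
have H1 : normc (cintegral `[0, T]%classic (fun y => G y + -1 * F y)) <= k1 * n%:R^-1.
  have cGF : ccont (fun y => G y + -1 * F y).
    by apply: ccontD => //; apply: ccontM => //; exact: ccont_cst.
  have b y : 0 <= y <= T -> normc (G y + -1 * F y) <= (w * T) ^+ 3 * n%:R^-1 * M.
    move=> /andP[y0 yT]; rewrite /F /G.
    have -> : (cos (w * y))%:C / quad a y + -1 * ((cos (2 * n%:R * atan (c * y)))%:C / quad a y) =
      (cos (w * y) - cos (2 * n%:R * atan (c * y)))%:C * (quad a y)^-1.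
      by rewrite rmorphB /=; ring.
    rewrite normcM ler_pM ?normc_ge0// normc_real (le_trans (cos_lip _ _))//.
    have -> : w * y - 2 * n%:R * atan (c * y) = 2 * n%:R * (c * y - atan (c * y)).
      by rewrite -nc; ring.
    have n20 : 0 < 2 * n%:R :> R by rewrite mulr_gt0.
    rewrite normrM (gtr0_norm n20).
    have cy0 : 0 <= c * y by rewrite mulr_ge0// ltW.
    rewrite (le_trans (ler_wpM2l (ltW n20) (atanB_le cy0)))//.
    have -> : 2 * n%:R * (c * y) ^+ 3 = (w * y) ^+ 3 * n%:R^-1 * (n%:R^-1 / 4).
      by rewrite /c; move: n0; move: (n%:R : R) => m m0; field; rewrite gt_eqF.
    rewrite -[leRHS]mulr1 ler_pM ?mulr_ge0 ?exprn_ge0 ?invr_ge0 ?mulr_ge0 ?(ltW w0) ?(ltW n0)//.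
      rewrite ler_wpM2r ?invr_ge0 ?(ltW n0)// lerXn2r ?nnegrE ?mulr_ge0 ?(ltW w0)//.
      by rewrite ler_wpM2l// ltW.
    by rewrite mulr_ile1 ?invr_ge0 ?(ltW n0)// invf_le1//; lra.
  rewrite (le_trans (normc_cint_bound T0 cGF b))// /k1 subr0.
  by rewrite le_eqVlt; apply/orP; left; apply/eqP; ring.
rewrite cintD// in H1; last by apply: ccontM => //; exact: ccont_cst.
rewrite cintZ// in H1.
set IG := cintegral _ G in H1; set IF := cintegral _ F in H1.
rewrite -/IF in H2; rewrite -/IG.
have -> : IG - L * cexp (- (w%:C * a)) = (IG + -1 * IF) + (IF - L * rho ^+ n) +
   L * (rho ^+ n - cexp (- (w%:C * a))) by ring.
rewrite (le_trans (ler_normcD _ _))// (le_trans (lerD (ler_normcD _ _) (lexx _)))//.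
by rewrite [(k1 + k2) / _]mulrDl [leRHS]addrAC; exact: lerD (lerD H1 H2) H3.
Qed.

End Fixed.
End ExponentialLimit.

(** * The smoothing spline kernel as a cosine transform *)

Section SmoothingKernel.
Variable R : realType.
Local Notation C := R[i].
Local Notation mu := (@lebesgue_measure R).
Variables (q : nat) (q0 : (0 < q)%N).

Definition ss_angle (j : nat) : R := pi * (2 * j + 1)%:R / (2 * q)%:R.
(** For j < q, the square roots with positive real part of the negatives of the q-th roots of -1, so
    that 1 + y^(2q) is the product of the y^2 + ss_root(j)^2. *)
Definition ss_root (j : nat) : C := - 'i%C * cis (ss_angle j).

Let qR : (2 * q)%:R != 0 :> R. Proof. by rewrite pnatr_eq0 muln_eq0 negb_or -!lt0n. Qed.

Let q_neq0 : q%:R != 0 :> R. Proof. by rewrite pnatr_eq0 -lt0n. Qed.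

Let cis_odd_pi (j : nat) : cis (pi * (2 * j + 1)%:R) = -1 :> C.
Proof.
have -> : pi * (2 * j + 1)%:R = - (2 * pi * (0 + (- j%:Z)%:~R)) + pi :> R.
  by rewrite natrD natrM mulrNz add0r; ring.
rewrite cisD cis_shift mulr0 oppr0 cis0 mul1r /cis sinpi cospi.
by apply: complex_eqP => /=; rewrite ?oppr0.
Qed.

Lemma Re_ss_root j : (j < q)%N -> 0 < complex.Re (ss_root j).
Proof.
move=> jq; have -> : complex.Re (ss_root j) = sin (ss_angle j).
  by rewrite /ss_root cReM /=; ring.
have p0 := pi_gt0 R.
apply: sin_gt0_pi; rewrite /ss_angle !mulr_gt0 ?invr_gt0 ?ltr0n ?muln_gt0 ?addn1//=.
rewrite -addn1.
rewrite ltr_pdivrMr ?ltr0n ?muln_gt0// ltr_pM2l// ltr_nat; lia.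
Qed.

Lemma ss_root_sqr j : ss_root j ^+ 2 = - cis (2 * ss_angle j).
Proof.
rewrite /ss_root exprMn sqrrN sqr_i mulN1r; congr (- _).
by rewrite (cisMn _ 2).
Qed.

Let x_ j : C := cis (2 * ss_angle j).

Let x_pow j : x_ j ^+ q = -1.
Proof.
rewrite /x_ -cisMn -(cis_odd_pi j); congr cis.
by rewrite /ss_angle natrM; field; rewrite q_neq0.
Qed.

Let x_inj i j : (i < j < q)%N -> x_ i != x_ j.
Proof.
move=> /andP[ij jq]; have qp : 0 < q%:R :> R by rewrite ltr0n.
have z1 : zu ((j - i)%N%:R / q%:R) != 1 :> C.
  apply: cis_neq1; rewrite divr_gt0 ?ltr0n ?subn_gt0//=.
  rewrite ltr_pdivrMr// mul1r ltr_nat; lia.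
apply: contraNneq z1 => xx.
rewrite /zu (_ : - _ = 2 * ss_angle i - 2 * ss_angle j); last first.
  have odd_natE m : (2 * m + 1)%:R = 2 * m%:R + 1 :> R by rewrite natrD natrM.
  by rewrite /ss_angle natrB ?(ltnW ij)// !odd_natE [(2 * q)%:R]natrM; field.
by rewrite cisD -[cis (2 * _)]/(x_ i) xx -cisD subrr cis0.
Qed.

Let rs : seq C := [seq x_ j | j <- iota 0 q].

Let uniq_rs : uniq rs.
Proof.
rewrite map_inj_in_uniq ?iota_uniq// => i j; rewrite !mem_iota /= !add0n => iq jq xx.
case: (ltngtP i j) => // h.
  by have := @x_inj i j; rewrite h jq xx eqxx => /(_ isT).
by have := @x_inj j i; rewrite h iq xx eqxx => /(_ isT).
Qed.

Let size_X : size ('X^q + 1 : {poly C}) = q.+1.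
Proof. by rewrite size_polyDl size_polyXn// size_poly1 ltnS. Qed.

Let XE : 'X^q + 1 = 1 *: \prod_(r <- rs) ('X - r%:P) :> {poly C}.
Proof.
have lc : lead_coef ('X^q + 1 : {poly C}) = 1.
  by rewrite lead_coefDl ?lead_coefXn// size_polyXn size_poly1 ltnS.
rewrite -[in RHS]lc; apply: all_roots_prod_XsubC.
- by rewrite size_X size_map size_iota.
- apply/allP => z /mapP[j _ ->]; rewrite rootE hornerD hornerXn hornerC x_pow.
  by rewrite addNr.
- by rewrite uniq_rootsE; exact: uniq_rs.
Qed.

(** The residue of 1 / (s^q + 1) at a root x is 1 / (q x^(q-1)) = - x / q, because x^q = -1. *)
Lemma lorentz_partial_fractions (y : R) : (lorentz q y)%:C =
  \sum_(j < q) ss_root j ^+ 2 / q%:R * (quad (ss_root j) y)^-1.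
Proof.
have qE j : quad (ss_root j) y = (y ^+ 2)%:C - x_ j by rewrite /quad ss_root_sqr.
have yrs : (y ^+ 2)%:C \notin rs.
  apply/negP => /mapP[j]; rewrite mem_iota /= add0n => jq E.
  by have := quad_neq0 (Re_ss_root jq) y; rewrite qE E subrr eqxx.
have s0 : (0 < size rs)%N by rewrite size_map size_iota.
have PF : ('X^q + 1 : {poly C}).[(y ^+ 2)%:C]^-1 =
    \sum_(r <- rs) (('X^q + 1 : {poly C})^`().[r])^-1 / ((y ^+ 2)%:C - r).
  by rewrite XE; exact: partial_fractions.
move: PF.
have -> : ('X^q + 1 : {poly C}).[(y ^+ 2)%:C]^-1 = (lorentz q y)%:C.
  rewrite /lorentz fmorphV; congr (_^-1); rewrite hornerD hornerXn hornerC.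
  by rewrite exprM [RHS]rmorphD rmorph1 [in RHS]rmorphXn [RHS]addrC.
move=> ->; rewrite big_map (_ : iota 0 q = index_iota 0 q) ?big_mkord; last first.
  by rewrite /index_iota subn0.
apply: eq_bigr => j _; rewrite -qE; congr (_ * _).
rewrite derivD derivXn derivC addr0 hornerMn hornerXn ss_root_sqr -/(x_ j).
have x0 : x_ j != 0 by exact: cis_neq0.
have qc : q%:R != 0 :> C by rewrite pnatr_eq0 -lt0n.
apply: (canRL (mulfK qc)); rewrite -mulr_natr invfM -mulrA mulVf// mulr1.
apply: (mulfI (expf_neq0 q.-1 x0)); rewrite mulfV ?expf_neq0//.
by rewrite mulrN -exprSr prednK// x_pow opprK.
Qed.

Lemma KssE (x t : R) : pi%:C * Kss q x t =
  \sum_(j < q) ss_root j ^+ 2 / q%:R *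
    ((pi / 2)%:C / ss_root j * cexp (- (`|x - t|%:C * ss_root j))).
Proof.
rewrite /Kss mulr_sumr; apply: eq_bigr => j _.
have qc : q%:R != 0 :> C by rewrite pnatr_eq0 -lt0n.
have nat_C n : n%:R = (n%:R : R)%:C :> C by rewrite rmorph_nat.
have -> : cexp (pi%:C * 'i%C * (2 * j + 1)%:R / (2 * q)%:R) = cis (ss_angle j) :> C.
  rewrite -cexp_i; congr cexp; rewrite /ss_angle !rmorphM fmorphV !rmorph_nat /=.
  by rewrite -!mulrA mulrCA.
have -> : cexp ('i%C * pi%:C * (2 * q - 1)%:R * (2 * j + 1)%:R / (2 * q)%:R) =
    - cis (- ss_angle j) :> C.
  (* (2q - 1) times the angle differs from minus the angle by an odd multiple of pi; hence the
     sign. *)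
  have E : (2 * q - 1)%:R * ss_angle j = - ss_angle j + pi * (2 * j + 1)%:R.
    by rewrite /ss_angle natrB ?muln_gt0//; move: qR; move: ((2 * q)%:R : R) => Q Q0; field.
  rewrite -[RHS]mulrN1 -(cis_odd_pi j) -cisD -E -cexp_i; congr cexp.
  rewrite /ss_angle !rmorphM fmorphV !rmorph_nat /=; ring.
have e0 : cis (ss_angle j) != 0 :> C by exact: cis_neq0.
rewrite -cisV /ss_root.
have -> : - (`|x - t|%:C * (- 'i%C * cis (ss_angle j))) =
  'i%C * `|x - t|%:C * cis (ss_angle j) by ring.
rewrite [(pi / 2)%:C]rmorphM fmorphV rmorph_nat /=.
have i0 : 'i%C != 0 :> C by rewrite -normc_gt0 /normc /= expr0n add0r expr1n sqrtr1.
rewrite natrM; move: (cexp _) => E; move: (cis _) e0 => e e0.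
rewrite !exprMn sqrrN.
by field; rewrite e0 i0 qc.
Qed.

(** The error is uniform in x and t and has the form of the tail of 1 / (1 + y^2), the same form as
    for the improper integral in [K2]. *)
Lemma lorentz_cosine : exists M, forall x t T : R, 0 <= T ->
  normc ((\int[mu]_(y in `[0, T]%classic) (cos (`|x - t| * y) * lorentz q y))%:C -
    pi%:C * Kss q x t) <= M * (pi / 2 - atan T).
Proof.
have /choice[M HM] : forall j : 'I_q, exists M, forall w T : R, 0 <= w -> 0 <= T ->
    normc (cintegral `[0, T]%classic (fun y => (cos (w * y))%:C * (quad (ss_root j) y)^-1) -
    (pi / 2)%:C / ss_root j * cexp (- (w%:C * ss_root j))) <= M * (pi / 2 - atan T).
  by move=> j; exact: quad_cosine (Re_ss_root (ltn_ord j)).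
exists (\sum_(j < q) normc (ss_root j ^+ 2 / q%:R) * M j) => x t T T0.
set w := `|x - t|; have w0 : 0 <= w by exact: normr_ge0.
pose f j (y : R) : C := (cos (w * y))%:C * (quad (ss_root j) y)^-1.
have cf (j : 'I_q) : ccont (f j).
  apply: ccontM; last exact: ccont_quadV (Re_ss_root (ltn_ord j)).
  by apply: ccont_real; apply: continuous_comp_scale; exact: continuous_cos.
have -> : (\int[mu]_(y in `[0, T]%classic) (cos (w * y) * lorentz q y))%:C =
    cintegral `[0, T]%classic (fun y => \sum_(j < q) ss_root j ^+ 2 / q%:R * f j y).
  transitivity (cintegral `[0, T]%classic (fun y => (cos (w * y) * lorentz q y)%:C : C)).
    by apply: complex_eqP => //=; rewrite /Rintegral integral0.
  apply: eq_cint => y _; rewrite rmorphM /= lorentz_partial_fractions mulr_sumr.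
  by apply: eq_bigr => j _; rewrite mulrCA.
rewrite cint_sum => [|j]; last by apply: ccontM; [exact: ccont_cst|exact: cf].
rewrite KssE -sumrB mulr_suml (le_trans (ler_normc_sum _ _ _))//.
apply: ler_sum => j _; rewrite cintZ// -mulrBr normcM -[leRHS]mulrA.
by rewrite ler_wpM2l ?normc_ge0//; exact: HM.
Qed.

End SmoothingKernel.

(** * Large bandwidths *)

Section TailIntegral.
Variable R : realType.
Local Notation mu := (@lebesgue_measure R).

Lemma atan_den_ge0 (x : R) : 0 <= (1 + x ^+ 2)^-1.
Proof. by rewrite invr_ge0 addr_ge0// sqr_ge0. Qed.

Lemma integral_atan_tail (T : R) :
  (\int[mu]_(x in `[T, +oo[%classic) ((1 + x ^+ 2)^-1)%:E = (pi / 2 - atan T)%:E)%E.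
Proof.
rewrite (@ge0_continuous_FTC2y _ _ (@atan R) _ (pi / 2)) ?EFinB//.
- by move=> x _; exact: atan_den_ge0.
- by apply: continuous_subspaceT; exact: continuous_atan_den.
- exact: cvgy_atan.
- by apply: cvg_at_right_filter; exact: continuous_atan.
- by move=> x _; rewrite derive1_atan.
Qed.

Lemma integrable_atan_tail (T : R) :
  mu.-integrable `[T, +oo[%classic (EFin \o (fun x : R => (1 + x ^+ 2)^-1)).
Proof.
apply/integrableP; split.
  apply/measurable_EFinP; apply: measurable_funTS.
  by apply: continuous_measurable_fun; exact: continuous_atan_den.
under eq_integral do rewrite /= ger0_norm ?atan_den_ge0//.
by rewrite integral_atan_tail ltry.
Qed.

Lemma integrable_atan_tailZ (C T : R) :
  mu.-integrable `[T, +oo[%classic (EFin \o (fun x : R => C * (1 + x ^+ 2)^-1)).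
Proof. by have := integrable_atan_tail T; apply: integrableZl. Qed.

Lemma integrable_tail (f : R -> R) C T : continuous f ->
  (forall x, T <= x -> `|f x| <= C * (1 + x ^+ 2)^-1) ->
  mu.-integrable `[T, +oo[%classic (EFin \o f).
Proof.
move=> cf fC.
apply: (le_integrable _ _ _ (integrable_atan_tailZ C T)) => //.
  apply/measurable_EFinP; apply: measurable_funTS.
  exact: continuous_measurable_fun.
move=> x; rewrite /= in_itv /= andbT => Tx.
by rewrite lee_fin (le_trans (fC x Tx))// ler_norm.
Qed.

Lemma Rint_tail_bound (f : R -> R) C T : continuous f ->
  (forall x, T <= x -> `|f x| <= C * (1 + x ^+ 2)^-1) ->
  `|\int[mu]_(x in `[T, +oo[%classic) f x| <= C * (pi / 2 - atan T).
Proof.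
move=> cf fC; have If := integrable_tail cf fC.
have I := integrable_atan_tail T.
rewrite (le_trans (le_normr_Rintegral _ If))//.
have -> : C * (pi / 2 - atan T) = \int[mu]_(x in `[T, +oo[%classic) (C * (1 + x ^+ 2)^-1).
  by rewrite RintegralZl// /Rintegral integral_atan_tail.
apply: le_Rintegral => //.
- exact: (integrable_norm If).
- exact: integrable_atan_tailZ.
by move=> x; rewrite /= in_itv /= andbT; exact: fC.
Qed.

Lemma Rint_tail_split (f : R -> R) C a T : a <= T -> continuous f ->
  (forall x, a <= x -> `|f x| <= C * (1 + x ^+ 2)^-1) ->
  `|\int[mu]_(x in `[a, +oo[%classic) f x - \int[mu]_(x in `[a, T]%classic) f x| <=
  C * (pi / 2 - atan T).
Proof.
move=> aT cf fC; have If := integrable_tail cf fC.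
have fT x : T <= x -> `|f x| <= C * (1 + x ^+ 2)^-1 by move=> /(le_trans aT); exact: fC.
rewrite (Rintegral_itvB If)//.
rewrite Rintegral_itv_obnd_cbnd; first exact: Rint_tail_bound.
apply: integrableS (integrable_tail cf fT) => //.
by apply: subset_itvr; rewrite bnd_simp.
Qed.

End TailIntegral.

(** * Splines and penalty at low frequency *)

Section LowFrequency.
Variable R : realType.
Local Notation C := R[i].
Variables (q : nat) (q0 : (0 < q)%N).
Variables (u : R) (u02 : 0 <= u <= 2^-1).

Let q20 : (0 < 2 * q)%N. Proof. by rewrite muln_gt0. Qed.

Let u01 : 0 <= u <= 1.
Proof. by case/andP: u02 => -> ? /=; lra. Qed.

Let s : R := sinc (pi * u) ^+ (2 * q).
Let Q1 : R := Qc q u.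
Let Q2 : R := Qc (2 * q) u.
(** One error for both Q's: [Qsum_tail] gives 8^q u^(2q) for [Q1] and 8^(2q) u^(4q) for [Q2], and
    both are at most this. *)
Let e : R := 8 ^+ (2 * q) * u ^+ (2 * q).

Let u2q0 : 0 <= u ^+ (2 * q). Proof. exact: even_pow_ge0. Qed.

Let s_ge0 : 0 <= s. Proof. exact: sinc_even_ge0. Qed.

Let s_le1 : s <= 1.
Proof. by rewrite /s exprM exprn_ile1 ?sqr_ge0// sinc_sqr_le1. Qed.

Let s_lower : (3 ^+ (2 * q))^-1 <= s.
Proof.
have := sinc_ge_third u02 => h; rewrite /s -exprVn lerXn2r ?nnegrE ?invr_ge0//.
by rewrite (le_trans _ h)// invr_ge0.
Qed.

Let Q1_near : s <= Q1 <= s + e.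
Proof.
rewrite /Q1 QcE//; apply/andP; split; first exact: Qsum_ge_term.
rewrite -lerBlDl (le_trans (Qsum_tail q0 u02))//.
rewrite /e ler_wpM2r// ler_eXn2l ?ltr1n// leq_pmull//.
Qed.

Let Q2_near : s ^+ 2 <= Q2 <= s ^+ 2 + e.
Proof.
have sE : s ^+ 2 = sinc (pi * u) ^+ (2 * (2 * q)).
  by rewrite /s -exprM mulnC.
rewrite /Q2 QcE// sE; apply/andP; split; first exact: Qsum_ge_term.
rewrite -lerBlDl (le_trans (Qsum_tail q20 u02))//.
rewrite /e ler_wpM2l ?exprn_ge0// (mulnC 2 (2 * q)) exprM expr2 ler_piMr//.
by case/andP: u01 => *; rewrite exprn_ile1.
Qed.

Let Q2_gt0 : 0 < Q2. Proof. exact: Qc_gt0. Qed.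

Let Q2V_le : Q2^-1 <= 3 ^+ (4 * q).
Proof.
rewrite -[leRHS]invrK lef_pV2 ?posrE ?invr_gt0 ?exprn_gt0//.
by have := Qc_lower q20 u; rewrite mulnA.
Qed.

Let Phi_near X :
  normc (Phi (deg q) (X + q%:R) (zu u) - s%:C * cis (- (2 * pi * u * X))) <= e.
Proof.
rewrite (le_trans (Phi_near_term q0 u01 X))// -QcE//.
by case/andP: Q1_near => _; rewrite -lerBlDl.
Qed.

(** Replacing each of the two splines by s times its exponential, and Q_(2p) by s^2, costs [e] three
    times; the division by Q_(2p) costs 3^(4q). *)
Lemma phi_prod_near X T :
  normc (phi_prod q X T u - cis (2 * pi * u * (T - X))) <=
  3 * 8 ^+ (2 * q) * 3 ^+ (4 * q) * u ^+ (2 * q).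
Proof.
set f := Phi (deg q) (X + q%:R) (zu u); set g := Phi (deg q) (T + q%:R) (zu u).
set ef := cis (- (2 * pi * u * X)) : C; set eg := cis (- (2 * pi * u * T)) : C.
have Eo : cis (2 * pi * u * (T - X)) = ef * eg^-1.
  by rewrite /ef /eg cisV opprK -cisD; congr cis; ring.
have Q2c : Q2%:C != 0 :> C by rewrite fmorph_eq0 gt_eqF.
have E : phi_prod q X T u - cis (2 * pi * u * (T - X)) =
    ((f - s%:C * ef) * Num.conj g + s%:C * ef * Num.conj (g - s%:C * eg) +
     (s ^+ 2 - Q2)%:C * (ef * eg^-1)) * Q2%:C^-1.
  rewrite Eo /phi_prod -/f -/g -/Q2.
  have -> : Num.conj (g - s%:C * eg) = Num.conj g - s%:C * eg^-1.
    rewrite rmorphB rmorphM /= /eg cisV; congr (_ - _ * _).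
      by rewrite conjCE conjc_real.
    by rewrite conjCE -cisN.
  have -> : (s ^+ 2 - Q2)%:C = s%:C ^+ 2 - Q2%:C :> C by rewrite rmorphB [in LHS]rmorphXn.
  move: (eg^-1) (Num.conj g) Q2c; move: (s%:C : C) (Q2%:C : C) => a b c h b0.
  by field.
have n1 : normc (ef * eg^-1) = 1.
  by rewrite /ef /eg cisV -cisD normc_cis.
have cj (z : C) : normc (Num.conj z) = normc z by rewrite conjCE normcJ.
have Q2V : normc (Q2%:C^-1 : C) = Q2^-1 by rewrite normcV normc_real gtr0_norm.
rewrite E normcM Q2V.
have -> : 3 * 8 ^+ (2 * q) * 3 ^+ (4 * q) * u ^+ (2 * q) = (e + e + e) * 3 ^+ (4 * q).
  by rewrite /e; ring.
rewrite ler_pM ?normc_ge0 ?invr_ge0 ?(ltW Q2_gt0)//.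
rewrite (le_trans (ler_normcD _ _))// (le_trans (lerD (ler_normcD _ _) (lexx _)))//.
rewrite lerD// ?lerD//.
- rewrite normcM cj -[leRHS]mulr1 ler_pM ?normc_ge0 ?Phi_near//.
  exact: normc_Phi_le1.
- rewrite normcM cj normcM normc_real (ger0_norm s_ge0) normc_cis mulr1.
  by rewrite -[leRHS]mul1r ler_pM ?normc_ge0// Phi_near.
- rewrite normcM n1 mulr1 normc_real ler_norml.
  by case/andP: Q2_near => h1 h2; apply/andP; split; lra.
Qed.

Lemma pen_sinc : pen q u = (2 * u) ^+ (2 * q) * (s * Q1 / Q2).
Proof.
transitivity ((2 * u * sinc (pi * u)) ^+ (2 * q) * (Q1 / Q2)); last first.
  by rewrite exprMn -/s !mulrA.
rewrite /pen -exprMn; congr (_ ^+ _ * _); rewrite /sinc.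
have p0 := pi_gt0 R; rewrite mulf_eq0 (gt_eqF p0) /=.
have [->|u_neq0] := eqVneq u 0; first by rewrite !mulr0 sin0 mulr0 mul0r.
by move: (sin _) p0 => S; move: (@pi R) => P P0; field; rewrite u_neq0 gt_eqF.
Qed.

Lemma pen_near :
  `|pen q u - (2 * u) ^+ (2 * q)| <=
  2 * 8 ^+ (2 * q) * 3 ^+ (4 * q) * u ^+ (2 * q) * (2 * u) ^+ (2 * q).
Proof.
rewrite pen_sinc -[X in _ - X]mulr1 -mulrBr normrM.
rewrite (ger0_norm (even_pow_ge0 q (2 * u))) mulrC ler_wpM2r ?even_pow_ge0//.
have -> : s * Q1 / Q2 - 1 = (s * (Q1 - s) + (s ^+ 2 - Q2)) / Q2.
  by field; rewrite gt_eqF.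
rewrite normrM normfV (gtr0_norm Q2_gt0).
have -> : 2 * 8 ^+ (2 * q) * 3 ^+ (4 * q) * u ^+ (2 * q) = (e + e) * 3 ^+ (4 * q).
  by rewrite /e; ring.
rewrite ler_pM ?invr_ge0 ?(ltW Q2_gt0)// (le_trans (ler_normD _ _))// lerD//.
  case/andP: Q1_near => h1 h2; rewrite ger0_norm ?mulr_ge0 ?subr_ge0//.
  rewrite -[leRHS]mul1r ler_pM ?subr_ge0//; lra.
by rewrite ler_norml; case/andP: Q2_near => h1 h2; apply/andP; split; lra.
Qed.

(** Used to divide an error proportional to (2u)^(2q) by 1 + k^(2q) [pen]. The constant collects the
    lower bounds 3^(-2q) of s and of [Q1]. *)
Lemma pen_lower : (2 * u) ^+ (2 * q) <= 3 ^+ (4 * q) * pen q u.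
Proof.
rewrite pen_sinc mulrCA -[leLHS]mulr1 ler_wpM2l ?even_pow_ge0//.
have Q1l : (3 ^+ (2 * q))^-1 <= Q1 by exact: Qc_lower.
have Q2l : Q2 <= 1 by exact: Qc_le1.
have p3 : 0 < 3 ^+ (2 * q) :> R by rewrite exprn_gt0.
rewrite mulrA ler_pdivlMr// mul1r (le_trans Q2l)//.
have -> : 3 ^+ (4 * q) = 3 ^+ (2 * q) * 3 ^+ (2 * q) :> R by rewrite -exprD -mulnDl.
rewrite mulrACA -[leLHS]mulr1 ler_pM//.
  by rewrite mulrC -ler_pdivrMr// mul1r.
by rewrite mulrC -ler_pdivrMr// mul1r.
Qed.

End LowFrequency.

(** * The case k_q >= 1 *)

Section LargeBandwidth.
Variable R : realType.
Local Notation C := R[i].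
Local Notation mu := (@lebesgue_measure R).
Variables (q K : nat) (q0 : (0 < q)%N) (K0 : (0 < K)%N) (lambda : R) (l0 : 0 <= lambda).
Local Notation k := (kq q K lambda).
Hypothesis k1 : 1 <= k.

Let k0 : 0 < k. Proof. exact: lt_le_trans k1. Qed.

Let k_neq0 : k != 0. Proof. by rewrite gt_eqF. Qed.

Let kV0 : 0 < k^-1. Proof. by rewrite invr_gt0. Qed.

Let p0 : 0 < pi :> R. Proof. exact: pi_gt0. Qed.

Let p_neq0 : pi != 0 :> R. Proof. by rewrite gt_eqF. Qed.

Let half0 : 0 <= k / 2. Proof. by rewrite divr_ge0// ltW. Qed.

Let e2 (y : R) : 0 <= y ^+ (2 * q). Proof. exact: even_pow_ge0. Qed.

Let kpow : 0 < k ^+ (2 * q). Proof. by rewrite exprn_gt0. Qed.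

Let Kl : K%:R * lroot q lambda = k / pi.
Proof. by rewrite /kq [RHS]mulrAC mulfK// mulrC. Qed.

Definition scaled_density (x t v : R) : C :=
  phi_prod q (k / pi * x) (k / pi * t) (k^-1 * v) / (1 + k ^+ (2 * q) * pen q (k^-1 * v))%:C.

Lemma ccont_scaled_density x t : ccont (scaled_density x t).
Proof.
apply: (ccont_scale (f := fun u => phi_prod q (k / pi * x) (k / pi * t) u /
   (1 + k ^+ (2 * q) * pen q u)%:C)).
by apply: ccontM; [exact: ccont_phi_prod|exact: ccont_pen_den].
Qed.

(** Hermitian symmetry reduces the integral to [0, 1/2], and u = v / k_q stretches this to
    [0, k_q / 2]; the prefactor becomes K lambda^(1/(2q)) / k_q = 1 / pi. *)
Lemma kernel_scaled x t :
  (cst2 q K lambda)%:C * eqkernel q K lambda (cst2 q K lambda * x) (cst2 q K lambda * t) =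
  (pi^-1 * complex.Re (cintegral `[0, (k / 2)]%classic (fun v => 2 * scaled_density x t v)))%:C.
Proof.
have E y : K%:R * (bandwidth q K lambda * (cst2 q K lambda * y)) = k / pi * y.
  rewrite [bandwidth _ _ _ * _]mulrA [bandwidth _ _ _ * _]mulrC cst2_bandwidth// mulrA.
  by rewrite Kl.
rewrite -kernel_phi_prod Wker_phi_prod// !E cst2_bandwidth//.
set f := fun u => _ : C.
have cf : ccont f by apply: ccontM; [exact: ccont_phi_prod|exact: ccont_pen_den].
rewrite cint_hermitian//; last first.
  move=> u; rewrite /f phi_prod_onem// pen_onem//.
  move: (phi_prod _ _ _ _) (1 + _) => g D.
  have DE : D%:C^-1 = (D^-1)%:C :> C by rewrite fmorphV.
  by rewrite DE; case: g => b c; apply: complex_eqP => /=; ring.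
have c2f : ccont (fun u => 2 * f u) by apply: ccontM => //; exact: ccont_cst.
have h0 : 0 <= 2^-1 :> R by rewrite invr_ge0.
rewrite (cint_scale h0 kV0 c2f) invrK [2^-1 * k]mulrC cReMl.
rewrite mulrA -!rmorphM /=; congr (_%:C); rewrite mulrA; congr (_ * _).
by rewrite [lroot _ _ * _]mulrC Kl mulrAC mulfV// mul1r.
Qed.

Lemma oscE (x t v : R) : osc x t v = cis (2 * v * (t - x)).
Proof.
rewrite -cexp_i /osc; congr cexp.
have -> : (2 * v * (t - x))%:C = 2 * v%:C * (t - x)%:C :> C by rewrite !rmorphM rmorph_nat.
by move: (_%:C : C) (_%:C : C) => a b; ring.
Qed.

Lemma ccont_osc (x t : R) : ccont (osc x t).
Proof.
apply: (ccont_ext _ (ccont_cis (2 * (t - x)))) => v; rewrite oscE; congr cis; ring.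
Qed.

Definition defect (x t v : R) : C :=
  scaled_density x t v - osc x t v * (lorentz q (2 * v))%:C.

Let continuous_lorentz2 : continuous (fun v : R => lorentz q (2 * v)).
Proof. by apply: continuous_comp_scale; exact: continuous_lorentz. Qed.

Let ccont_osc_lorentz x t : ccont (fun v : R => osc x t v * (lorentz q (2 * v))%:C).
Proof.
by apply: ccontM; [exact: ccont_osc|apply: ccont_real; exact: continuous_lorentz2].
Qed.

Lemma ccont_defect x t : ccont (defect x t).
Proof.
apply: (ccont_ext (f := fun v => scaled_density x t v +
  -1 * (osc x t v * (lorentz q (2 * v))%:C))).
  by move=> v; rewrite mulN1r.
apply: ccontD; first exact: ccont_scaled_density.
by apply: ccontM; [exact: ccont_cst|exact: ccont_osc_lorentz].
Qed.

(** 1 + r_q = (1 + r_2) / (1 + r_1), so multiplying by the main term gives the exact density, and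
    r_q alone gives the difference of the two. *)
Lemma rq_defect x t v : 0 <= v <= k / 2 ->
  2 * osc x t v / (pi * (1 + (2 * v) ^+ (2 * q)))%:C * rq q K lambda x t v =
  (2 / pi)%:C * defect x t v.
Proof.
move=> /andP[v0 v2].
have KR0 : 0 < K%:R :> R by exact: K_gt0.
have vK : 0 <= K%:R * v / k <= K%:R.
  have vk : v <= k by rewrite (le_trans v2)// ler_pdivrMr// ler_peMr ?(ltW k0)// ler1n.
  apply/andP; split; first exact: divr_ge0 (mulr_ge0 (ltW KR0) v0) (ltW k0).
  rewrite ler_pdivrMr//; exact: ler_wpM2l (ltW KR0) _ _ vk.
have vE : K%:R * v / k / K%:R = k^-1 * v by rewrite mulrC !mulrA mulVf ?gt_eqF// mul1r mulrC.
have Ky y : K%:R * (lroot q lambda * y) = k / pi * y by rewrite mulrA Kl.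
rewrite /rq /r2 /r1 phi_mul// lambda_penal// vE !Ky /defect /scaled_density.
have o0 : osc x t v != 0 by rewrite oscE cis_neq0.
rewrite /lorentz; have := lorentz_den_gt0 q (2 * v); have := pen_den_gt0 K q0 lambda (k^-1 * v).
move: (phi_prod _ _ _ _) (osc _ _ _) o0 => f o o0.
move: (1 + k ^+ _ * _) (1 + (2 * v) ^+ _) => B A B0 A0.
have A1 : A%:C != 0 :> C by rewrite fmorph_eq0 gt_eqF.
have B1 : B%:C != 0 :> C by rewrite fmorph_eq0 gt_eqF.
have P1 : pi%:C != 0 :> C by rewrite fmorph_eq0.
have -> : 1 + (B / A - 1) = B / A by rewrite addrC subrK.
have -> : (B / A - 1)%:C = B%:C / A%:C - 1 :> C by rewrite rmorphB rmorphM fmorphV rmorph1.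
have -> : (B / A)%:C = B%:C / A%:C :> C by rewrite rmorphM fmorphV.
have -> : (pi * A)%:C = pi%:C * A%:C :> C by rewrite rmorphM.
have -> : (A^-1)%:C = A%:C^-1 :> C by rewrite fmorphV.
have -> : (2 / pi)%:C = 2 / pi%:C :> C by rewrite rmorphM fmorphV rmorph_nat.
move: A1 B1 P1; move: (A%:C : C) (B%:C : C) (pi%:C : C) => a b P a1 b1 P1.
by field; rewrite a1 b1 P1 o0.
Qed.

Lemma cos_normM (a b : R) : cos (`|a| * b) = cos (a * b).
Proof.
have [h|h] := leP 0 a; first by rewrite ger0_norm.
by rewrite ltr0_norm// mulNr cosN.
Qed.

Lemma Re_osc_lorentz x t :
  complex.Re (cintegral `[0, (k / 2)]%classic (fun v => 2 * (osc x t v * (lorentz q (2 * v))%:C))) =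
  \int[mu]_(y in `[0, k]%classic) (cos (`|x - t| * y) * lorentz q y).
Proof.
have cg : continuous (fun y => cos (`|x - t| * y) * lorentz q y).
  apply: continuous_mul; last exact: continuous_lorentz.
  by apply: continuous_comp_scale; exact: continuous_cos.
have h2 : 0 < 2 :> R by [].
rewrite (Rint_scale (ltW k0) h2 cg) cintZ//.
have -> : 2 = (2 : R)%:C :> C by rewrite rmorph_nat.
rewrite cReMl; congr (_ * _).
transitivity (\int[mu]_(v in `[0, (k / 2)]%classic) complex.Re (osc x t v * (lorentz q (2 * v))%:C)).
  by [].
apply: eq_Rintegral => v _; rewrite cReM oscE mulr0 subr0 [complex.Re _%:C]/=; congr (_ * _).
rewrite /cis [LHS]/=.
by rewrite distrC cos_normM; congr cos; ring.
Qed.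

Definition tail_density (x t u : R) : R :=
  cos (k * u * (t - x)) / (pi * (k ^- (2 * q) + u ^+ (2 * q))).

Let tail_den_gt0 (u : R) : 0 < k ^- (2 * q) + u ^+ (2 * q).
Proof. by rewrite ltr_pwDl ?e2// invr_gt0. Qed.

Lemma tail_densityE x t u : tail_density x t u =
  k ^+ (2 * q) / pi * (cos (`|x - t| * (k * u)) * lorentz q (k * u)).
Proof.
rewrite distrC cos_normM /tail_density /lorentz [(k * u) ^+ _]exprMn.
have -> : (t - x) * (k * u) = k * u * (t - x) by ring.
have := tail_den_gt0 u; move: (cos _) => c; move: (k ^+ _) (u ^+ _) kpow => a b a0.
have a1 : a != 0 by rewrite gt_eqF.
have -> : 1 + a * b = a * (a^-1 + b) by rewrite mulrDr mulfV.
move: (a^-1 + b) => d d0; move: p0; move: (@pi R) => P P0.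
by field; rewrite a1 !gt_eqF.
Qed.

Lemma continuous_cos_lorentz (w : R) : continuous (fun y : R => cos (w * y) * lorentz q y).
Proof.
apply: continuous_mul; last exact: continuous_lorentz.
by apply: continuous_comp_scale; exact: continuous_cos.
Qed.

Lemma continuous_tail_density x t : continuous (tail_density x t).
Proof.
have -> : tail_density x t = fun u =>
    k ^+ (2 * q) / pi * (cos (`|x - t| * (k * u)) * lorentz q (k * u)).
  by apply/funext => u; exact: tail_densityE.
apply: continuous_mul; first exact: continuous_const.
apply: (continuous_comp_scale (f := fun y => cos (`|x - t| * y) * lorentz q y)).
exact: continuous_cos_lorentz.
Qed.

Lemma tail_density_bound x t u : 1 <= u -> `|tail_density x t u| <= 2 / pi * (1 + u ^+ 2)^-1.
Proof.
move=> u1; have u0 : 0 < u by exact: lt_le_trans u1.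
have v0 : 0 < 1 + u ^+ 2 by rewrite ltr_pwDl// sqr_ge0.
have uu : u ^+ 2 <= u ^+ (2 * q) by rewrite ler_weXn2l// leq_pmulr.
have u21 : 1 <= u ^+ 2 by rewrite exprn_ege1.
have d0 := tail_den_gt0 u.
rewrite /tail_density normrM normfV (gtr0_norm (mulr_gt0 p0 d0)).
rewrite (le_trans (_ : _ <= 1 * (pi * (k ^- (2 * q) + u ^+ (2 * q)))^-1))//.
  by rewrite ler_wpM2r ?invr_ge0 ?(ltW (mulr_gt0 p0 d0))// ler_norml cos_geN1 cos_le1.
rewrite mul1r invfM mulrC [2 / pi]mulrC -mulrA [leRHS]mulrC ler_wpM2r ?invr_ge0 ?(ltW p0)//.
rewrite ler_pdivlMr// mulrC ler_pdivrMr//.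
have : 0 < k ^- (2 * q) by rewrite invr_gt0.
by move: uu u21; move: (u ^+ (2 * q)) (u ^+ 2) (k ^- _) => a b c; lra.
Qed.

Lemma Rint_tail_density x t s : 0 <= s ->
  k / k ^+ (2 * q) * \int[mu]_(u in `[0, s]%classic) tail_density x t u =
  pi^-1 * \int[mu]_(y in `[0, (k * s)]%classic) (cos (`|x - t| * y) * lorentz q y).
Proof.
move=> s0; have ks0 : 0 <= k * s by rewrite mulr_ge0// ltW.
pose g y := cos (`|x - t| * y) * lorentz q y.
have cg : continuous g by exact: continuous_cos_lorentz.
rewrite [in RHS](Rint_scale ks0 k0 cg) [k * s]mulrC mulfK//.
have -> : \int[mu]_(u in `[0, s]%classic) tail_density x t u =
    \int[mu]_(u in `[0, s]%classic) (k ^+ (2 * q) / pi * g (k * u)).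
  by apply: eq_Rintegral => u _; exact: tail_densityE.
rewrite RintegralZl//; last by apply: cont_integrable; exact: continuous_comp_scale.
move: (\int[mu]_(u in _) _) => I.
by move: p0 kpow; move: (k ^+ _) (@pi R) => A P P0 A0; field; rewrite !gt_eqF.
Qed.

(** [Kss] is 1 / pi times the cosine integral over the half-line; y = k_q u turns the part beyond
    k_q into the second term of [K2]. Both sides are compared with the integral up to k_q T as T
    tends to infinity. *)
Lemma Kss_split x t :
  (pi^-1 * \int[mu]_(y in `[0, k]%classic) (cos (`|x - t| * y) * lorentz q y) +
    k / k ^+ (2 * q) * \int[mu]_(u in `[1, +oo[%classic) tail_density x t u)%:C = Kss q x t.
Proof.
have [M HM] := @lorentz_cosine R q q0.
set J := fun s => \int[mu]_(y in `[0, s]%classic) (cos (`|x - t| * y) * lorentz q y).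
set I := \int[mu]_(u in `[1, +oo[%classic) _; rewrite -/(J k).
have ck := @continuous_tail_density x t.
apply/eqP; rewrite -subr_eq0 -normc_eq0 eq_le normc_ge0 andbT.
have kk0 : 0 < k / k ^+ (2 * q) by rewrite divr_gt0.
pose f N := pi^-1 * (M * (pi / 2 - atan (k * (1 + N%:R)))) +
  k / k ^+ (2 * q) * (2 / pi * (pi / 2 - atan (1 * (1 + N%:R)))) : R.
have f0 : (f @ \oo --> (0 : R))%classic.
  have -> : (0 : R) = pi^-1 * (M * 0) + k / k ^+ (2 * q) * (2 / pi * 0) by rewrite !mulr0 addr0.
  apply: cvgD; apply: cvgMr; apply: cvgMr; exact: cvg_atan_tail.
apply: (ler_cvg0D f0) => N _; rewrite addr0 /f mul1r.
set T := 1 + N%:R; have T1 : 1 <= T by rewrite /T lerDl.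
have T0 : 0 <= T by exact: le_trans T1.
have kT0 : 0 <= k * T by rewrite mulr_ge0// ltW.
have h1 := HM x t (k * T) kT0; rewrite -/(J (k * T)) in h1.
have h2 := Rint_tail_split T1 ck (tail_density_bound x t).
set I1 := \int[mu]_(u in `[1, T]%classic) _ in h2.
have E : pi^-1 * J k + k / k ^+ (2 * q) * I1 = pi^-1 * J (k * T).
  rewrite -(Rint_tail_density x t T0) (Rint_split ler01 T1 ck) mulrDr -/I1.
  by rewrite (Rint_tail_density x t ler01) mulr1.
have -> : (pi^-1 * J k + k / k ^+ (2 * q) * I)%:C - Kss q x t =
   (pi^-1)%:C * ((J (k * T))%:C - pi%:C * Kss q x t) + (k / k ^+ (2 * q) * (I - I1))%:C.
  have -> : pi^-1 * J k + k / k ^+ (2 * q) * I =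
    pi^-1 * J (k * T) + k / k ^+ (2 * q) * (I - I1) by rewrite -E; ring.
  move: (k / _ * (I - I1)) (J (k * T)) (Kss q x t) => b j z.
  have -> : (pi^-1 * j + b)%:C = (pi^-1)%:C * j%:C + b%:C :> C by rewrite rmorphD rmorphM.
  have -> : (pi^-1)%:C = pi%:C^-1 :> C by rewrite fmorphV.
  have P1 : pi%:C != 0 :> C by rewrite fmorph_eq0.
  by move: (pi%:C : C) P1 => P P1; field.
rewrite (le_trans (ler_normcD _ _))// lerD//.
  by rewrite normcM normc_real gtr0_norm ?invr_gt0// ler_wpM2l// invr_ge0 ltW.
by rewrite normc_real normrM (gtr0_norm kk0) ler_wpM2l// ltW.
Qed.

Lemma kpow_pred : k ^+ (2 * q - 1) = k ^+ (2 * q) / k.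
Proof.
have -> : (2 * q = (2 * q - 1).+1)%N by rewrite subn1 prednK// muln_gt0.
by rewrite subn1 /= exprSr mulfK.
Qed.

Lemma K2E x t : K2 q K lambda x t =
  k ^+ (2 * q) / k * complex.Re (cintegral `[0, (k / 2)]%classic
    (fun v => (2 / pi)%:C * defect x t v)) -
  \int[mu]_(u in `[1, +oo[%classic) tail_density x t u.
Proof.
rewrite /K2 kpow_pred; congr (_ * complex.Re _ - _).
by apply: eq_cint => v; exact: rq_defect.
Qed.

Lemma kernel_large x t :
  (cst2 q K lambda)%:C * eqkernel q K lambda (cst2 q K lambda * x) (cst2 q K lambda * t) =
  Kss q x t + (k ^ (1 - (2 * q)%N%:Z) * K2 q K lambda x t)%:C.
Proof.
have kE : k ^ (1 - (2 * q)%N%:Z) = k / k ^+ (2 * q) by rewrite expfzDr// expr1z -exprnN.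
rewrite kernel_scaled -Kss_split kE K2E -rmorphD; apply: (congr1 (real_complex R)).
have -> : cintegral `[0, (k / 2)]%classic (fun v => (2 / pi)%:C * defect x t v) =
  (pi^-1)%:C * (cintegral `[0, (k / 2)]%classic (fun v => 2 * scaled_density x t v) +
   -1 * cintegral `[0, (k / 2)]%classic (fun v => 2 * (osc x t v * (lorentz q (2 * v))%:C))).
  have c2 : ccont (fun v => 2 * (osc x t v * (lorentz q (2 * v))%:C)).
    by apply: ccontM; [exact: ccont_cst|exact: ccont_osc_lorentz].
  have c1 : ccont (fun v => 2 * scaled_density x t v).
    by apply: ccontM; [exact: ccont_cst|exact: ccont_scaled_density].
  have c3 : ccont (fun v => -1 * (2 * (osc x t v * (lorentz q (2 * v))%:C))).
    by apply: ccontM => //; exact: ccont_cst.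
  rewrite -cintZ// -cintD// -cintZ; last exact: ccontD.
  apply: eq_cint => v _; rewrite /defect rmorphM rmorph_nat /=; ring.
rewrite cReMl cReD mulN1r cReN Re_osc_lorentz.
move: (complex.Re _) (\int[mu]_(y in _) _) (\int[mu]_(u in _) _) => A B D.
by move: k_neq0 kpow p_neq0; move: (k ^+ _) (@pi R) => a P k' a0 P'; field; rewrite P' k' gt_eqF.
Qed.

(** The first summand comes from [phi_prod_near]; the second is the constant of [pen_near] times
    that of [pen_lower] and the bound of [phi_prod]. *)
Definition defect_const : R :=
  3 * 8 ^+ (2 * q) * 3 ^+ (4 * q) +
  3 ^+ (4 * q) * 3 ^+ (4 * q) * (2 * 8 ^+ (2 * q) * 3 ^+ (4 * q)).

(** With a = (2v)^(2q) and b the penalty term, f / (1 + b) - o / (1 + a) is 1 / (1 + a) times (f -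
    o) + f (a - b) / (1 + b). Both summands are O(u^(2q)), the second since |a - b| is O(u^(2q) a)
    and a <= 3^(4q) b. Finally u^(2q) = k^(-2q) v^(2q), and v^(2q) <= 1 + a. *)
Lemma normc_defect x t v : 0 <= v <= k / 2 ->
  normc (defect x t v) <= defect_const * k ^- (2 * q).
Proof.
move=> /andP[v0 v2]; set u := k^-1 * v.
have u02 : 0 <= u <= 2^-1.
  apply/andP; split; first exact: mulr_ge0 (ltW kV0) v0.
  by rewrite /u mulrC ler_pdivrMr// mulrC.
have vE : v = k * u by rewrite /u mulrA mulfV// mul1r.
have h1 := phi_prod_near q0 u02 (k / pi * x) (k / pi * t).
have h2 := pen_near q0 u02; have h3 := pen_lower q0 u02.
have h4 := normc_phi_prod q0 (k / pi * x) (k / pi * t) u.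
have h5 := pen_ge0 q0 u.
rewrite /defect /scaled_density -/u /lorentz.
have oE : osc x t v = cis (2 * pi * u * (k / pi * t - k / pi * x)).
  rewrite oscE vE; congr cis; move: k_neq0 p_neq0; move: (@pi R) => P k' P'; field; exact: P'.
have aE : (2 * v) ^+ (2 * q) = k ^+ (2 * q) * (2 * u) ^+ (2 * q).
  by rewrite vE mulrCA exprMn.
have uE : u ^+ (2 * q) * k ^+ (2 * q) = v ^+ (2 * q) by rewrite -exprMn [u * k]mulrC -vE.
have va : v ^+ (2 * q) <= (2 * v) ^+ (2 * q).
  rewrite lerXn2r ?nnegrE ?mulr_ge0//; lra.
rewrite -oE in h1; move: (osc x t v) h1 => o h1.
set a := (2 * v) ^+ (2 * q) in aE va *; set b := k ^+ (2 * q) * pen q u.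
have a0 : 0 <= a by exact: e2.
have b0 : 0 <= b by rewrite mulr_ge0// ltW.
have ab : a <= 3 ^+ (4 * q) * b by rewrite aE /b [leRHS]mulrCA ler_wpM2l// ltW.
set w := u ^+ (2 * q) in h1 h2 uE; have w0 : 0 <= w by exact: e2.
have abw : `|a - b| <= 2 * 8 ^+ (2 * q) * 3 ^+ (4 * q) * w * a.
  rewrite aE /b -mulrBr normrM (gtr0_norm kpow) [leRHS]mulrCA ler_wpM2l ?(ltW kpow)//.
  by rewrite distrC.
move: (phi_prod _ _ _ _) h1 h4 => f h1 h4.
have A0 : 0 < 1 + a by rewrite ltr_pwDl.
have B0 : 0 < 1 + b by rewrite ltr_pwDl.
have A1 : (1 + a)%:C != 0 :> C by rewrite fmorph_eq0 gt_eqF.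
have B1 : (1 + b)%:C != 0 :> C by rewrite fmorph_eq0 gt_eqF.
have -> : f / (1 + b)%:C - o * ((1 + a)^-1)%:C =
  ((1 + a)^-1)%:C * ((f - o) + ((a - b) / (1 + b))%:C * f).
  have -> : ((1 + a)^-1)%:C = (1 + a)%:C^-1 :> C by rewrite fmorphV.
  have -> : ((a - b) / (1 + b))%:C = ((1 + a)%:C - (1 + b)%:C) / (1 + b)%:C :> C.
    by rewrite -rmorphB -fmorphV -rmorphM /=; congr (_%:C); congr (_ / _); ring.
  by move: A1 B1; move: ((1 + a)%:C : C) ((1 + b)%:C : C) => X Y X0 Y0; field; rewrite X0 Y0.
rewrite normcM normc_real (gtr0_norm (_ : 0 < (1 + a)^-1)) ?invr_gt0//.
rewrite mulrC ler_pdivrMr//.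
have c80 : 0 <= 2 * 8 ^+ (2 * q) * 3 ^+ (4 * q) * w by rewrite mulr_ge0// !mulr_ge0// exprn_ge0.
have c30 : 0 <= 3 ^+ (4 * q) :> R by rewrite exprn_ge0.
have ab1 : `|(a - b) / (1 + b)| <= 2 * 8 ^+ (2 * q) * 3 ^+ (4 * q) * w * 3 ^+ (4 * q).
  rewrite normrM normfV (gtr0_norm B0) ler_pdivrMr// (le_trans abw)// -[leRHS]mulrA.
  by rewrite ler_wpM2l// (le_trans ab)// ler_wpM2l// lerDr.
have main : normc (f - o + ((a - b) / (1 + b))%:C * f) <= defect_const * w.
  rewrite /defect_const [leRHS]mulrDl (le_trans (ler_normcD _ _))// lerD//.
  rewrite normcM normc_real (le_trans (ler_pM _ _ ab1 h4)) ?normc_ge0//.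
  by rewrite le_eqVlt; apply/orP; left; apply/eqP; ring.
have dc0 : 0 <= defect_const by rewrite addr_ge0// !mulr_ge0// exprn_ge0.
rewrite (le_trans main)// -mulrA ler_wpM2l// mulrC ler_pdivlMr// uE.
by rewrite (le_trans va)// lerDr.
Qed.

(** The factors k^(2q-1), k^(-2q) and the length k / 2 leave half of [defect_const]; the improper
    integral is at most (2 / pi)(pi / 2 - atan 1) = 1/2. *)
Lemma K2_bounded x t : `|K2 q K lambda x t| <= defect_const + 1.
Proof.
have dc0 : 0 <= defect_const by rewrite addr_ge0// !mulr_ge0// exprn_ge0.
have P2 : 2 / pi <= 1 :> R by rewrite ler_pdivrMr// mul1r; exact: pi_ge2.
have P20 : 0 <= 2 / pi :> R by rewrite divr_ge0// ltW.
rewrite K2E (le_trans (ler_normB _ _))// lerD//.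
  have cd : ccont (fun v => (2 / pi)%:C * defect x t v).
    by apply: ccontM; [exact: ccont_cst|exact: ccont_defect].
  have H v : 0 <= v <= k / 2 -> normc ((2 / pi)%:C * defect x t v) <= defect_const * k ^- (2 * q).
    move=> /normc_defect h; rewrite normcM normc_real (ger0_norm P20) -[leRHS]mul1r.
    by rewrite ler_pM ?normc_ge0.
  have := Re_cint_bound half0 cd H; rewrite subr0.
  move: (complex.Re _) => A hA.
  have kk : 0 < k ^+ (2 * q) / k by rewrite divr_gt0.
  rewrite normrM (gtr0_norm kk) (le_trans (ler_wpM2l (ltW kk) hA))//.
  have -> : k ^+ (2 * q) / k * (defect_const * k ^- (2 * q) * (k / 2)) = defect_const / 2.
    have : k ^+ (2 * q) != 0 by rewrite gt_eqF.
    move: defect_const k_neq0; move: (k ^+ _) => a d; move: (k) => k' k'0 a0.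
    by field; rewrite k'0 a0.
  by rewrite ler_piMr// invf_le1//; lra.
rewrite (le_trans (Rint_tail_bound (@continuous_tail_density x t) (tail_density_bound x t)))//.
have -> : 2 / pi * (pi / 2 - atan 1) = 2^-1 :> R.
  by rewrite atan1; move: p_neq0; move: (@pi R) => P P'; field.
lra.
Qed.

End LargeBandwidth.

(** M is quantified before K and lambda, so the remainders are bounded uniformly in these as well as
    in x and t. *)
Theorem theorem1 (R : realType) (q : nat) (hq : (0 < q)%N) :
  exists M : R, forall (K : nat) (lambda : R), (0 < K)%N -> 0 <= lambda ->
    let k := kq q K lambda in
    let c1 := cst1 q K lambda in
    let c2 := cst2 q K lambda in
    (k < 1 -> forall x t : R,
       c1%:C * eqkernel q K lambda (c1 * x) (c1 * t) =
         Krs q x t - (k ^+ (2 * q) * K1 q K lambda x t)%:C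
       /\ `|K1 q K lambda x t| <= M) /\
    (1 <= k -> forall x t : R,
       c2%:C * eqkernel q K lambda (c2 * x) (c2 * t) =
         Kss q x t + (k ^ (1 - (2 * q)%N%:Z) * K2 q K lambda x t)%:C
       /\ `|K2 q K lambda x t| <= M).
Proof.
have M1 : 0 <= 3 ^+ (4 * q) * 3 ^+ (4 * q) :> R by rewrite mulr_ge0// exprn_ge0.
have M2 : 0 <= defect_const R q + 1 by rewrite !addr_ge0// !mulr_ge0// exprn_ge0.
exists (3 ^+ (4 * q) * 3 ^+ (4 * q) + (defect_const R q + 1)) => K lambda K0 l0 /=.
split=> [_ | k1] x t; split.
- exact: kernel_small.
- by rewrite (le_trans (K1_bounded _ _ _ _ _))// lerDl.
- exact: kernel_large.
- by rewrite (le_trans (K2_bounded _ _ _ _ _ _))// lerDr.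
Qed.
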